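(* Let $n\ge 1$, $1\le i\le n$ and $m\in\mathbb Z_{\ge 0}$. The map $pr$ on $B^{m,i}$ is Schützenberger's promotion operator. That is, $pr$ maps $B^{m,i}$ to itself, and if $\Phi:B^{m,i}\to \mathrm{SSYT}_{m,i}$ denotes the (unique) isomorphism of $A_n$-crystals from $B^{m,i}$ to the crystal $\mathrm{SSYT}_{m,i}\cong B(m\omega_i)$ of semistandard Young tableaux of rectangular shape with $i$ rows and $m$ columns, then $\Phi\circ pr=pr_S\circ\Phi$, where $pr_S$ is Schützenberger's promotion operator on $\mathrm{SSYT}_{m,i}$.
   Context: Notation for $\mathfrak{sl}_{n+1}$ (type $A_n$): $I=\{1,\dots,n\}$, simple roots $\alpha_l$, fundamental weights $\omega_l$, $\alpha_{p,q}=\alpha_p+\cdots+\alpha_q$ for $1\le p\le q\le n$; $B(m\omega_i)$ is the crystal of the irreducible $U_q(\mathfrak{sl}_{n+1})$-module of highest weight $m\omega_i$. The set $B^{m,i}$: all arrays $A=(a_{p,q})_{1\le p\le i,\ i\le q\le n}$ of non-negative integers ($p$ = column index, $q$ = row index) such that $\sum_{s=1}^k a_{\beta(s)}\le m$ for every sequence (Dyck path) $\beta(1),\dots,\beta(k)$, $k\ge1$, of index pairs with $\beta(1)=(1,i)$, $\beta(k)=(i,n)$, and such that $\beta(s)=(p,q)$ implies $\beta(s+1)\in\{(p,q+1),(p+1,q)\}$. Its weight map is $\operatorname{wt}(A)=m\omega_i-\sum_{1\le p\le i\le q\le n}a_{p,q}\alpha_{p,q}$. Auxiliary integers. For $l>i$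 put $S_l(p)=\sum_{j=1}^{p}a_{j,l-1}+\sum_{j=p}^{i}a_{j,l}$ for $1\le p\le i$; let $p_+^l(A)$ (resp. $q_+^l(A)$) be the smallest (resp. largest) $p\in\{1,\dots,i\}$ at which $S_l$ is maximal. For $l<i$ put $T_l(p)=\sum_{j=i}^{p}a_{l,j}+\sum_{j=p}^{n}a_{l+1,j}$ for $i\le p\le n$; let $p_-^l(A)$ (resp. $q_-^l(A)$) be the largest (resp. smallest) $p\in\{i,\dots,n\}$ at which $T_l$ is maximal. Maps $\varphi_l,\epsilon_l$ ($l\in I$): $\varphi_i(A)=m-\sum_{j=1}^{i-1}a_{j,i}-\sum_{j=i}^{n}a_{i,j}$, $\epsilon_i(A)=a_{i,i}$; for $l>i$ with $p=p_+^l(A)$, $q=q_+^l(A)$: $\varphi_l(A)=\sum_{j=1}^{p}a_{j,l-1}-\sum_{j=1}^{p-1}a_{j,l}$, $\epsilon_l(A)=\sum_{j=q}^{i}a_{j,l}-\sum_{j=q+1}^{i}a_{j,l-1}$; for $l<i$ with $p=p_-^l(A)$, $q=q_-^l(A)$: $\varphi_l(A)=\sum_{j=p}^{n}a_{l+1,j}-\sum_{j=p+1}^{n}a_{l,j}$, $\epsilon_l(A)=\sum_{j=i}^{q}a_{l,j}-\sum_{j=i}^{q-1}a_{l+1,j}$. Kashiwara operators: $\tilde f_lA=0$ if $\varphi_l(A)=0$, $\tilde e_lA=0$ if $\epsilon_l(A)=0$. Otherwise: $\tilde f_i$ replaces $a_{i,i}$ by $a_{i,i}+1$; $\tilde e_i$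 replaces $a_{i,i}$ by $a_{i,i}-1$; for $l>i$: $\tilde f_l$ decreases $a_{p,l-1}$ by 1 and increases $a_{p,l}$ by 1, where $p=p_+^l(A)$; $\tilde e_l$ increases $a_{q,l-1}$ by 1 and decreases $a_{q,l}$ by 1, where $q=q_+^l(A)$; for $l<i$: $\tilde f_l$ increases $a_{l,p}$ by 1 and decreases $a_{l+1,p}$ by 1, where $p=p_-^l(A)$; $\tilde e_l$ decreases $a_{l,q}$ by 1 and increases $a_{l+1,q}$ by 1, where $q=q_-^l(A)$. All other entries are unchanged. With these maps $B^{m,i}$ is a crystal of type $A_n$ isomorphic to $B(m\omega_i)$. The map $pr$. For two columns $x=(x_r)_{s\le r\le n}$, $y=(y_r)_{s\le r\le n}$ let $q_-(x,y)$ be the smallest $p\in\{s,\dots,n\}$ at which $\sum_{r=s}^{p}x_r+\sum_{r=p}^{n}y_r$ is maximal, and $\epsilon(x,y)=\sum_{r=s}^{q}x_r-\sum_{r=s}^{q-1}y_r$ with $q=q_-(x,y)$. For $x=(x_i,\dots,x_n)$ write $x^{\ge r}=(x_r,\dots,x_n)$ and $x^{>r}=x^{\ge r+1}$. Given $A\in B^{m,i}$ let $\mathbf a_j=(a_{j,i},\dots,a_{j,n})$ be its $j$-th column. The array $pr(A)=(pr(a_{p,q}))_{1\le p\le i\le q\le n}$ is computed as follows. Put $c^{(i)}=\mathbf a_i$. For $k=i,i-1,\dots,2$ (in this order; no steps if $i=1$) set $x=\mathbf a_{k-1}$, $y=c^{(k)}$, $l_0=i-1$, and define inductively $l_j=q_-(x^{>l_{j-1}},y^{>l_{j-1}})$,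 stopping at the index $t$ with $l_t=n$. The $k$-th column of $pr(A)$ is: $pr(a_{k,i})=\epsilon(x,y)$; $pr(a_{k,r})=\epsilon(x^{\ge r},y^{\ge r})$ if $r-1\in\{l_1,\dots,l_{t-1}\}$; and $pr(a_{k,r})=y_{r-1}$ for all other $r$. The next auxiliary column is: $c^{(k-1)}_r=x_r+y_r-\epsilon(x^{>r},y^{>r})$ if $r\in\{l_1,\dots,l_{t-1}\}$; $c^{(k-1)}_n=x_n+y_n$; and $c^{(k-1)}_r=x_r$ for all other $r$. Finally the first column is: $pr(a_{1,i})=m-\sum_{j=i}^{n}a_{i,j}-\sum_{j=2}^{i}pr(a_{j,i})$ and $pr(a_{1,r})=\sum_{j=1}^{i}a_{j,r-1}-\sum_{j=2}^{i}pr(a_{j,r})$ for $r>i$. Tableaux crystal: $\mathrm{SSYT}_{m,i}$ is the set of semistandard Young tableaux with $i$ rows and $m$ columns (rows weakly increasing, columns strictly increasing from top to bottom) and entries in $\{1,\dots,n+1\}$, with the usual $A_n$-crystal structure: read the columns from right to left and each column from top to bottom, write $+$ for each $l$ and $-$ for each $l+1$, cancel successively pairs $(+,-)$ to obtain $-\cdots-+\cdots+$; $\tilde f_l$ changes the letter $l$ of the leftmost remaining $+$ to $l+1$ (and is $0$ if there is none), $\tilde e_l$ changes the letter $l+1$ of the rightmost remaining $-$ to $l$ (and is $0$ if there is none). Schützenberger's promotion operator $pr_S$: remove all letters $n+1$, slide the remaining entries into the vacated boxes by jeu-de-taquin (process the vacated boxes from left to right; repeatedly move into the hole the larger of the entries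 immediately above and to the left, in case of equality the one above, until neither exists), add 1 to all remaining entries, and fill the resulting empty boxes with 1's. *)

(* Defs.v *)
From mathcomp Require Import all_boot all_order all_algebra.
Set Implicit Arguments.
Unset Strict Implicit.
Unset Printing Implicit Defensive.
Import Order.TTheory GRing.Theory Num.Theory.
Local Open Scope ring_scope.

Definition argmaxs (F : nat -> int) (a b : nat) : seq nat :=
  [seq p <- index_iota a b.+1 | all (fun q => F q <= F p) (index_iota a b.+1)].

(* Smallest and largest point of {a, ..., b} at which F is maximal; both are
   junk (0) only when b < a. *)
Definition min_argmax (F : nat -> int) (a b : nat) : nat :=
  head 0%N (argmaxs F a b).
Definition max_argmax (F : nat -> int) (a b : nat) : nat :=
  last 0%N (argmaxs F a b).

Section Weights.
Variable n : nat.

(* Integral weights of type A_n, by their coordinates on the fundamental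
   weights: the entry of index j : 'I_n is the coefficient of omega_{j+1}.
   In particular omega 0 = omega n.+1 = 0. *)
Definition weight := 'rV[int]_n.

Definition omega (l : nat) : weight := \row_j (j.+1 == l)%:R.

Definition alpha (l : nat) : weight :=
  omega l *+ 2 - omega l.-1 - omega l.+1.

Definition alphapq (p q : nat) : weight := \sum_(p <= l < q.+1) alpha l.

End Weights.

(* The data of a crystal of type A_n: the elements are the x : carrier with
   elts x, and None plays the role of the extra element 0. *)
Record crystal (n : nat) := Crystal {
  carrier : Type;
  elts : carrier -> Prop;
  wt : carrier -> weight n;
  eps : nat -> carrier -> int;
  phi : nat -> carrier -> int;
  etilde : nat -> carrier -> option carrier;
  ftilde : nat -> carrier -> option carrier
}.

Definition crystal_iso (n : nat) (B C : crystal n)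
    (Phi : carrier B -> carrier C) : Prop :=
  [/\ [/\ forall x, elts x -> elts (Phi x),
          forall x y, elts x -> elts y -> Phi x = Phi y -> x = y
        & forall z, elts z -> exists2 x, elts x & Phi x = z],
      forall x, elts x -> wt (Phi x) = wt x,
      forall l x, (1 <= l <= n)%N -> elts x ->
        eps l (Phi x) = eps l x /\ phi l (Phi x) = phi l x
    & forall l x, (1 <= l <= n)%N -> elts x ->
        etilde l (Phi x) = omap Phi (etilde l x) /\
        ftilde l (Phi x) = omap Phi (ftilde l x)].

Section Arrays.
Variables n i m : nat.

(* Throughout, 1 <= i <= n.  Entries are integers, so that subtractions are
   the genuine ones.  The matrix entry in row r and column c (both counted from
   0) is a_{c+1,i+r}. *)
Definition array := 'M[int]_(n.+1 - i, i).

(* entry A p q is a_{p,q} if 1 <= p <= i <= q <= n, and 0 otherwise. *)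
Definition entry (A : array) (p q : nat) : int :=
  \sum_(r < n.+1 - i | (i + r)%N == q) \sum_(c < i | c.+1 == p) A r c.

Definition mk_array (F : nat -> nat -> int) : array :=
  \matrix_(r, c) F c.+1 (i + r)%N.

Definition dyck_step (b b' : nat * nat) : bool :=
  (b' == (b.1, b.2.+1)) || (b' == (b.1.+1, b.2)).

Definition dyck_path (s : seq (nat * nat)) : bool :=
  if s is b :: s' then
    [&& b == (1%N, i), path dyck_step b s' & last b s' == (i, n)]
  else false.

Definition in_Bmi (A : array) : Prop :=
  (forall r c, 0 <= A r c) /\
  (forall s, dyck_path s -> \sum_(b <- s) entry A b.1 b.2 <= m%:Z).

Definition array_wt (A : array) : weight n :=
  omega n i *+ m -
  \sum_(1 <= p < i.+1) \sum_(i <= q < n.+1) alphapq n p q *~ entry A p q.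

Definition Sl (A : array) (l p : nat) : int :=
  \sum_(1 <= j < p.+1) entry A j l.-1 + \sum_(p <= j < i.+1) entry A j l.

Definition Tl (A : array) (l p : nat) : int :=
  \sum_(i <= j < p.+1) entry A l j + \sum_(p <= j < n.+1) entry A l.+1 j.

Definition p_plus (A : array) (l : nat) : nat := min_argmax (Sl A l) 1 i.
Definition q_plus (A : array) (l : nat) : nat := max_argmax (Sl A l) 1 i.
Definition p_minus (A : array) (l : nat) : nat := max_argmax (Tl A l) i n.
Definition q_minus (A : array) (l : nat) : nat := min_argmax (Tl A l) i n.

Definition array_phi (l : nat) (A : array) : int :=
  if l == i then
    m%:Z - \sum_(1 <= j < i) entry A j i - \sum_(i <= j < n.+1) entry A i j
  else if (i < l)%N then
    let p := p_plus A l in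
    \sum_(1 <= j < p.+1) entry A j l.-1 - \sum_(1 <= j < p) entry A j l
  else
    let p := p_minus A l in
    \sum_(p <= j < n.+1) entry A l.+1 j - \sum_(p.+1 <= j < n.+1) entry A l j.

Definition array_eps (l : nat) (A : array) : int :=
  if l == i then entry A i i
  else if (i < l)%N then
    let q := q_plus A l in
    \sum_(q <= j < i.+1) entry A j l - \sum_(q.+1 <= j < i.+1) entry A j l.-1
  else
    let q := q_minus A l in
    \sum_(i <= j < q.+1) entry A l j - \sum_(i <= j < q) entry A l.+1 j.

Definition add_entry (p q : nat) (z : int) (A : array) : array :=
  mk_array (fun p' q' => entry A p' q' + (if (p', q') == (p, q) then z else 0)).

Definition array_f (l : nat) (A : array) : option array :=
  if array_phi l A == 0 then None
  else if l == i then Some (add_entry i i 1 A)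
  else if (i < l)%N then
    let p := p_plus A l in
    Some (add_entry p l 1 (add_entry p l.-1 (-1) A))
  else
    let p := p_minus A l in
    Some (add_entry l.+1 p (-1) (add_entry l p 1 A)).

Definition array_e (l : nat) (A : array) : option array :=
  if array_eps l A == 0 then None
  else if l == i then Some (add_entry i i (-1) A)
  else if (i < l)%N then
    let q := q_plus A l in
    Some (add_entry q l (-1) (add_entry q l.-1 1 A))
  else
    let q := q_minus A l in
    Some (add_entry l.+1 q 1 (add_entry l q (-1) A)).

Definition Bmi : crystal n :=
  Crystal in_Bmi array_wt array_eps array_phi array_e array_f.

End Arrays.

Section PrMap.
Variables n i m : nat.

(* A column is a function of the row index; only its values at s, ..., n are
   used by colq s and coleps s, so that colq s x y is
   q_-(x^{>= s}, y^{>= s}) and coleps s x y is eps(x^{>= s}, y^{>= s}). *)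
Definition colq (s : nat) (x y : nat -> int) : nat :=
  min_argmax (fun p => \sum_(s <= r < p.+1) x r + \sum_(p <= r < n.+1) y r) s n.

Definition coleps (s : nat) (x y : nat -> int) : int :=
  let q := colq s x y in \sum_(s <= r < q.+1) x r - \sum_(s <= r < q) y r.

(* If l_{j-1} = s - 1, this is the list l_j, ..., l_{t-1}, the final l_t = n
   being left out; since l_j > l_{j-1}, fuel n is enough when s >= 1. *)
Fixpoint cuts_from (fuel s : nat) (x y : nat -> int) : seq nat :=
  if fuel is fuel'.+1 then
    let l := colq s x y in
    if l == n then [::] else l :: cuts_from fuel' l.+1 x y
  else [::].

Definition cuts (x y : nat -> int) : seq nat := cuts_from n i x y.

Definition pr_column (x y : nat -> int) (r : nat) : int :=
  if r == i then coleps i x y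
  else if r.-1 \in cuts x y then coleps r x y
  else y r.-1.

Definition next_column (x y : nat -> int) (r : nat) : int :=
  if r \in cuts x y then x r + y r - coleps r.+1 x y
  else if r == n then x n + y n
  else x r.

(* aux_column_rec A d is the auxiliary column c^{(i-d)}. *)
Fixpoint aux_column_rec (A : array n i) (d : nat) : nat -> int :=
  if d is d'.+1 then next_column (entry A (i - d)) (aux_column_rec A d')
  else entry A i.

Definition aux_column (A : array n i) (k : nat) : nat -> int :=
  aux_column_rec A (i - k).

Definition pr_entry (A : array n i) (k r : nat) : int :=
  if (2 <= k)%N then pr_column (entry A k.-1) (aux_column A k) r
  else
    let col j := pr_column (entry A j.-1) (aux_column A j) in
    if r == i then
      m%:Z - \sum_(i <= j < n.+1) entry A i j - \sum_(2 <= j < i.+1) col j i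
    else
      \sum_(1 <= j < i.+1) entry A j r.-1 - \sum_(2 <= j < i.+1) col j r.

Definition pr (A : array n i) : array n i := mk_array n i (pr_entry A).

End PrMap.

Section Tableaux.
Variables n i m : nat.

Definition tableau := 'M[nat]_(i, m).

Definition is_ssyt (T : tableau) : Prop :=
  [/\ forall r c, (1 <= T r c <= n.+1)%N,
      forall r (c c' : 'I_m), (c <= c')%N -> (T r c <= T r c')%N
    & forall (r r' : 'I_i) c, (r < r')%N -> (T r c < T r' c)%N].

Definition tableau_wt (T : tableau) : weight n :=
  \sum_(r < i) \sum_(c < m) (omega n (T r c) - omega n (T r c).-1).

Definition reading : seq ('I_i * 'I_m) :=
  [seq (r, c) | c <- rev (enum 'I_m), r <- enum 'I_i].

(* Signed boxes: true is + (letter l) and false is - (letter l+1). *)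
Definition signature (l : nat) (T : tableau) : seq (bool * ('I_i * 'I_m)) :=
  [seq (T b.1 b.2 == l, b)
     | b <- reading & (T b.1 b.2 == l) || (T b.1 b.2 == l.+1)].

(* Prepending a box to an already reduced word -...-+...+ . *)
Definition cons_cancel (x : bool * ('I_i * 'I_m))
    (w : seq (bool * ('I_i * 'I_m))) : seq (bool * ('I_i * 'I_m)) :=
  if x.1 && ~~ head true (unzip1 w) then behead w else x :: w.

Definition reduced (l : nat) (T : tableau) : seq (bool * ('I_i * 'I_m)) :=
  foldr cons_cancel [::] (signature l T).

Definition plus_boxes (l : nat) (T : tableau) : seq ('I_i * 'I_m) :=
  [seq x.2 | x <- reduced l T & x.1].
Definition minus_boxes (l : nat) (T : tableau) : seq ('I_i * 'I_m) :=
  [seq x.2 | x <- reduced l T & ~~ x.1].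

Definition tableau_phi (l : nat) (T : tableau) : int := (size (plus_boxes l T))%:Z.
Definition tableau_eps (l : nat) (T : tableau) : int := (size (minus_boxes l T))%:Z.

Definition set_box (b : 'I_i * 'I_m) (z : nat) (T : tableau) : tableau :=
  \matrix_(r, c) if (r, c) == b then z else T r c.

Definition tableau_f (l : nat) (T : tableau) : option tableau :=
  if plus_boxes l T is b :: _ then Some (set_box b l.+1 T) else None.

Definition tableau_e (l : nat) (T : tableau) : option tableau :=
  if minus_boxes l T is b :: s then Some (set_box (last b s) l T) else None.

Definition SSYT : crystal n :=
  Crystal is_ssyt tableau_wt tableau_eps tableau_phi tableau_e tableau_f.

(* Partial filling: row and column are counted from 0; None is an empty box or
   a position outside the rectangle. *)
Definition filling := nat -> nat -> option nat.

Definition upd (t : filling) (r c : nat) (v : option nat) : filling :=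
  fun r' c' => if (r' == r) && (c' == c) then v else t r' c'.

(* Jeu de taquin slide of the hole (r, c); the hole makes at most r + c moves,
   so fuel r + c is enough. *)
Fixpoint slide (fuel : nat) (t : filling) (r c : nat) : filling :=
  if fuel is fuel'.+1 then
    let above := if r is r'.+1 then t r' c else None in
    let left := if c is c'.+1 then t r c' else None in
    let move_above := slide fuel' (upd (upd t r c above) r.-1 c None) r.-1 c in
    let move_left := slide fuel' (upd (upd t r c left) r c.-1 None) r c.-1 in
    match above, left with
    | None, None => t
    | Some _, None => move_above
    | None, Some _ => move_left
    | Some a, Some b => if (b <= a)%N then move_above else move_left
    end
  else t.

Definition remove_max (T : tableau) : filling := fun r c =>
  if (insub r : option 'I_i) is Some r' then
    if (insub c : option 'I_m) is Some c' then
      if T r' c' == n.+1 then None else Some (T r' c')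
    else None
  else None.

(* The vacated boxes, from left to right. *)
Definition vacated (T : tableau) : seq ('I_i * 'I_m) :=
  [seq b <- [seq (r, c) | c <- enum 'I_m, r <- enum 'I_i] | T b.1 b.2 == n.+1].

Definition jdt (T : tableau) : filling :=
  foldl (fun (t : filling) (b : 'I_i * 'I_m) => slide (b.1 + b.2) t b.1 b.2)
        (remove_max T) (vacated T).

Definition promotion (T : tableau) : tableau :=
  \matrix_(r, c) if jdt T r c is Some x then x.+1 else 1%N.

End Tableaux.

(* Main.v *)
Require Import Defs.
From mathcomp Require Import all_boot all_order all_algebra.
From mathcomp Require Import zify.
From Stdlib Require Import FunctionalExtensionality.

(** Both sides of the statement are read off from a triangle of integers by
    max-plus recursions, and it is enough to compare the recursions.

    A semistandard tableau with i rows is the same as a Gelfand-Tsetlin pattern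
    x r v, the number of entries at most v in row r ([pattern], [counts]).  For
    an array, turned by half a turn, let the last-passage time lpp be the maximal
    weight of a path from the first cell to a given cell; the condition defining
    B^{m,i} says that no such time exceeds m ([in_BmiP]).  Unfolding the recursive
    choice of the indices l_j shows that pr is a local transformation of lpp,
    namely piecewise-linear rowmotion ([fo_pr]).  The isomorphism [Phi] lets m
    minus the last-passage times of row r, after i-1-r steps of rowmotion, be
    the pattern of a tableau ([nabove], [gtpat]).  It is bijective because
    rowmotion is inverted by measuring paths from the opposite corner
    ([rowmotion_onto], [nabove_inj], [nabove_onto]).

    Crystal operators.  The maximum of S_l or T_l and the bracketing of the
    reading word are one and the same rule, applied to two adjacent lines of
    integers ([pluses], [minuses], [plus_pos], [minus_pos]; [profile_plus_pos]
    for arrays, [tableau_lines] for tableaux).  For l >= i the lines are two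
    adjacent rows of the array, for l < i two adjacent columns, and for a
    tableau they are the numbers of letters l and l+1 in each row.  A step of
    rowmotion replaces a pair of adjacent lines by the next pair, and this
    keeps the signature and commutes with the operators ([pluses_output],
    [pass_lower], [pass_raise]).  Iterating it leads from the lines of the
    array to those of the tableau ([crystal_rows], [crystal_cols]).

    Promotion.  If z describes the filling left by the slides, one slide adds 1
    to z along a lattice path ([slide_fill]), and whatever the number of slides
    so far, z satisfies the recursion [toggled], which determines it from its
    values at v = n ([toggled_unique]).  The pattern of the rowmotion of an
    array satisfies the same recursion ([nabove_rowmotion], [gtpat_toggled]), so
    [Phi] intertwines pr and promotion.

    Uniqueness.  Every array is reached from one killed by all raising
    operators, and a tableau killed by them all is determined: its row r,
    counted from 0, contains only the letter r+1 ([highest_counts]). *)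

Set Implicit Arguments.
Unset Strict Implicit.
Unset Printing Implicit Defensive.
Import Order.TTheory GRing.Theory Num.Theory.
Local Open Scope ring_scope.

(** * The signature rule on a sequence of blocks *)

(** Signature of a word made of k blocks, the block x being b x minus signs
    followed by a x plus signs, when pairs (+,-) cancel: the numbers of surviving
    signs, the block of the leftmost surviving plus and the block of the
    rightmost surviving minus.  A max-plus recursion is used in place of words
    because the lines of an array have no word attached to them. *)
Fixpoint pluses (b a : nat -> int) (k : nat) : int :=
  if k is k'.+1 then a k' + Num.max 0 (pluses b a k' - b k') else 0.

Fixpoint minuses (b a : nat -> int) (k : nat) : int :=
  if k is k'.+1 then minuses b a k' + Num.max 0 (b k' - pluses b a k') else 0.

Fixpoint plus_pos (b a : nat -> int) (k : nat) : nat :=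
  if k is k'.+1 then if pluses b a k' <= b k' then k' else plus_pos b a k'
  else 0%N.

Fixpoint minus_pos (b a : nat -> int) (k : nat) : nat :=
  if k is k'.+1 then if pluses b a k' < b k' then k' else minus_pos b a k'
  else 0%N.

Lemma sum_ordS (f : nat -> int) k :
  \sum_(x < k.+1) f x = \sum_(x < k) f x + f k.
Proof. by rewrite big_ord_recr. Qed.

Lemma sum_ord_pred (f : nat -> int) k : (0 < k)%N ->
  \sum_(x < k) f x = \sum_(x < k.-1) f x + f k.-1.
Proof. by case: k => // k _; rewrite sum_ordS. Qed.

Lemma sum_ordB (f g : nat -> int) k :
  \sum_(x < k) (f x - g x) = \sum_(x < k) f x - \sum_(x < k) g x.
Proof. exact: sumrB. Qed.

Definition incr (f : nat -> int) (p : nat) (x : nat) : int := f x + (x == p)%:R.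
Definition decr (f : nat -> int) (p : nat) (x : nat) : int := f x - (x == p)%:R.

Lemma plusesS b a k :
  pluses b a k.+1 = a k + Num.max 0 (pluses b a k - b k).
Proof. by []. Qed.

Lemma eq_pluses b a b' a' k :
    (forall x, (x < k)%N -> b x = b' x) -> (forall x, (x < k)%N -> a x = a' x) ->
  [/\ pluses b a k = pluses b' a' k, minuses b a k = minuses b' a' k,
      plus_pos b a k = plus_pos b' a' k & minus_pos b a k = minus_pos b' a' k].
Proof.
elim: k => [//|k IH] hb ha /=.
have [|y yk|-> -> -> ->] := IH; [by move=> y yk; apply: hb; lia|by apply: ha; lia|].
by rewrite !hb ?ha.
Qed.

Lemma pluses_minuses b a k :
  pluses b a k - minuses b a k = \sum_(x < k) (a x - b x).
Proof.
by elim: k => [|k IH]; rewrite ?big_ord0 // (sum_ordS (fun x => a x - b x)) -IH /=; lia.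
Qed.

Lemma minuses_ge0 b a k : 0 <= minuses b a k.
Proof. by elim: k => [//|k IH] /=; lia. Qed.

Lemma pluses_ge0 b a k : (forall x, (x < k)%N -> 0 <= a x) -> 0 <= pluses b a k.
Proof. by case: k => [//|k] h /=; have := h k (leqnn _); lia. Qed.

Lemma plus_pos_lt b a k : (0 < k)%N -> (plus_pos b a k < k)%N.
Proof.
case: k => // k _; elim: k => [|k IH]; first by rewrite /=; case: ifP.
change ((if (pluses b a k.+1 <= b k.+1)%R then k.+1 else plus_pos b a k.+1) < k.+2)%N.
by case: ifP => _; lia.
Qed.

Lemma minus_pos_lt b a k : (0 < k)%N -> (minus_pos b a k < k)%N.
Proof.
case: k => // k _; elim: k => [|k IH]; first by rewrite /=; case: ifP.
change ((if (pluses b a k.+1 < b k.+1)%R then k.+1 else minus_pos b a k.+1) < k.+2)%N.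
by case: ifP => _; lia.
Qed.

Lemma plus_pos_gt0 b a k : (forall x, (x < k)%N -> 0 <= b x) ->
  0 < pluses b a k -> 0 < a (plus_pos b a k).
Proof.
elim: k => [//|k IH] hb /=; have := hb k (leqnn _).
have {}IH : 0 < pluses b a k -> 0 < a (plus_pos b a k).
  by apply: IH => x xk; apply: hb; lia.
by case: ifP => h; [lia | move=> *; apply: IH; lia].
Qed.

Lemma minus_pos_gt0 b a k : (forall x, (x < k)%N -> 0 <= a x) ->
  0 < minuses b a k -> 0 < b (minus_pos b a k).
Proof.
elim: k => [//|k IH] ha /=.
have hp : 0 <= pluses b a k by apply: pluses_ge0 => x xk; apply: ha; lia.
have {}IH : 0 < minuses b a k -> 0 < b (minus_pos b a k).
  by apply: IH => x xk; apply: ha; lia.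
by case: ifP => h; [lia | move=> *; apply: IH; lia].
Qed.

(** The rightmost surviving minus becomes, once turned into a plus, the
    leftmost surviving plus: this is why the two operators are inverse to each
    other. *)
Lemma pluses_raise b a k : let q := minus_pos b a k in 0 < minuses b a k ->
  pluses (decr b q) (incr a q) k = pluses b a k + 1 /\
  plus_pos (decr b q) (incr a q) k = q.
Proof.
elim: k => [//|k IH] /=; case: (ltrP (pluses b a k) (b k)) => h hm.
  have [x xk|x xk|-> _ _ _] := @eq_pluses (decr b k) (incr a k) b a k.
  - by rewrite /decr; lia.
  - by rewrite /incr; lia.
  by rewrite ifT /decr /incr; lia.
have {IH}[|-> ->] := IH; first by lia.
have qk : (minus_pos b a k < k)%N.
  by case: k hm h => [|k] /= hm h; [lia | apply: (@minus_pos_lt b a k.+1)].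
by rewrite ifF /decr /incr; lia.
Qed.

Lemma minuses_lower b a k : let p := plus_pos b a k in 0 < pluses b a k ->
    (forall x, (x < k)%N -> 0 <= b x) ->
  [/\ pluses (incr b p) (decr a p) k = pluses b a k - 1,
      minuses (incr b p) (decr a p) k = minuses b a k + 1 &
      minus_pos (incr b p) (decr a p) k = p].
Proof.
elim: k => [//|k IH] /=; case: (lerP (pluses b a k) (b k)) => h hm hb; have bk := hb k (leqnn _).
  have [x xk|x xk|-> -> _ _] := @eq_pluses (incr b k) (decr a k) b a k.
  - by rewrite /incr; lia.
  - by rewrite /decr; lia.
  by rewrite /decr /incr ifT; [split; lia|lia].
have {IH}[||-> -> ->] := IH; first by lia.
  by move=> x xk; apply: hb; lia.
have qk : (plus_pos b a k < k)%N.
  by case: k hm h {hb} bk => [|k] /= hm h bk; [lia | apply: (@plus_pos_lt b a k.+1)].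
by rewrite /decr /incr ifF; [split; lia|lia].
Qed.

(** * Passing to the next pair of lines *)

(** Last-passage times along a line of cells of weights b, when u gives the
    times along the preceding line. *)
Fixpoint pass (u b : nat -> int) (x : nat) : int :=
  if x is x'.+1 then b x' + Num.max (pass u b x') (u x'.+1) else 0.

Lemma passS u b x : pass u b x.+1 = b x + Num.max (pass u b x) (u x.+1).
Proof. by []. Qed.

(** Rowmotion of the weights of a line whose last-passage times are v, the
    preceding line having times u.  The last cell of a line has no further
    neighbour in the line, hence the second case of [output]. *)
Definition inner (u v : nat -> int) (x : nat) : int :=
  Num.min (v x.+1) (u x.+2) - u x.+1.

Definition output (k : nat) (u v : nat -> int) (x : nat) : int :=
  if (x.+1 < k)%N then inner u v x else v x.+1 - u x.+1.

Lemma eq_pass u b b' k : (forall x, (x < k)%N -> b x = b' x) ->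
  forall x, (x <= k)%N -> pass u b x = pass u b' x.
Proof.
move=> hb; elim=> [//|x IH] xk /=; rewrite hb // IH //; lia.
Qed.

Lemma eq_pass_l u u' b k : (forall x, (x <= k)%N -> u x = u' x) ->
  forall x, (x <= k)%N -> pass u b x = pass u' b x.
Proof.
move=> hb; elim=> [//|x IH] xk /=; rewrite hb // IH //; lia.
Qed.

Section TwoLines.
Variables u b a : nat -> int.
Let v := pass u b.
Let w := pass v a.

(** The two signatures agree up to a boundary term, which is what the last
    cell of the new lines contributes.  Keeping this term explicit is what makes
    the induction on the length go through. *)
Lemma pluses_inner k : 0 <= u 1%N -> (forall x, (x <= k)%N -> 0 <= b x) ->
  pluses b a k.+1 = w k.+1 - v k.+1 +
    Num.max 0 (pluses (inner u v) (inner v w) k - (v k.+1 - u k.+1)).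
Proof.
move=> u1; elim: k => [|k IH] hb.
  by have := hb 0%N (leqnn _); rewrite /w /= /v /=; lia.
have {}IH := IH (fun x xk => hb x (leqW xk)).
have bk := hb k.+1 (leqnn _).
rewrite plusesS {}IH [in RHS]plusesS.
have -> : w k.+2 = a k.+1 + Num.max (w k.+1) (v k.+2) by [].
move: (pluses _ _ k) => D; rewrite /inner.
have -> : v k.+2 = b k.+1 + Num.max (v k.+1) (u k.+2) by [].
lia.
Qed.

Lemma pluses_output k : 0 <= u 1%N -> (forall x, (x < k)%N -> 0 <= b x) ->
  pluses (output k u v) (output k v w) k = pluses b a k.
Proof.
case: k => // k u1 hb; rewrite pluses_inner //= /output ltnn.
by have [||-> _ _ _] := @eq_pluses (output k.+1 u v) (output k.+1 v w)
   (inner u v) (inner v w) k; rewrite /output // => x xk; rewrite ltnS xk.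
Qed.

Lemma sum_inner k : 0 <= u 1%N ->
  \sum_(x < k) inner u v x = \sum_(x < k.+1) b x + u k.+1 - v k.+1.
Proof.
move=> u1; elim: k => [|k IH]; first by rewrite big_ord0 big_ord1 /v /=; lia.
rewrite !sum_ordS IH sum_ordS /inner.
by rewrite -[v k.+2]/(b k.+1 + Num.max (v k.+1) (u k.+2)); lia.
Qed.

End TwoLines.

Lemma sum_output u b k : 0 <= u 1%N ->
  \sum_(x < k) output k u (pass u b) x = \sum_(x < k) b x.
Proof.
case: k => [|k] u1; first by rewrite !big_ord0.
rewrite sum_ordS {2}/output ltnn.
rewrite (eq_bigr (fun x : 'I_k => inner u (pass u b) x)); last first.
  by move=> x _; rewrite /output ltnS ltn_ord.
by rewrite sum_inner // sum_ordS; lia.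
Qed.

(** Either the leftmost surviving plus is still to be found in the last cell,
    and then only the time reached there changes, or it is visible in the
    truncated lines, and then the operator acts there.  The condition of the
    alternative is the one that selects [plus_pos] once the last cell is
    restored. *)
Lemma pass_lower_inner (u b a : nat -> int) k : 0 <= u 1%N ->
    (forall x, (x <= k)%N -> 0 <= b x) -> 0 < pluses b a k.+1 ->
  let p := plus_pos b a k.+1 in
  let v := pass u b in let w := pass v a in
  let v' := pass u (incr b p) in let w' := pass v' (decr a p) in
  let q := plus_pos (inner u v) (inner v w) k in
  (forall x, (x <= k.+1)%N -> w' x = w x) /\
  if pluses (inner u v) (inner v w) k <= v k.+1 - u k.+1
  then v' k.+1 = v k.+1 + 1 /\ forall x, (x < k)%N ->
         inner u v' x = inner u v x /\ inner v' w' x = inner v w x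
  else v' k.+1 = v k.+1 /\ forall x, (x < k)%N ->
         inner u v' x = incr (inner u v) q x /\
         inner v' w' x = decr (inner v w) q x.
Proof.
move=> u1; elim: k => [|k IH] hb.
  have := hb 0%N (leqnn _); rewrite [pluses _ _ _]/= => b0 hp p v w v' w' q.
  have p0 : p = 0%N by rewrite /p /=; case: ifP.
  have ev : v 1%N = b 0%N + Num.max 0 (u 1%N) by [].
  have ev' : v' 1%N = b 0%N + 1 + Num.max 0 (u 1%N) by rewrite /v' /= p0 /incr.
  split; last by rewrite ifT; [split=> [|x] //; lia|rewrite /=; lia].
  case=> [|[|x]] // _.
  rewrite -[w 1%N]/(a 0%N + Num.max 0 (v 1%N)).
  rewrite -[w' 1%N]/(decr a p 0 + Num.max 0 (v' 1%N)).
  by rewrite ev' ev p0 /decr; lia.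
have {}IH := IH (fun x xk => hb x (leqW xk)).
have bk := hb k.+1 (leqnn _).
have EF := @pluses_inner u b a k u1 (fun x xk => hb x (leqW xk)).
move=> hp p v w v' w' q; move: EF; rewrite -/v -/w.
have ew : w k.+2 = a k.+1 + Num.max (w k.+1) (v k.+2) by [].
have ev : v k.+2 = b k.+1 + Num.max (v k.+1) (u k.+2) by [].
have ew' : w' k.+2 = decr a p k.+1 + Num.max (w' k.+1) (v' k.+2) by [].
have ev' : v' k.+2 = incr b p k.+1 + Num.max (v' k.+1) (u k.+2) by [].
have eD := plusesS (inner u v) (inner v w) k.
have eq : q = if pluses (inner u v) (inner v w) k <= inner u v k then k
  else plus_pos (inner u v) (inner v w) k by [].
have ep : p = if pluses b a k.+1 <= b k.+1 then k.+1 else plus_pos b a k.+1 by [].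
rewrite eD; set D := pluses (inner u v) (inner v w) k in eq *.
case: (lerP (pluses b a k.+1) (b k.+1)) ep => [hF ep EF|hF ep EF].
  have hv x : (x <= k.+1)%N -> v' x = v x.
    by move=> xk; apply: (@eq_pass _ _ _ k.+1) => // y yk; rewrite /incr ep; lia.
  have hw x : (x <= k.+1)%N -> w' x = w x.
    move=> xk; rewrite /w' (@eq_pass_l _ v _ k.+1) //.
    by apply: (@eq_pass _ _ _ k.+1) => // y yk; rewrite /decr ep; lia.
  move: ew' ev'; rewrite (hv k.+1) // (hw k.+1) // ep /incr /decr eqxx => ew' ev'.
  split=> [x|].
    by rewrite leq_eqVlt => /orP[/eqP->|/hw//]; lia.
  rewrite ifT; last by rewrite /inner; lia.
  split=> [|x]; first by lia.
  rewrite ltnS leq_eqVlt => /orP[/eqP->|xk]; rewrite /inner.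
    by rewrite (hv k.+1) // (hw k.+1) //; split; lia.
  by rewrite !hv ?(hw x.+1) //; lia.
have F0 : 0 < pluses b a k.+1 by lia.
have pk : (p < k.+1)%N by rewrite ep; apply: plus_pos_lt.
move: (IH F0); cbv zeta; rewrite -ep -/v -/w -/v' -/w' -/D => -[hw].
move: ew' ev'; rewrite (hw k.+1) // /incr /decr (_ : (k.+1 == p) = false); last by lia.
rewrite subr0 addr0 => ew' ev'.
case: (lerP D (v k.+1 - u k.+1)) => hD [hv hin].
  have hw2 : w' k.+2 = w k.+2 by rewrite ew'; lia.
  split=> [x|]; first by rewrite leq_eqVlt => /orP[/eqP->//|/hw].
  case: (lerP (u k.+2) (v k.+1)) => hvu.
    rewrite ifT; last by rewrite /inner; lia.
    split=> [|x]; first by lia.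
    rewrite ltnS leq_eqVlt => /orP[/eqP->|/hin//].
    by rewrite /inner (hw k.+1) //; split; lia.
  rewrite ifF; last by rewrite /inner; lia.
  have -> : q = k by rewrite eq ifT // /inner; lia.
  split=> [|x]; first by lia.
  rewrite ltnS leq_eqVlt => /orP[/eqP->|xk].
    by rewrite /incr /decr /inner (hw k.+1) // eqxx; split; lia.
  by have [-> ->] := hin x xk; rewrite /incr /decr; lia.
have hw2 : w' k.+2 = w k.+2 by rewrite ew'; lia.
split=> [x|]; first by rewrite leq_eqVlt => /orP[/eqP->//|/hw].
have vu : u k.+1 <= v k.+1.
  by have := hb k (leqnSn _); rewrite -[v k.+1]/(b k + Num.max (v k) (u k.+1)); lia.
have qE : q = plus_pos (inner u v) (inner v w) k by rewrite eq ifF // /inner; lia.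
have qk : (q < k)%N.
  by rewrite qE; apply: plus_pos_lt; rewrite lt0n; apply/eqP=> k0; move: hD vu; rewrite /D k0 /=; lia.
rewrite ifF; last by rewrite /inner; lia.
split=> [|x]; first by lia.
rewrite ltnS leq_eqVlt => /orP[/eqP->|/hin]; last by rewrite qE.
by rewrite /incr /decr /inner (hw k.+1) //; split; lia.
Qed.

(** The operator commutes with the passage to the new lines.  The times w after
    both lines are unchanged, so that the rest of the array does not notice the
    move. *)
Lemma pass_lower (u b a : nat -> int) k : 0 <= u 1%N ->
    (forall x, (x < k)%N -> 0 <= b x) -> 0 < pluses b a k ->
  let p := plus_pos b a k in
  let v := pass u b in let w := pass v a in
  let v' := pass u (incr b p) in let w' := pass v' (decr a p) in
  let q := plus_pos (output k u v) (output k v w) k in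
  (forall x, (x <= k)%N -> w' x = w x) /\
  forall x, (x < k)%N -> output k u v' x = incr (output k u v) q x /\
                         output k v' w' x = decr (output k v w) q x.
Proof.
case: k => // k u1 hb hp p v w v' w' q.
move: (@pass_lower_inner u b a k u1 hb hp); cbv zeta.
rewrite -/p -/v -/w -/v' -/w' => -[hw].
have [x xk|x xk|eD _ eq _] := @eq_pluses (output k.+1 u v) (output k.+1 v w)
   (inner u v) (inner v w) k; try by rewrite /output ltnS xk.
have : q = if pluses (inner u v) (inner v w) k <= v k.+1 - u k.+1 then k
  else plus_pos (inner u v) (inner v w) k.
  by rewrite /q /= eD eq {1}/output ltnn.
case: ifP => hD qE [hv hin]; split=> // x; rewrite ltnS leq_eqVlt => /orP[/eqP->|xk].
- by rewrite qE /incr /decr /output ltnn eqxx hw //; split; lia.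
- by rewrite qE /incr /decr /output ltnS xk; have [-> ->] := hin x xk; split; lia.
- have k0 : (0 < k)%N.
    rewrite lt0n; apply/eqP=> k0; move: hD; rewrite k0 /=.
    by have := hb 0%N isT; rewrite /v /=; lia.
  have := plus_pos_lt (inner u v) (inner v w) k0.
  by rewrite qE /incr /decr /output ltnn hw // hv; split; lia.
- by rewrite qE /incr /decr /output ltnS xk; have [-> ->] := hin x xk.
Qed.

Lemma eq_output k u u' v v' x : (x < k)%N ->
  (forall y, (0 < y <= k)%N -> u y = u' y) ->
  (forall y, (0 < y <= k)%N -> v y = v' y) -> output k u v x = output k u' v' x.
Proof.
move=> xk hu hv; rewrite /output /inner; case: ifP => h; rewrite ?hu ?hv //; lia.
Qed.

Lemma sum_outputs u b a k : 0 <= u 1%N -> (forall x, (x < k)%N -> 0 <= b x) ->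
  let v := pass u b in let w := pass v a in
  \sum_(x < k) (output k v w x - output k u v x) = \sum_(x < k) (a x - b x).
Proof.
move=> u1 hb v w; rewrite {}/w {}/v; case: k hb => [|k] hb; first by rewrite !big_ord0.
rewrite !sumrB !sum_output //.
by have := hb 0%N isT; rewrite /=; lia.
Qed.

Lemma minuses_output u b a k : 0 <= u 1%N -> (forall x, (x < k)%N -> 0 <= b x) ->
  let v := pass u b in let w := pass v a in
  minuses (output k u v) (output k v w) k = minuses b a k.
Proof.
move=> u1 hb v w; have := sum_outputs a u1 hb; rewrite /= -!pluses_minuses.
by rewrite pluses_output // -/v -/w; lia.
Qed.

(** Follows from [pass_lower] at the raised lines, because raising is undone
    by lowering ([pluses_raise]). *)
Lemma pass_raise (u b a : nat -> int) k : 0 <= u 1%N ->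
    (forall x, (0 < x < k)%N -> u x <= u x.+1) ->
    (forall x, (x < k)%N -> 0 <= b x) -> (forall x, (x < k)%N -> 0 <= a x) ->
    0 < minuses b a k ->
  let p := minus_pos b a k in
  let v := pass u b in let w := pass v a in
  let v' := pass u (decr b p) in let w' := pass v' (incr a p) in
  let q := minus_pos (output k u v) (output k v w) k in
  (forall x, (x <= k)%N -> w' x = w x) /\
    forall x, (x < k)%N -> output k u v' x = decr (output k u v) q x /\
                         output k v' w' x = incr (output k v w) q x.
Proof.
move=> u1 hu hb ha hm p v w v' w' q.
have bp := minus_pos_gt0 ha hm; rewrite -/p in bp.
have [hF hP] := pluses_raise hm; rewrite -/p in hF hP.
have hb' x : (x < k)%N -> 0 <= decr b p x.
  by move=> xk; have := hb x xk; rewrite /decr; case: eqP => [->|]; lia.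
have ge0 := pluses_ge0 b ha.
have F0 : 0 < pluses (decr b p) (incr a p) k by lia.
have := pass_lower u1 hb' F0; cbv zeta; rewrite hP -/v' -/w'.
have eb : incr (decr b p) p = b by apply: functional_extensionality => x; rewrite /incr /decr; lia.
have ea : decr (incr a p) p = a by apply: functional_extensionality => x; rewrite /incr /decr; lia.
rewrite eb ea -/v -/w => -[hw hout].
split=> [x xk|]; first by rewrite hw.
set B := output k u v' in hout *; set A := output k v' w' in hout *.
set p' := plus_pos B A k in hout.
have B_ge0 x : (x < k)%N -> 0 <= B x.
  move=> xk; rewrite /B /output /inner -[v' x.+1]/(decr b p x + Num.max (v' x) (u x.+1)).
  by have := hb' x xk; case: ifP => xk'; have := hu x.+1; lia.
have FB : 0 < pluses B A k by rewrite /B /A pluses_output.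
have [_ _ ep'] := minuses_lower FB B_ge0.
have [x xk|x xk|_ _ _ eq] := @eq_pluses (output k u v) (output k v w) (incr B p') (decr A p') k.
- by have [] := hout x xk.
- by have [] := hout x xk.
rewrite /q eq ep' => x xk; rewrite /incr /decr; have [-> ->] := hout x xk.
by rewrite /incr /decr -/B -/A; lia.
Qed.

(** * Last-passage times and rowmotion *)

(** Last-passage percolation: the maximal weight of a lattice path from cell
    (0,0) to cell (x-1,y-1).  The shift leaves room for the border values 0. *)
Fixpoint lpp (a : nat -> nat -> int) (x : nat) : nat -> int :=
  if x is x'.+1 then
    fix lpp_x y :=
      if y is y'.+1 then a x' y' + Num.max (lpp a x' y) (lpp_x y') else 0
  else fun _ => 0.

Lemma lppSS a x y :
  lpp a x.+1 y.+1 = a x y + Num.max (lpp a x y.+1) (lpp a x.+1 y).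
Proof. by []. Qed.

Lemma lppx0 a x : lpp a x 0 = 0. Proof. by case: x. Qed.

Lemma lpp_row a x y : lpp a x y.+1 = pass (lpp a ^~ y) (a ^~ y) x.
Proof. by elim: x => [//|x IH]; rewrite lppSS IH. Qed.

Lemma lpp_col a x y : lpp a x.+1 y = pass (lpp a x) (a x) y.
Proof. by elim: y => [//|y IH]; rewrite lppSS IH maxC. Qed.

Arguments lpp : simpl never.

Lemma eq_lpp a b X Y :
    (forall x y, (x < X)%N -> (y < Y)%N -> a x y = b x y) ->
  forall x y, (x <= X)%N -> (y <= Y)%N -> lpp a x y = lpp b x y.
Proof.
move=> eqab; elim=> [//|x IHx]; elim=> [//|y IHy] hx hy.
by rewrite !lppSS eqab // IHx ?IHy //; lia.
Qed.

Definition ge0_on X Y (a : nat -> nat -> int) :=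
  forall x y, (x < X)%N -> (y < Y)%N -> 0 <= a x y.

Lemma lpp_ge0 a X Y x y : ge0_on X Y a -> (x <= X)%N -> (y <= Y)%N ->
  0 <= lpp a x y.
Proof.
move=> a0; elim: x => [//|x IHx]; case: y IHx => [//|y] IHx hx hy; rewrite lppSS.
by have := a0 x y hx hy; have := IHx (ltnW hx) hy; lia.
Qed.

Lemma lpp_incr a X Y x y : ge0_on X Y a -> (x < X)%N -> (y < Y)%N ->
  lpp a x y.+1 <= lpp a x.+1 y.+1 /\ lpp a x.+1 y <= lpp a x.+1 y.+1.
Proof. by move=> a0 hx hy; have := a0 x y hx hy; rewrite lppSS; lia. Qed.

Lemma lpp_mono a X Y x y x' y' : ge0_on X Y a ->
  (x <= x' <= X)%N -> (y <= y' <= Y)%N -> lpp a x y <= lpp a x' y'.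
Proof.
move=> a0 /andP[hx hX] /andP[hy hY].
apply: (@le_trans _ _ (lpp a x' y)).
  elim: x' hx hX => [|x' IH]; first by case: (x).
  rewrite leq_eqVlt => /orP[/eqP-> //|hx hX]; apply: (le_trans (IH _ _)); [lia|lia|].
  case: y hy {IH} => [|y hy]; first by rewrite !lppx0.
  by case: (lpp_incr a0 hX (leq_trans hy hY)).
elim: y' hy hY => [|y' IH]; first by case: (y).
rewrite leq_eqVlt => /orP[/eqP-> //|hy hY]; apply: (le_trans (IH _ _)); [lia|lia|].
case: x' hX {hx IH} => [//|x' hX].
by case: (lpp_incr a0 hX hY).
Qed.

Section Rowmotion.
Variables (N : nat) (m : int).

(** Beyond the border y = N the time is the constant m, which stands for the
    bound on the weights of Dyck paths. *)
Definition lppm (a : nat -> nat -> int) (x y : nat) : int :=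
  if (y <= N)%N then lpp a x y else m.

Definition rowmotion (M : nat) (a : nat -> nat -> int) (x y : nat) : int :=
  (if (x.+1 < M)%N then Num.min (lppm a x.+1 y.+2) (lpp a x.+2 y.+1)
   else lppm a x.+1 y.+2) - lpp a x.+1 y.+1.

Definition valid (M : nat) (a : nat -> nat -> int) : Prop :=
  ge0_on M N a /\ lpp a M N <= m.

Lemma eq_lppm M a b : (forall x y, (x < M)%N -> (y < N)%N -> a x y = b x y) ->
  forall x y, (x <= M)%N -> lppm a x y = lppm b x y.
Proof.
by move=> eqab x y hx; rewrite /lppm; case: ifP => // hy; apply: (eq_lpp eqab).
Qed.

Lemma eq_rowmotion M a b : (forall x y, (x < M)%N -> (y < N)%N -> a x y = b x y) ->
  forall x y, (x < M)%N -> (y < N)%N -> rowmotion M a x y = rowmotion M b x y.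
Proof.
move=> eqab x y hx hy; rewrite /rowmotion (eq_lppm eqab) //.
by case: ifP => hx2; rewrite !(eq_lpp eqab).
Qed.

Lemma rowmotion_step M a x y : (x.+1 < M)%N -> rowmotion M.+1 a x y = rowmotion M a x y.
Proof. by move=> h; rewrite /rowmotion h (ltn_trans h). Qed.

Lemma valid_lpp M a x y : valid M a -> (x <= M)%N -> (y <= N)%N ->
  0 <= lpp a x y <= m.
Proof.
move=> [a0 am] hx hy; rewrite (lpp_ge0 a0) //=.
by apply: le_trans am; apply: (lpp_mono a0); rewrite ?hx ?hy ?leqnn.
Qed.

Lemma eq_valid M a b : (forall x y, (x < M)%N -> (y < N)%N -> a x y = b x y) ->
  valid M a -> valid M b.
Proof.
move=> eqab [a0 am]; split; last by rewrite -(eq_lpp eqab).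
by move=> x y hx hy; rewrite -eqab //; apply: a0.
Qed.

Lemma rowmotion_ge0 M a : valid M a -> ge0_on M N (rowmotion M a).
Proof.
move=> va x y hx hy; rewrite /rowmotion /lppm.
have [a0 _] := va; have := valid_lpp va hx hy.
have := @lpp_mono a M N x.+1 y.+1 x.+1 y.+2 a0.
have := @lpp_mono a M N x.+1 y.+1 x.+2 y.+1 a0.
by case: ifP => h1; case: ifP => h2; lia.
Qed.

(** The new times are at most the old ones one step further in either direction,
    and at most m.  The first inequality is the interlacing of consecutive rows
    of the tableau, the last one says that rowmotion keeps the Dyck condition. *)
Lemma lpp_rowmotion M a x y : valid M a -> (x <= M)%N -> (y <= N)%N ->
  ((x < M)%N -> lpp (rowmotion M a) x y <= lpp a x.+1 y) /\
  ((y < N)%N -> lpp (rowmotion M a) x y <= lpp a x y.+1) /\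
  lpp (rowmotion M a) x y <= m.
Proof.
move=> va; have m0 : 0 <= m by have := valid_lpp va (leqnn M) (leqnn N); lia.
elim: x y => [|x IHx] y hx hy.
  split=> [h|]; last by split=> // h; have /andP[] := valid_lpp va hx h.
  by have /andP[] := valid_lpp va h hy.
elim: y hy => [|y IHy] hy.
  split=> [h|]; first by rewrite lppx0.
  by split=> [h|//]; have /andP[] := valid_lpp va hx h.
have [Hx1 [Hx2 Hx3]] := IHx y.+1 (ltnW hx) hy.
have [Hy1 [Hy2 Hy3]] := IHy (ltnW hy).
rewrite lppSS {1 4 7}/rowmotion /lppm.
have := valid_lpp va hx hy.
have := Hx1 hx; have := Hy2 hy => h1 h2 h3.
split; [|split]; repeat (case: ifP => ?); try (by lia);
 have := @valid_lpp M a x.+2 y.+1 va; have := @valid_lpp M a x.+1 y.+2 va; lia.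
Qed.

Lemma valid_rowmotion M a : valid M a -> valid M (rowmotion M a).
Proof.
move=> va; split; first exact: rowmotion_ge0.
by have [_ [_]] := lpp_rowmotion va (leqnn M) (leqnn N).
Qed.

Lemma valid_restr M a : valid M.+1 a -> valid M a.
Proof.
move=> va; split; last by have /andP[] := valid_lpp va (leqnSn M) (leqnn N).
by move=> x y hx hy; case: va => a0 _; apply: a0 => //; lia.
Qed.

(** In row x of the tableau attached to a, the number of entries above the letter
    that j encodes; only the first x+1 lines of the iterate matter. *)
Definition nabove (M : nat) (a : nat -> nat -> int) (x j : nat) : int :=
  lppm (iter (M.-1 - x) (rowmotion M) a) x.+1 j.

Lemma eq_iter_rowmotion M a b s :
    (forall x y, (x < M)%N -> (y < N)%N -> a x y = b x y) ->
  forall x y, (x < M)%N -> (y < N)%N ->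
    iter s (rowmotion M) a x y = iter s (rowmotion M) b x y.
Proof. by move=> eqab; elim: s => [//|s IH] x y; apply: eq_rowmotion. Qed.

Lemma iter_rowmotionS M a s x y : (x + s < M)%N -> (y < N)%N ->
  iter s (rowmotion M.+1) a x y = iter s (rowmotion M) a x y.
Proof.
elim: s x y => [//|s IH] x y hx hy; rewrite !iterS.
rewrite rowmotion_step; last by lia.
have {}IH x' y' : (x' < x.+2)%N -> (y' < N)%N ->
    iter s (rowmotion M.+1) a x' y' = iter s (rowmotion M) a x' y'.
  by move=> hx' hy'; apply: IH => //; lia.
by rewrite /rowmotion (eq_lppm IH) // !(eq_lpp IH).
Qed.

Lemma eq_nabove M a b : (forall x y, (x < M)%N -> (y < N)%N -> a x y = b x y) ->
  forall x j, (x < M)%N -> nabove M a x j = nabove M b x j.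
Proof. by move=> eqab x j hx; apply: eq_lppm hx => x' y; apply: eq_iter_rowmotion. Qed.

Lemma nabove_last M a j : nabove M.+1 a M j = lppm a M.+1 j.
Proof. by rewrite /nabove subnn. Qed.

(** The last line does not influence the other ones during later steps, so a
    step of rowmotion may be followed by its deletion.  All inductions on the
    number of lines rest on this. *)
Lemma nabove_prev M a x j : (x < M)%N -> nabove M.+1 a x j = nabove M (rowmotion M.+1 a) x j.
Proof.
move=> hx; rewrite /nabove (_ : (M.+1.-1 - x = (M.-1 - x).+1)%N) ?iterSr; last by lia.
apply: (@eq_lppm x.+1) => // x' y hx' hy; apply: iter_rowmotionS => //; lia.
Qed.

End Rowmotion.

(** * Rowmotion carries a crystal move to a crystal move *)

Section Moves.
Variables (N : nat) (m : int).
Local Notation lppm := (lppm N m).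
Local Notation rowmotion := (rowmotion N m).
Local Notation valid := (valid N m).

(** A source or target outside of the array stands for the reservoir from which
    the operator of index i takes its unit. *)
Definition moved (M : nat) (a a' : nat -> nat -> int) (s t : nat * nat) :=
  forall x y, (x < M)%N -> (y < N)%N ->
    a' x y = a x y + ((x == t.1) && (y == t.2))%:R - ((x == s.1) && (y == s.2))%:R.

(** The slack m - lpp a 1 N, put on a virtual line y = N, raises the times behind
    it to the constant m.  With this line the operator of index i is a move
    between two adjacent lines like the others. *)
Definition aext (a : nat -> nat -> int) (x y : nat) : int :=
  if (y < N)%N then a x y else if x == 0%N then m - lpp a 1 N else 0.

Lemma aextE a x y : (y < N)%N -> aext a x y = a x y.
Proof. by rewrite /aext => ->. Qed.

Lemma lpp_aext a x y : (y < N)%N ->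
  lpp a x y.+1 = pass (lpp a ^~ y) (aext a ^~ y) x.
Proof.
move=> hy; rewrite lpp_row; apply: (@eq_pass _ _ _ x) => // x' _.
by rewrite aextE.
Qed.

Lemma lppm_aext M a x y : valid M a -> (0 < x <= M)%N -> (y <= N)%N ->
  lppm a x y.+1 = pass (lpp a ^~ y) (aext a ^~ y) x.
Proof.
move=> va hx; rewrite leq_eqVlt /lppm => /orP[/eqP->|hy].
  rewrite ltnn; case: x hx => // x; elim: x => [|x IH] hx.
    by have := valid_lpp va hx (leqnn N); rewrite passS /= /aext ltnn eqxx; lia.
  rewrite passS -IH; last by lia.
  by have := valid_lpp va hx (leqnn N); rewrite /aext ltnn /=; lia.
by rewrite hy lpp_aext.
Qed.

Lemma output_lppm M a x y :
  output M (lpp a ^~ y.+1) (lppm a ^~ y.+2) x = rowmotion M a x y.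
Proof. by rewrite /output /inner /rowmotion; case: ifP. Qed.

Lemma output_rows M a x y : valid M a -> (x < M)%N -> (y < N)%N ->
  output M (lpp a ^~ y.+1) (pass (lpp a ^~ y.+1) (aext a ^~ y.+1)) x = rowmotion M a x y.
Proof.
move=> va hx hy.
rewrite (@eq_output _ _ (lpp a ^~ y.+1) _ (lppm a ^~ y.+2)) // ?output_lppm //.
by move=> z hz; rewrite (lppm_aext va).
Qed.

Lemma output_cols M a x y : valid M a -> (x.+1 < M)%N -> (y < N)%N ->
  output N (lpp a x.+1) (lpp a x.+2) y = rowmotion M a x y.
Proof.
move=> va hx hy; rewrite /output /inner /rowmotion hx /lppm; case: ifP => hy2.
  by rewrite minC.
have := valid_lpp va hx (leqnn N); rewrite (_ : y.+1 = N); lia.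
Qed.

Lemma eq_lpp_above M a a' Y :
    (forall x, (x <= M)%N -> lpp a' x Y = lpp a x Y) ->
    (forall x y, (x < M)%N -> (Y <= y < N)%N -> a' x y = a x y) ->
  forall x y, (x <= M)%N -> (Y <= y <= N)%N -> lpp a' x y = lpp a x y.
Proof.
move=> eY eqa x y hx hy; rewrite -(subnKC (n:=y) (m:=Y)); last by lia.
have: (Y + (y - Y) <= N)%N by lia.
move: (y - Y)%N => d {hy}; elim: d x hx => [|d IH] x hx hd.
  by rewrite addn0 eY.
rewrite addnS !lpp_row (@eq_pass_l _ (lpp a ^~ (Y + d)%N) _ M) //; last first.
  by move=> z hz; rewrite IH //; lia.
by apply: (@eq_pass _ _ _ M) => // z hz; apply: eqa => //; lia.
Qed.

Lemma row_step_eq M a y : valid M a -> (y.+1 < N)%N ->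
  let b := a ^~ y.+1 in let c := aext a ^~ y.+2 in
  let b' := rowmotion M a ^~ y in let c' := rowmotion M a ^~ y.+1 in
  pluses b' c' M = pluses b c M /\
  \sum_(x < M) (c' x - b' x) = \sum_(x < M) (c x - b x).
Proof.
move=> va hy b c b' c'; have [a0 _] := va.
case: (posnP M) => [->|M0]; first by rewrite !big_ord0.
pose u := lpp a ^~ y.+1; pose v := pass u b; pose w := pass v c.
have u1 : 0 <= u 1%N by have := valid_lpp va M0 (ltnW hy); rewrite /u; lia.
have b0 x : (x < M)%N -> 0 <= b x by move=> hx; apply: a0.
have eb x : (x < M)%N -> output M u v x = b' x.
  move=> hx; rewrite /b' -output_rows //; last by lia.
  by rewrite (_ : v = pass u (aext a ^~ y.+1)) //; congr pass;
    apply: functional_extensionality => z; rewrite aextE.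
have ev : v = lpp a ^~ y.+2.
  by apply: functional_extensionality => z; rewrite lpp_row.
have ec x : (x < M)%N -> output M v w x = c' x.
  by move=> hx; rewrite /c' -output_rows // /w ev.
have [<- _ _ _] := eq_pluses eb ec; split; first exact: pluses_output.
rewrite -(sum_outputs c u1 b0) -/v -/w; apply: eq_bigr => x _.
by rewrite eb // ec.
Qed.

(** The lines y+1 and y+2 pass to the lines y and y+1.  As [pass_lower] keeps
    the times after both lines, the times [lppm] along the border x = M change
    only if the new move takes place in the last cell; this is where a row of the
    tableau changes. *)
Lemma row_step M a a' y : valid M a -> (y.+1 < N)%N ->
  let b := a ^~ y.+1 in let c := aext a ^~ y.+2 in
  let p := plus_pos b c M in
  0 < pluses b c M -> moved M a a' (p, y.+2) (p, y.+1) ->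
  let q := plus_pos (rowmotion M a ^~ y) (rowmotion M a ^~ y.+1) M in
  [/\ valid M a', moved M (rowmotion M a) (rowmotion M a') (q, y.+1) (q, y) &
      forall j, lppm a' M j = lppm a M j + ((q == M.-1) && (j == y.+2))%:R].
Proof.
move=> va hy b c p hF hmv q; have [a0 am] := va.
have M0 : (0 < M)%N by case: (M) hF.
pose u := lpp a ^~ y.+1; pose v := pass u b; pose w := pass v c.
have u1 : 0 <= u 1%N by have := valid_lpp va M0 (ltnW hy); rewrite /u; lia.
have b0 x : (x < M)%N -> 0 <= b x by move=> hx; apply: a0.
have ev : v = lpp a ^~ y.+2.
  by apply: functional_extensionality => z; rewrite lpp_row.
have eb x : (x < M)%N -> output M u v x = rowmotion M a x y.
  move=> hx; rewrite -output_rows //; last by lia.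
  by rewrite (_ : v = pass u (aext a ^~ y.+1)) //; congr pass;
    apply: functional_extensionality => z; rewrite aextE.
have ec x : (x < M)%N -> output M v w x = rowmotion M a x y.+1.
  by move=> hx; rewrite -output_rows // /w ev.
have pM : (p < M)%N by apply: plus_pos_lt.
have cp : 0 < c p by apply: plus_pos_gt0.
have := pass_lower u1 b0 hF; cbv zeta; rewrite -/p -/v -/w.
have [_ _ -> _] := eq_pluses eb ec; rewrite -/q.
set v' := pass u (incr b p); set w' := pass v' (decr c p) => -[hw hout].
have eqa x y' : (x < M)%N -> (y' < y.+1)%N -> a x y' = a' x y'.
  by move=> hx hy'; rewrite hmv //=; lia.
have eu x y' : (x <= M)%N -> (y' <= y.+1)%N -> lpp a' x y' = lpp a x y'.
  by move=> hx hy'; rewrite (eq_lpp eqa).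
have ev' x : (x <= M)%N -> lpp a' x y.+2 = v' x.
  move=> hx; rewrite lpp_row (@eq_pass_l _ u _ M) //; last by move=> z hz; rewrite eu.
  by apply: (@eq_pass _ _ _ M) => // z hz; rewrite hmv //= /incr /b; lia.
have ec' x : (x < M)%N -> aext a' x y.+2 = decr c p x.
  move=> hx; rewrite /decr /c /aext; case: ifP => hy2.
    by rewrite hmv //=; lia.
  have p0 : p = 0%N by move: cp; rewrite /c /aext hy2; case: eqP.
  have <- : y.+2 = N by lia.
  have -> : lpp a 1 y.+2 = v 1%N by rewrite ev.
  by rewrite ev' // p0 /v' /v !passS /incr p0 /=; case: eqP => _; lia.
have ew' x : (x <= M)%N -> pass (lpp a' ^~ y.+2) (aext a' ^~ y.+2) x = w x.
  move=> hx; rewrite -hw // (@eq_pass_l _ v' _ M) //.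
  exact: (@eq_pass _ _ _ M).
have va' : valid M a'.
  split=> [x y' hx hy'|].
    rewrite hmv //=; have := a0 x y' hx hy'.
    case: (x =P p) => [->|_] //=; last by lia.
    case: (y' =P y.+2) => [ey|_] /=; last by lia.
    by move: cp; rewrite /c -ey aextE //; lia.
  case: (ltnP y.+2 N) => hy2.
    rewrite (@eq_lpp_above M a a' y.+3) //; last by lia.
      by move=> x hx; rewrite !lpp_aext // ew' // /w ev.
    by move=> x y' hx hy'; rewrite hmv //=; lia.
  have eN : N = y.+2 by lia.
  have : w M = m by rewrite /w ev /c -eN -(@lppm_aext M) ?M0 ?leqnn // /lppm ltnn.
  rewrite -hw // eN ev' // -(prednK M0) /w' passS prednK //.
  suff : 0 <= decr c p M.-1 by lia.
  rewrite /decr /c /aext eN ltnn; case: eqP => [e0|]; last first.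
    move=> ?; move: cp; rewrite /c /aext eN ltnn; case: eqP => //; lia.
  have := valid_lpp va M0 (leqnn N); rewrite e0.
  by move: cp; rewrite /c /aext eN ltnn; case: eqP => //; lia.
have low x j : (x <= M)%N -> (j <= y.+1)%N -> lppm a' x j = lppm a x j.
  by move=> hx hj; rewrite /lppm eu.
have high x j : (0 < x <= M)%N -> (y.+3 <= j)%N -> lppm a' x j = lppm a x j.
  move=> hx hj; case: (ltnP y.+2 N) => hy2; last first.
    by rewrite /lppm !ifF //; lia.
  rewrite /lppm; case: ifP => // hjN; apply: (@eq_lpp_above M a a' y.+3) => //; try by lia.
    by move=> z hz; rewrite !lpp_aext // ew' // /w ev.
  by move=> z y' hz hy'; rewrite hmv //=; lia.
have lppE b' z j : (j <= N)%N -> lpp b' z j = lppm b' z j by rewrite /lppm => ->.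
split=> // [x y' hx hy'|j].
  rewrite -output_lppm.
  case: (y' =P y) => [->|ny].
    rewrite (@eq_output _ _ u _ v') //.
    - by rewrite (hout x hx).1 /incr eb //=; lia.
    - by move=> z hz; rewrite eu //; lia.
    - by move=> z hz; rewrite /lppm ifT ?ev'; lia.
  case: (y' =P y.+1) => [->|ny1].
    rewrite (@eq_output _ _ v' _ w') //.
    - by rewrite (hout x hx).2 /decr ec //=; lia.
    - by move=> z hz; rewrite ev' //; lia.
    - by move=> z hz; rewrite (lppm_aext va') // ew' ?hw //; lia.
  rewrite (@eq_output _ _ (lpp a ^~ y'.+1) _ (lppm a ^~ y'.+2)) //.
  - by rewrite output_lppm /=; lia.
  - move=> z hz; rewrite !lppE //.
    by case: (leqP y'.+1 y.+1) => h; [apply: low | apply: high]; lia.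
  - move=> z hz.
    by case: (leqP y'.+2 y.+1) => h; [apply: low | apply: high]; lia.
case: (j =P y.+2) => [->|nj].
  have := (hout M.-1); rewrite /output /incr prednK // ltnn leqnn => /(_ isT)[h _].
  rewrite /lppm (_ : (y.+2 <= N)%N) ?ev' //.
  have <- : v M = lpp a M y.+2 by rewrite ev.
  by rewrite eq_sym; lia.
rewrite andbF addr0; case: (leqP j y.+1) => h; [apply: low|apply: high]; lia.
Qed.
End Moves.

Section ColumnMoves.
Variables (N : nat) (m : int).
Local Notation lppm := (lppm N m).
Local Notation rowmotion := (rowmotion N m).
Local Notation valid := (valid N m).

Lemma col_step_eq M a x : valid M a -> (x.+1 < M)%N ->
  let b := a x in let c := a x.+1 in
  let b' := output N (lpp a x) (lpp a x.+1) in let c' := rowmotion M a x in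
  minuses b' c' N = minuses b c N /\
  \sum_(y < N) (c' y - b' y) = \sum_(y < N) (c y - b y).
Proof.
move=> va hx b c b' c'; have [a0 _] := va.
case: (posnP N) => [->|N0]; first by rewrite !big_ord0.
pose u := lpp a x; pose v := pass u b; pose w := pass v c.
have xM : (x <= M)%N by lia.
have u1 : 0 <= u 1%N by have := valid_lpp va xM N0; rewrite /u; lia.
have b0 y : (y < N)%N -> 0 <= b y by move=> hy; apply: a0; lia.
have ev : v = lpp a x.+1 by apply: functional_extensionality => z; rewrite lpp_col.
have ew : w = lpp a x.+2 by apply: functional_extensionality => z; rewrite lpp_col -ev.
have eb y : (y < N)%N -> output N u v y = b' y by rewrite ev.
have ec y : (y < N)%N -> output N v w y = c' y.
  by move=> hy; rewrite ev ew (output_cols va).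
have [_ <- _ _] := eq_pluses eb ec; split; first exact: minuses_output.
rewrite -(sum_outputs c u1 b0) -/v -/w; apply: eq_bigr => y _.
by rewrite eb // ec.
Qed.

(** For two adjacent columns the move goes the other way, hence [pass_raise].
    Its image under rowmotion is a move from the column x-1 to the column x; for
    x = 0 the unit comes from outside of the array. *)
Lemma col_step M a a' x : valid M a -> (x.+1 < M)%N ->
  let b := a x in let c := a x.+1 in
  let p := minus_pos b c N in
  0 < minuses b c N -> moved N M a a' (x, p) (x.+1, p) ->
  let q := minus_pos (output N (lpp a x) (lpp a x.+1)) (rowmotion M a x) N in
  [/\ valid M a',
      forall z y, (z < M)%N -> (y < N)%N -> rowmotion M a' z y = rowmotion M a z y
        + ((z == x) && (y == q))%:R - ((z.+1 == x) && (y == q))%:R &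
      forall j, lppm a' M j = lppm a M j].
Proof.
move=> va hx b c p hF hmv q; have [a0 am] := va.
have N0 : (0 < N)%N by case: (N) hF.
pose u := lpp a x; pose v := pass u b; pose w := pass v c.
have xM : (x <= M)%N by lia.
have u1 : 0 <= u 1%N by have := valid_lpp va xM N0; rewrite /u; lia.
have umono y : (0 < y < N)%N -> u y <= u y.+1.
  by move=> hy; apply: (lpp_mono a0); lia.
have b0 y : (y < N)%N -> 0 <= b y by move=> hy; apply: a0; lia.
have c0 y : (y < N)%N -> 0 <= c y by move=> hy; apply: a0; lia.
have ev : v = lpp a x.+1 by apply: functional_extensionality => z; rewrite lpp_col.
have ew : w = lpp a x.+2 by apply: functional_extensionality => z; rewrite lpp_col -ev.
have eb y : (y < N)%N -> output N u v y = output N (lpp a x) (lpp a x.+1) y.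
  by rewrite ev.
have ec y : (y < N)%N -> output N v w y = rowmotion M a x y.
  by move=> hy; rewrite ev ew (output_cols va).
have pN : (p < N)%N by apply: minus_pos_lt.
have bp : 0 < b p by apply: minus_pos_gt0.
have := pass_raise u1 umono b0 c0 hF; cbv zeta; rewrite -/p -/v -/w.
have [_ _ _ ->] := eq_pluses eb ec; rewrite -/q.
set v' := pass u (decr b p); set w' := pass v' (incr c p) => -[hw hout].
have eu z y : (z <= x)%N -> (y <= N)%N -> lpp a' z y = lpp a z y.
  move=> hz hy; apply: (@eq_lpp _ _ x N) => // z' y' hz' hy'.
  by rewrite hmv //=; lia.
have ev' y : (y <= N)%N -> lpp a' x.+1 y = v' y.
  move=> hy; rewrite lpp_col (@eq_pass_l _ u _ N) //; last by move=> z hz; rewrite eu.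
  by apply: (@eq_pass _ _ _ N) => // z hz; rewrite hmv //= /decr /b; lia.
have ew' y : (y <= N)%N -> lpp a' x.+2 y = w y.
  move=> hy; rewrite -hw // lpp_col (@eq_pass_l _ v' _ N) //.
  by apply: (@eq_pass _ _ _ N) => // z hz; rewrite hmv //= /incr /c; lia.
have eh z y : (x.+2 <= z <= M)%N -> (y <= N)%N -> lpp a' z y = lpp a z y.
  move=> hz; rewrite -(subnKC (n:=z) (m:=x.+2)); last by lia.
  have: (x.+2 + (z - x.+2) <= M)%N by lia.
  move: (z - x.+2)%N => d {hz}; elim: d y => [|d IH] y hd hy.
    by rewrite addn0 ew' // ew.
  rewrite addnS !lpp_col (@eq_pass_l _ (lpp a (x.+2 + d)%N) _ N) //; last first.
    by move=> t ht; rewrite IH //; lia.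
  by apply: (@eq_pass _ _ _ N) => // t ht; rewrite hmv //=; lia.
have same z y : (z <= M)%N -> z != x.+1 -> lppm a' z y = lppm a z y.
  move=> hz nz; rewrite /lppm; case: ifP => // hy.
  by case: (leqP z x) => h; [apply: eu | apply: eh]; lia.
have va' : valid M a'.
  split=> [z y hz hy|]; last by rewrite eh //; lia.
  rewrite hmv //=; have := a0 z y hz hy.
  case: (z =P x) => [->|_] //=; last by lia.
  by case: (y =P p) => [->|_] /=; [move: bp; rewrite /b|]; lia.
have lppE b' z j : (j <= N)%N -> lpp b' z j = lppm b' z j by rewrite /lppm => ->.
split=> // [z y hz hy|j]; last by apply: same; lia.
case: (z =P x) => [->|nz].
  rewrite -(output_cols va') // (@eq_output _ _ v' _ w').
  - by rewrite (hout y hy).2 /incr ec //; lia.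
  - by [].
  - by move=> t ht; rewrite ev'; lia.
  - by move=> t ht; rewrite ew' ?hw; lia.
case: (z.+1 =P x) => [ez|nz1].
  rewrite -(output_cols va) -?(output_cols va') //; try by lia.
  rewrite ez (@eq_output _ _ u _ v').
  - by rewrite (hout y hy).1 /decr eb //= addr0.
  - by [].
  - by move=> t ht; rewrite eu //; lia.
  - by move=> t ht; rewrite ev'; lia.
rewrite /rowmotion; case: ifP => hz2 /=; rewrite !lppE ?same //; lia.
Qed.
End ColumnMoves.

(** * From the lines of an array to the lines of a tableau *)

Section Crystal.
Variables (N : nat) (m : int).
Local Notation lppm := (lppm N m).
Local Notation rowmotion := (rowmotion N m).
Local Notation valid := (valid N m).
Local Notation moved := (moved N).
Local Notation aext := (aext N m).
Local Notation nabove := (nabove N m).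

(** With D = n+1-l, the numbers of letters l+1 and of letters l in row x of the
    tableau, so that row x is the block x of its reading word. *)
Definition tminus M a D (x : nat) : int := nabove M a x (D + x).+1 - nabove M a x (D + x)%N.
Definition tplus M a D (x : nat) : int := nabove M a x (D + x).+2 - nabove M a x (D + x).+1.

Lemma tlines_prev M a D x : (x < M)%N ->
  tminus M.+1 a D x = tminus M (rowmotion M.+1 a) D x /\
  tplus M.+1 a D x = tplus M (rowmotion M.+1 a) D x.
Proof. by move=> hx; rewrite /tminus /tplus !nabove_prev. Qed.

Definition nabove_bumped M a a' D r :=
  forall x j, (x < M)%N ->
    nabove M a' x j = nabove M a x j + ((x == r) && (j == (D + x).+1))%:R.

(** Each step of rowmotion shifts the pair of lines by one and lets one column
    be deleted; that column accounts for the letters l and l+1 of one row of the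
    tableau.  Hence the induction on the number of columns. *)
Lemma crystal_rows M a D : valid M a -> (0 < D)%N -> (D + M <= N)%N ->
  let y := (D + M).-1 in let b := a ^~ y in let c := aext a ^~ y.+1 in
  let p := plus_pos b c M in let tm := tminus M a D in let tp := tplus M a D in
  [/\ pluses tm tp M = pluses b c M,
      \sum_(x < M) (tp x - tm x) = \sum_(x < M) (c x - b x) &
      forall a', 0 < pluses b c M -> moved M a a' (p, y.+1) (p, y) ->
        valid M a' /\ nabove_bumped M a a' D (plus_pos tm tp M)].
Proof.
elim: M a => [|M IH] a va D0 DN; first by split=> //; rewrite !big_ord0.
pose a1 := rowmotion M.+1 a.
have va1 : valid M a1 by apply/valid_restr/valid_rowmotion.
have := IH a1 va1 D0; rewrite -ltnS -addnS => /(_ (leqW DN)).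
set y := (D + M).-1 => {}IH.
have -> : (D + M.+1).-1 = y.+1 by rewrite /y; lia.
cbv zeta; set b := a ^~ y.+1; set c := aext a ^~ y.+2; set p := plus_pos b c M.+1.
set tm := tminus M.+1 a D; set tp := tplus M.+1 a D.
move: IH; cbv zeta; set tm1 := tminus M a1 D; set tp1 := tplus M a1 D.
set b1 := a1 ^~ y; set c1 := aext a1 ^~ y.+1 => -[eF eS eX].
have hy : (y.+1 < N)%N by lia.
have [F_eq S_eq] := row_step_eq va hy.
pose c' := a1 ^~ y.+1.
have ec x : c1 x = c' x by rewrite /c1 aextE.
have [//|x _|eFc _ ePc _] := @eq_pluses b1 c1 b1 c' M; first exact: ec.
have et x : (x < M)%N -> tm x = tm1 x /\ tp x = tp1 x by apply: tlines_prev.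
have [x hx|x hx|eFt _ ePt _] := @eq_pluses tm tp tm1 tp1 M.
- by have [] := et x hx.
- by have [] := et x hx.
have yE : (D + M)%N = y.+1 by lia.
have etm : tm M = b1 M.
  rewrite /tm /tminus !nabove_last yE /b1 /a1 /rowmotion ltnn /lppm.
  by rewrite (_ : (y.+1 <= N)%N) //; lia.
have etp : tp M = c' M.
  rewrite /tp /tplus !nabove_last yE /c' /a1 /rowmotion ltnn /lppm.
  by rewrite (_ : (y.+2 <= N)%N).
have bM : 0 <= b1 M by apply: (rowmotion_ge0 va); lia.
have FE : pluses tm tp M.+1 = pluses b1 c' M.+1.
  by rewrite !plusesS etm etp eFt eF eFc.
split.
- by rewrite FE; exact: F_eq.
- rewrite -S_eq (sum_ordS (fun x => tp x - tm x)).
  rewrite (sum_ordS (fun x => c' x - b1 x)) etm etp; congr (_ + _).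
  rewrite (eq_bigr (fun x : 'I_M => tp1 x - tm1 x)); last first.
    by move=> x _; have [-> ->] := et x (ltn_ord x).
  by rewrite eS; apply: eq_bigr => x _; rewrite ec.
move=> a' hF hmv; have [va' hmv' hlm] := row_step va hy hF hmv.
split=> //.
have qE : plus_pos b1 c' M.+1 = if pluses b1 c' M <= b1 M then M else plus_pos b1 c' M by [].
have rE : plus_pos tm tp M.+1 = if pluses b1 c' M <= b1 M then M else plus_pos tm1 tp1 M.
  by rewrite -eFc -eF -eFt -etm -ePt.
move: hmv' hlm; rewrite -/b1 -/c' {}qE rE /= -/a1.
case: ifP => hq hmv' hlm x j; rewrite ltnS leq_eqVlt => /orP[/eqP->|hx].
- by rewrite !nabove_last hlm !eqxx yE.
- rewrite !nabove_prev // (@eq_nabove _ _ M _ a1) //; last first.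
    by move=> x' y' hx' hy'; rewrite hmv' //=; lia.
  by rewrite /a1; lia.
- have M0 : (0 < M)%N by case: (M) hq bM => //=; lia.
  have := plus_pos_lt b1 c' M0; have := plus_pos_lt tm1 tp1 M0.
  by rewrite !nabove_last hlm; lia.
have hFc : 0 < pluses b1 c1 M by rewrite eFc; lia.
have [x' y' hx' hy'|_ hX] := eX (rowmotion M.+1 a') hFc; last by rewrite !nabove_prev // hX.
by rewrite ePc; apply: hmv' => //; lia.
Qed.

(** With all plus signs in the first block, matching is a comparison with the
    total number of minus signs behind it. *)
Lemma pluses_single (b c : nat -> int) k : (forall x, (x < k)%N -> 0 <= b x) -> 0 <= c 0%N ->
    (forall x, (0 < x < k)%N -> c x = 0) -> (0 < k)%N ->
  pluses b c k = Num.max 0 (c 0%N + b 0%N - \sum_(x < k) b x).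
Proof.
case: k => // k hb c0 hc _; elim: k hb hc => [|k IH] hb hc.
  by rewrite big_ord1 /=; have := hb 0%N isT; lia.
rewrite plusesS IH; last by move=> x hx; apply: hc; lia.
  by rewrite (sum_ordS b k.+1) (hc k.+1) //; have := hb k.+1 (ltnSn _); lia.
by move=> x hx; apply: hb; lia.
Qed.

Lemma minuses_single (b c : nat -> int) k : (forall x, (x < k)%N -> b x = 0) ->
    (forall x, (x < k)%N -> 0 <= c x) ->
  [/\ minuses b c k = 0, pluses b c k = \sum_(x < k) c x &
      minuses b c k.+1 = Num.max 0 (b k - \sum_(x < k) c x)].
Proof.
move=> hb hc; suff [e1 e2] : minuses b c k = 0 /\ pluses b c k = \sum_(x < k) c x.
  by split=> //; rewrite [LHS]/= e1 e2 add0r.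
elim: k hb hc => [|k IH] hb hc; first by rewrite big_ord0.
have [||e1 e2] := IH; [by move=> x hx; apply: hb; lia|by move=> x hx; apply: hc; lia|].
have s0 : 0 <= \sum_(x < k) c x by apply: sumr_ge0 => x _; apply: hc; have := ltn_ord x; lia.
by rewrite (sum_ordS c) /= e1 e2 (hb k) //; move: (\sum_(x < k) c x) s0 => S s0; split; lia.
Qed.

Lemma lpp1 a X Y y : ge0_on X.+1 Y a -> (y <= Y)%N ->
  lpp a 1 y = \sum_(z < y) a 0%N z.
Proof.
move=> a0; elim: y => [|y IH] hy; first by rewrite big_ord0.
rewrite (sum_ordS (a 0%N)) lppSS IH; last by lia.
have : 0 <= \sum_(z < y) a 0%N z by apply: sumr_ge0 => z _; apply: a0; have := ltn_ord z; lia.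
by rewrite /lpp; lia.
Qed.

(** Each step of rowmotion shifts the pair of columns towards the border x = 0
    and deletes a column which contributes no letters l and l+1.  At the border
    the pair becomes the situation of the virtual line, which [crystal_rows]
    settles. *)
Lemma crystal_cols M a x D : valid M a -> (x.+1 + N = M + D)%N -> (0 < D < N)%N ->
  let b := a x in let c := a x.+1 in
  let p := minus_pos b c N in let tm := tminus M a D in let tp := tplus M a D in
  [/\ pluses tm tp M = minuses b c N,
      \sum_(z < M) (tp z - tm z) = \sum_(y < N) (b y - c y) &
      forall a', 0 < minuses b c N -> moved M a a' (x, p) (x.+1, p) ->
        valid M a' /\ nabove_bumped M a a' D (plus_pos tm tp M)].
Proof.
elim: M a x => [|M IH] a x va hxM DN; first by lia.
move=> b c p tm tp.
pose a1 := rowmotion M.+1 a.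
have va1 : valid M a1 by apply/valid_restr/valid_rowmotion.
have hx : (x.+1 < M.+1)%N by lia.
have M0 : (0 < M)%N by lia.
pose tm1 := tminus M a1 D; pose tp1 := tplus M a1 D.
have et z : (z < M)%N -> tm z = tm1 z /\ tp z = tp1 z by apply: tlines_prev.
have [z hz|z hz|eFt _ ePt _] := @eq_pluses tm tp tm1 tp1 M.
- by have [] := et z hz.
- by have [] := et z hz.
have eSt : \sum_(z < M.+1) (tp z - tm z) =
    \sum_(z < M) (tp1 z - tm1 z) + (tp M - tm M).
  rewrite (sum_ordS (fun z => tp z - tm z)); congr (_ + _).
  by apply: eq_bigr => z _; have [-> ->] := et z (ltn_ord z).
have [E_eq S_eq] := col_step_eq va hx.
have := @col_step N m M.+1 a _ x va hx; rewrite -/b -/c -/p -/a1.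
move: E_eq S_eq; rewrite -/b -/c -/a1.
set b' := output N _ _; set c' := a1 x => E_eq S_eq step.
have sumN (f g : nat -> int) : \sum_(y < N) (f y - g y) = - \sum_(y < N) (g y - f y).
  by rewrite -sumrN; apply: eq_bigr => y _; rewrite opprB.
have /andP[D0 DltN] := DN.
have tpM : tp M = 0.
  rewrite /tp /tplus !nabove_last /lppm !ifF ?subrr //; lia.
have X_last a' : (forall j, lppm a' M.+1 j = lppm a M.+1 j) ->
    forall j, nabove M.+1 a' M j = nabove M.+1 a M j.
  by move=> h j; rewrite !nabove_last.
have rE : tm M < pluses tm tp M -> plus_pos tm tp M.+1 = plus_pos tm1 tp1 M.
  by rewrite /= ePt; case: ifP => //; lia.
have bump a' : (forall j, lppm a' M.+1 j = lppm a M.+1 j) -> tm M < pluses tm tp M ->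
    nabove_bumped M a1 (rowmotion M.+1 a') D (plus_pos tm1 tp1 M) ->
    nabove_bumped M.+1 a a' D (plus_pos tm tp M.+1).
  move=> hlm hF hX z j; rewrite rE // ltnS leq_eqVlt => /orP[/eqP->|hz].
    by rewrite X_last //; have := plus_pos_lt tm1 tp1 M0; lia.
  by rewrite !nabove_prev // hX.
have m_ge0 := minuses_ge0 b c N.
(* x > 0: the pair of columns moves on; x = 0: it becomes the corner *)
case: (posnP x) => x0; last first.
  pose z := x.-1; have zx : z.+1 = x by rewrite /z prednK.
  have eb' y : (y < N)%N -> b' y = a1 z y.
    by move=> hy; rewrite /b' /a1 -(output_cols va) ?zx // -?zx //; lia.
  have tmM : tm M = 0.
    rewrite /tm /tminus !nabove_last /lppm !ifF ?subrr //; lia.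
  have hz : (z.+1 + N = M + D)%N by lia.
  have := IH a1 z va1 hz DN; rewrite zx; cbv zeta; rewrite -/tm1 -/tp1 => -[eF eS eX].
  have [y hy|//|_ em _ ep] := @eq_pluses b' c' (a1 z) c' N; first exact: eb'.
  have FE : pluses tm tp M.+1 = minuses b c N.
    by rewrite plusesS tpM tmM eFt eF -/c' -em E_eq; lia.
  split=> //.
    rewrite eSt eS tpM tmM subrr addr0 sumN [RHS]sumN -S_eq; congr (- _).
    by apply: eq_bigr => y _; rewrite eb'.
  move=> a' hF hmv; have [va' hmv' hlm] := step a' hF hmv; split=> //.
  have hF' : 0 < minuses (a1 z) c' N by rewrite -em E_eq.
  apply: bump => //; first by rewrite tmM eFt eF.
  have [|//] := eX (rowmotion M.+1 a') hF'.
  move=> x' y' hx' hy'; rewrite hmv' //; last by lia.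
  by rewrite /= -ep (_ : (x'.+1 == x) = (x' == z)) // -zx eqSS.
have DMN : (D + M = N)%N by lia.
have eN : N = N.-1.+1 by lia.
have leDMN : (D + M <= N)%N by lia.
move: (crystal_rows va1 D0 leDMN); cbv zeta; rewrite DMN -/tm1 -/tp1 -eN.
set b1 := a1 ^~ N.-1; set c1 := aext a1 ^~ N; set p1 := plus_pos b1 c1 M.
move=> [eF eS eX].
have [a0 am] := va; have [a10 a1m] := va1.
have L1m : lpp a1 1 N <= m by have := valid_lpp va1 M0 (leqnn N); lia.
have c1E z : c1 z = if z == 0%N then m - lpp a1 1 N else 0 by rewrite /c1 /aext ltnn.
have b1E z : (z < M)%N -> b1 z = lpp a z.+2 N - lpp a z.+1 N.
  move=> hz; rewrite /b1 /a1 /rowmotion ltnS hz -eN /lppm ltnn.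
  by have := valid_lpp va (_ : (z.+2 <= M.+1)%N) (leqnn N); lia.
have sum_b1 : \sum_(z < M) b1 z = lpp a M.+1 N - lpp a 1 N.
  rewrite (eq_bigr (fun z : 'I_M => lpp a z.+2 N - lpp a z.+1 N)); last first.
    by move=> z _; apply: b1E.
  elim: (M) => [|k IHk]; first by rewrite big_ord0 subrr.
  by rewrite (sum_ordS (fun z => lpp a z.+2 N - lpp a z.+1 N)) IHk; lia.
have b1_ge0 z : (z < M)%N -> 0 <= b1 z by move=> hz; apply: a10 => //; lia.
have rowF : pluses b1 c1 M = Num.max 0 (c1 0%N + b1 0%N - \sum_(z < M) b1 z).
  apply: pluses_single => //; first by rewrite c1E eqxx; lia.
  by move=> z hz; rewrite c1E ifF //; lia.
have tmM : tm M = m - lpp a M.+1 N.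
  by rewrite /tm /tminus !nabove_last DMN /lppm ltnn leqnn.
have tm_ge0 : 0 <= tm M by rewrite tmM; lia.
have b'E y : (y < N)%N -> b' y = if y == N.-1 then lpp a 1 N else 0.
  move=> hy; rewrite /b' x0 /output /inner [lpp a 0]/lpp subr0.
  case: ifP => h; last by rewrite (_ : y = N.-1) ?eqxx -?eN //; lia.
  rewrite ifF; last by lia.
  by have := valid_lpp va (_ : (1 <= M.+1)%N) hy; lia.
have c'_ge0 y : (y < N)%N -> 0 <= c' y by move=> hy; apply: a10 => //; lia.
have [y hy|y hy|m0 m1 m2] := @minuses_single b' c' N.-1.
- by rewrite b'E ?ifF //; lia.
- by apply: c'_ge0; lia.
have c'L : lpp a1 1 N = \sum_(y < N.-1) c' y + c' N.-1.
  have := @lpp1 a1 M.-1 N N.-1.+1; rewrite prednK // (sum_ordS (a1 0%N)) -eN.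
  by rewrite /c' x0 => ->.
have b1c' : b1 0%N = c' N.-1 by rewrite /c' x0.
have b10 := b1E 0%N M0.
have FE : pluses tm tp M.+1 = minuses b c N.
  rewrite plusesS tpM eFt eF rowF -E_eq {1}eN m2 b'E ?eqxx; last by lia.
  by rewrite tmM sum_b1 c1E eqxx b1c' c'L; move: b10; rewrite b1c'; lia.
split=> //.
  rewrite eSt eS tpM tmM [RHS]sumN -S_eq -sumN.
  have -> : \sum_(z < M) (c1 z - b1 z) = \sum_(z < M) c1 z - \sum_(z < M) b1 z.
    by rewrite sumrB.
  have -> : \sum_(y < N) (b' y - c' y) = \sum_(y < N) b' y - \sum_(y < N) c' y.
    by rewrite sumrB.
  rewrite sum_b1.
  have -> : \sum_(z < M) c1 z = m - lpp a1 1 N.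
    rewrite -(prednK M0) big_ord_recl c1E eqxx big1 => [|z _]; last by rewrite c1E.
    by rewrite /= addr0.
  have -> : \sum_(y < N) b' y = lpp a 1 N.
    rewrite sum_ord_pred ?big1 ?add0r => [|y _|]; last by lia.
      by rewrite b'E ?eqxx //; lia.
    by have := ltn_ord y => hy; rewrite b'E ?ifF //; lia.
  rewrite (lpp1 (X := M.-1) (Y := N)) ?prednK // -/c' /c' x0; lia.
move=> a' hF hmv; have [va' hmv' hlm] := step a' hF hmv; split=> //.
have tF : tm M < pluses tm tp M by move: FE; rewrite plusesS tpM; lia.
apply: bump => //.
have rF : 0 < pluses b1 c1 M by rewrite -eF -eFt; lia.
have p10 : p1 = 0%N.
  by have := plus_pos_gt0 b1_ge0 rF; rewrite -/p1 c1E; case: eqP.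
have qE : minus_pos b' c' N = N.-1.
  rewrite eN /= ifT // m1.
  by move: hF; rewrite -E_eq {1}eN m2; lia.
have [|//] := eX (rowmotion M.+1 a') rF.
move=> z y hz hy; rewrite hmv' //; last by lia.
by rewrite /= p10 qE x0; lia.
Qed.
End Crystal.

(** * The tableau determines the array *)

Section Bijection.
Variables (N : nat) (m : int).
Local Notation lppm := (lppm N m).
Local Notation rowmotion := (rowmotion N m).
Local Notation valid := (valid N m).
Local Notation nabove := (nabove N m).

(** Rowmotion gives the time of a cell from the times of its two successors, so
    the times are recovered from the far corner on. *)
Lemma rowmotion_inj M a b :
    (forall x y, (x < M)%N -> (y < N)%N -> rowmotion M a x y = rowmotion M b x y) ->
  forall x y, (x < M)%N -> (y < N)%N -> a x y = b x y.
Proof.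
move=> eqr.
have eqL d x y : (x < M)%N -> (y < N)%N -> (M - x + (N - y) <= d)%N ->
    lpp a x.+1 y.+1 = lpp b x.+1 y.+1.
  elim: d x y => [|d IH] x y hx hy hd; first by lia.
  have := eqr x y hx hy; rewrite /rowmotion /lppm.
  case: (ltnP x.+1 M) => hx2; case: (ltnP y.+1 N) => hy2;
    rewrite ?(IH x.+1 y) ?(IH x y.+1) //; lia.
have {}eqL x y : (x <= M)%N -> (y <= N)%N -> lpp a x y = lpp b x y.
  case: x y => [|x] [|y] hx hy //; exact: (eqL _ _ _ hx hy (leqnn _)).
move=> x y hx hy; have := eqL x.+1 y.+1 hx hy; rewrite !lppSS !eqL //; lia.
Qed.

Lemma nabove_inj M a b :
    (forall x j, (x < M)%N -> nabove M a x j = nabove M b x j) ->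
  forall x y, (x < M)%N -> (y < N)%N -> a x y = b x y.
Proof.
elim: M a b => [//|M IH] a b eqX; apply: rowmotion_inj => x y hx hy.
move: hx; rewrite ltnS leq_eqVlt => /orP[/eqP->|hx].
  have := eqX M y.+2 (ltnSn M); have := eqX M y.+1 (ltnSn M).
  rewrite !nabove_last /rowmotion ltnn => e1 ->.
  by move: e1; rewrite /lppm hy => ->.
apply: IH => // x' j hx'; rewrite -!nabove_prev //; apply: eqX; lia.
Qed.

(** Last-passage times measured from the far corner. *)
Definition rev_lpp M (b : nat -> nat -> int) x y : int :=
  lpp (fun p q => b (M.-1 - p) (N.-1 - q))%N (M - x) (N - y).

Lemma rev_lppE M b x y : (x < M)%N -> (y < N)%N ->
  rev_lpp M b x y = b x y + Num.max (rev_lpp M b x.+1 y) (rev_lpp M b x y.+1).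
Proof.
move=> hx hy; rewrite /rev_lpp.
have eM : (M - x)%N = (M - x.+1).+1 by lia.
have eN : (N - y)%N = (N - y.+1).+1 by lia.
rewrite eM eN lppSS; congr (b _ _ + _); lia.
Qed.

Lemma rev_lpp_out M b x y : (M <= x)%N || (N <= y)%N -> rev_lpp M b x y = 0.
Proof.
rewrite /rev_lpp -!subn_eq0 => /orP[/eqP->|/eqP->]; last exact: lppx0.
by [].
Qed.

(** The complements to m of the times of b measured from the far corner are the
    times of its preimage. *)
Lemma rowmotion_onto M b : ge0_on M N b -> rev_lpp M b 0 0 <= m ->
  exists a, [/\ valid M a,
    forall x y, (x < M)%N -> (y < N)%N -> rowmotion M a x y = b x y &
    forall x y, (x < M)%N -> (y < N)%N ->
      lpp a x.+1 y.+1 = m - rev_lpp M b x y].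
Proof.
move=> b0 Km; set K := rev_lpp M b in Km *.
(* the times that the preimage must have; its entries are their increments *)
pose L x y := if (x == 0%N) || (y == 0%N) then 0 else m - K x.-1 y.-1.
pose a x y := L x.+1 y.+1 - Num.max (L x y.+1) (L x.+1 y).
have aL x y : lpp a x y = L x y.
  elim: x y => [//|x IHx]; elim=> [|y IHy]; first by rewrite lppx0.
  by rewrite lppSS IHx IHy /a subrK.
have b0' : ge0_on M N (fun p q => b (M.-1 - p) (N.-1 - q))%N.
  by move=> p q hp hq; apply: b0; lia.
have Kge0 x y : 0 <= K x y by apply: (lpp_ge0 b0'); lia.
have Kmono x y x' y' : (x <= x')%N -> (y <= y')%N -> K x' y' <= K x y.
  by move=> hx hy; apply: (lpp_mono b0'); lia.
have Lm x y : L x y <= m.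
  rewrite /L; case: ifP => _; last by have := Kge0 x.-1 y.-1; lia.
  by have := Kge0 0%N 0%N; lia.
have L0 x y : 0 <= L x y.
  rewrite /L; case: ifP => // _.
  by have := Kmono _ _ _ _ (leq0n x.-1) (leq0n y.-1); lia.
have Lmono x y : L x y.+1 <= L x.+1 y.+1 /\ L x.+1 y <= L x.+1 y.+1.
  split.
    case: x => [|x]; first exact: L0.
    by rewrite /L /=; have := Kmono x y x.+1 y; lia.
  case: y => [|y]; first exact: L0.
  by rewrite /L /=; have := Kmono x y x y.+1; lia.
exists a; split.
- split=> [x y _ _|]; last by rewrite aL.
  by rewrite /a; have := Lmono x y; lia.
- move=> x y hx hy; rewrite /rowmotion /lppm !aL.
  have := rev_lppE b hx hy; rewrite -/K => eK.
  have Ky : (N <= y.+1)%N -> K x y.+1 = 0.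
    by move=> h; rewrite /K rev_lpp_out // h ?orbT.
  have Kx : (M <= x.+1)%N -> K x.+1 y = 0.
    by move=> h; rewrite /K rev_lpp_out // h ?orbT.
  have := Kge0 x.+1 y; have := Kge0 x y.+1.
  rewrite /L /=; case: (ltnP x.+1 M) => h1; case: (ltnP y.+1 N) => h2; lia.
by move=> x y hx hy; rewrite aL.
Qed.

(** The last row of the pattern prescribes the last column of a rowmotion image,
    the other columns come from the induction, and [rowmotion_onto] supplies the
    array itself. *)
Lemma nabove_onto M (X : nat -> nat -> int) :
    (forall x, (x < M)%N -> X x 0%N = 0) ->
    (forall x j, (x < M)%N -> (N < j)%N -> X x j = m) ->
    (forall x j, (x < M)%N -> X x j <= X x j.+1) ->
    (forall x j, (x.+1 < M)%N -> X x j <= X x.+1 j) -> 0 <= m ->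
  exists a, valid M a /\ forall x j, (x < M)%N -> nabove M a x j = X x j.
Proof.
elim: M => [|M IH] X0 Xm Xj Xx m0.
  by exists (fun _ _ => 0); split=> //; split.
have [|||||a2 [va2 hX]] := IH => //.
- by move=> x hx; apply: X0; lia.
- by move=> x j hx; apply: Xm; lia.
- by move=> x j hx; apply: Xj; lia.
- by move=> x j hx; apply: Xx; lia.
(* the image of the array to be found after one step of rowmotion *)
pose b x y := if (x < M)%N then a2 x y else X M y.+2 - X M y.+1.
have [a20 a2m] := va2.
have b0 : ge0_on M.+1 N b.
  move=> x y hx hy; rewrite /b; case: ifP => h; first exact: a20.
  by have := Xj M y.+1 (ltnSn M); lia.
pose K := rev_lpp M.+1 b.
have KM y : (y <= N)%N -> K M y = m - X M y.+1.
  move=> hy; rewrite -(subKn hy); move: (N - y)%N (leq_subr y N) => d.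
  elim: d => [|d IHd] hd.
    by rewrite subn0 /K rev_lpp_out ?leqnn ?orbT // Xm //; lia.
  rewrite /K rev_lppE //; last by lia.
  rewrite (_ : (N - d.+1).+1 = (N - d)%N); last by lia.
  rewrite -/K IHd; last by lia.
  rewrite [K M.+1 _]rev_lpp_out ?leqnn // /b ltnn.
  rewrite (_ : (N - d.+1).+2 = (N - d).+1); last by lia.
  rewrite (_ : (N - d.+1).+1 = (N - d)%N); last by lia.
  have hm : X M (N - d).+1 <= m.
    rewrite -(Xm M N.+1) //.
    have : ((N - d).+1 <= N.+1)%N by lia.
    move: (N - d).+1 => k hk; rewrite -(subnK hk); move: (N.+1 - k)%N => e.
    by elim: e => [|e IHe]; [|apply: le_trans IHe _; rewrite addSn; apply: Xj].
  lia.
have a2X y : (0 < M)%N -> (y < N)%N -> lpp a2 M y.+1 = X M.-1 y.+1.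
  move=> M0 hy; rewrite -hX ?prednK // -{2}(prednK M0) nabove_last prednK //.
  by rewrite /lppm hy.
have X_ge0 x j : (x <= M)%N -> 0 <= X x j.
  move=> hx; elim: j => [|j IHj]; first by rewrite X0 //.
  exact: le_trans IHj (Xj _ _ _).
have inv d x y : (x <= M)%N -> (y < N)%N -> (M - x + (N - y) <= d)%N ->
    Num.max (lpp a2 x y.+1) (if (x < M)%N then lpp a2 x.+1 y else 0) + K x y <= m.
  elim: d x y => [|d IHd] x y hx hy hd; first by lia.
  case: (ltnP x M) => hxM.
    rewrite /K rev_lppE // -/K {1}/b hxM.
    have e1 := lppSS a2 x y.
    have h1 := IHd x.+1 y hxM hy _.
    case: (ltnP y.+1 N) => hy2.
      have := IHd x y.+1 hx hy2; rewrite hxM; case: (ltnP x.+1 M) h1; lia.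
    rewrite [K x y.+1]rev_lpp_out ?hy2 ?orbT //.
    have := valid_lpp va2 hxM hy.
    case: (ltnP x.+1 M) h1; lia.
  have eM : x = M by lia.
  rewrite eM KM; last by lia.
  have := X_ge0 M y.+1 (leqnn M).
  case: (posnP M) => [M0|M0]; first by rewrite M0 /lpp; lia.
  rewrite a2X //; have := Xx M.-1 y.+1; rewrite prednK //.
  by have := X_ge0 M.-1 y.+1; lia.
have Km : K 0%N 0%N <= m.
  case: (posnP N) => [N0|N0]; first by rewrite /K rev_lpp_out ?N0.
  have := inv _ 0%N 0%N (leq0n M) N0 (leqnn _).
  by rewrite [lpp a2 0 _]/lpp; lia.
have [a [va ha hL]] := rowmotion_onto b0 Km.
exists a; split=> // x j; rewrite ltnS leq_eqVlt => /orP[/eqP->|hx].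
  rewrite nabove_last /lppm; case: ifP => hj; last by rewrite Xm //; lia.
  case: j hj => [|j] hj; first by rewrite lppx0 X0.
  by rewrite hL // -/K KM; lia.
rewrite nabove_prev // -hX //; apply: eq_nabove => // x' y hx' hy.
by rewrite ha // /b ?hx' //; lia.
Qed.
End Bijection.

(** * Maximizers and signatures *)

(** The sums S_l and T_l, for lines numbered in the reverse order. *)
Definition profile (b c : nat -> int) (k x : nat) : int :=
  \sum_(z < x.+1) b z + \sum_(x <= z < k) c z.

Lemma profileS b c k x : (x <= k)%N -> profile b c k.+1 x =
  if x == k then \sum_(z < k.+1) b z + c k else profile b c k x + c k.
Proof.
move=> hx; rewrite /profile; case: eqP => [->|ne]; first by rewrite big_nat1.
by rewrite big_nat_recr //= addrA.
Qed.

(** The block of the leftmost surviving plus is the last maximizer: adding a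
    block of b k minus signs and c k plus signs makes k a maximizer exactly when
    the minus signs exhaust the pluses so far. *)
Lemma profile_plus_pos (b c : nat -> int) k : (forall x, (x < k.+1)%N -> 0 <= b x) ->
  let p := plus_pos b c k.+1 in
  [/\ profile b c k.+1 p = pluses b c k.+1 + \sum_(z < k.+1) b z,
      forall x, (x < k.+1)%N -> profile b c k.+1 x <= profile b c k.+1 p &
      forall x, (p < x < k.+1)%N -> profile b c k.+1 x < profile b c k.+1 p].
Proof.
elim: k => [|k IH] hb.
  have p0 : plus_pos b c 1 = 0%N by rewrite /=; case: ifP.
  have e0 : profile b c 1 0 = b 0%N + c 0%N by rewrite profileS //= big_ord1.
  cbv zeta; rewrite p0 e0 sum_ordS big_ord0; have := hb 0%N isT.
  by split=> [|[|x]|[|x]] //; rewrite /= ?e0; lia.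
have {IH} := IH (fun x hx => hb x (leqW hx)); cbv zeta.
set q := plus_pos b c k.+1 => -[e1 e2 e3].
have qk : (q < k.+1)%N by apply: plus_pos_lt.
have -> : plus_pos b c k.+2 = if pluses b c k.+1 <= b k.+1 then k.+1 else q by [].
have bk := hb k.+1 (ltnSn _).
have hs := sum_ordS b k.+1.
rewrite (plusesS b c k.+1); case: (lerP (pluses b c k.+1) (b k.+1)) => h; cbv zeta.
  rewrite (profileS b c (leqnn k.+1)) eqxx; split=> [|x hx|x]; last by lia.
    by lia.
  rewrite profileS //; case: eqP => [_|ne]; first by lia.
  by have := e2 x (_ : (x < k.+1)%N); lia.
rewrite [profile b c k.+2 q]profileS ?(ltnW qk) // ifF; last by lia.
split=> [|x hx|x /andP[hx1 hx]]; first by lia.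
- rewrite profileS //; case: eqP => [_|ne]; first by lia.
  by have := e2 x (_ : (x < k.+1)%N); lia.
- rewrite profileS //; case: eqP => [_|ne]; first by lia.
  by have := e3 x (_ : (q < x < k.+1)%N); lia.
Qed.

(** The block of the rightmost surviving minus is the first maximizer, for the
    same reason with a strict inequality. *)
Lemma profile_minus_pos (b c : nat -> int) k : (forall x, (x < k.+1)%N -> 0 <= b x) ->
  let q := minus_pos b c k.+1 in
  [/\ profile b c k.+1 q = minuses b c k.+1 + \sum_(z < k.+1) c z,
      forall x, (x < k.+1)%N -> profile b c k.+1 x <= profile b c k.+1 q &
      forall x, (x < q)%N -> profile b c k.+1 x < profile b c k.+1 q].
Proof.
elim: k => [|k IH] hb.
  have p0 : minus_pos b c 1 = 0%N by rewrite /=; case: ifP.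
  have e0 : profile b c 1 0 = b 0%N + c 0%N by rewrite profileS //= big_ord1.
  cbv zeta; rewrite p0 e0 sum_ordS big_ord0; have := hb 0%N isT.
  by split=> [|[|x]|x] //; rewrite /= ?e0; lia.
have {IH} := IH (fun x hx => hb x (leqW hx)); cbv zeta.
set q := minus_pos b c k.+1 => -[e1 e2 e3].
have qk : (q < k.+1)%N by apply: minus_pos_lt.
have -> : minus_pos b c k.+2 = if pluses b c k.+1 < b k.+1 then k.+1 else q by [].
have bk := hb k.+1 (ltnSn _).
have hs := sum_ordS b k.+1.
have ht := sum_ordS c k.+1.
have [pm1 pm2 _] := profile_plus_pos c (fun x hx => hb x (leqW hx)).
have qle := pm2 _ qk.
have pk : (plus_pos b c k.+1 < k.+1)%N by apply: plus_pos_lt.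
have := e2 _ pk => ple.
have -> : minuses b c k.+2 = minuses b c k.+1 + Num.max 0 (b k.+1 - pluses b c k.+1) by [].
case: (ltrP (pluses b c k.+1) (b k.+1)) => h; cbv zeta.
  rewrite (profileS b c (leqnn k.+1)) eqxx; split=> [|x hx|x hx].
  - by lia.
  - rewrite profileS //; case: eqP => [_|ne]; first by lia.
    by have := e2 x (_ : (x < k.+1)%N); lia.
  - rewrite profileS; last by lia.
    by rewrite ifF; [have := e2 x hx|]; lia.
rewrite [profile b c k.+2 q]profileS ?(ltnW qk) // ifF; last by lia.
split=> [|x hx|x hx]; first by lia.
- rewrite profileS //; case: eqP => [_|ne]; first by lia.
  by have := e2 x (_ : (x < k.+1)%N); lia.
- rewrite profileS; last by lia.
  by rewrite ifF; [have := e3 x hx|]; lia.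
Qed.

Lemma index_iota_split a p b : (a <= p <= b)%N ->
  index_iota a b.+1 = index_iota a p ++ p :: index_iota p.+1 b.+1.
Proof.
move=> h; rewrite /index_iota (_ : (b.+1 - a = (p - a) + (b.+1 - p))%N); last by lia.
rewrite iotaD subnKC; last by lia.
by rewrite (_ : (b.+1 - p)%N = (b.+1 - p.+1).+1) //; lia.
Qed.

Lemma filter_index_iota0 (P : pred nat) a b :
  (forall q, (a <= q < b)%N -> ~~ P q) -> [seq q <- index_iota a b | P q] = [::].
Proof.
move=> h; rewrite -(filter_pred0 (index_iota a b)); apply: eq_in_filter => q.
by rewrite mem_index_iota => /h /negbTE.
Qed.

Section Argmax.
Variables (F : nat -> int) (a b p : nat).
Hypotheses (hp : (a <= p <= b)%N) (Fp : forall q, (a <= q <= b)%N -> F q <= F p).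

Let all_max : all (fun q => F q <= F p) (index_iota a b.+1).
Proof. by apply/allP => q; rewrite mem_index_iota ltnS => /Fp. Qed.

Let not_max q : F q < F p -> ~~ all (fun q' => F q' <= F q) (index_iota a b.+1).
Proof.
move=> h; apply/allPn; exists p; first by rewrite mem_index_iota ltnS.
by rewrite -ltNge.
Qed.

Lemma min_argmaxE : (forall q, (a <= q < p)%N -> F q < F p) ->
  min_argmax F a b = p.
Proof.
move=> lt_p; rewrite /min_argmax /argmaxs {2}(index_iota_split hp) filter_cat.
by rewrite filter_index_iota0 /= ?all_max // => q /lt_p /not_max.
Qed.

Lemma max_argmaxE : (forall q, (p < q <= b)%N -> F q < F p) ->
  max_argmax F a b = p.
Proof.
move=> lt_p; rewrite /max_argmax /argmaxs {2}(index_iota_split hp) filter_cat /=.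
rewrite all_max [X in _ ++ p :: X]filter_index_iota0 ?last_cat //= => q hq.
by apply/not_max/lt_p; lia.
Qed.
End Argmax.

(** * Arrays as weights on a grid *)

Section Arrays.
Variables n i : nat.
Hypothesis hi : (1 <= i <= n)%N.
Local Notation N := n.+1.

Lemma entryE (A : array n i) (r : 'I_(n.+1 - i)) (c : 'I_i) :
  entry A c.+1 (i + r) = A r c.
Proof.
rewrite /entry (big_pred1 r) => [|r']; last by rewrite /= eqn_add2l.
by rewrite (big_pred1 c) => // c'; rewrite /= eqSS.
Qed.

Lemma entry_out (A : array n i) p q : ~~ ((1 <= p <= i) && (i <= q <= n))%N ->
  entry A p q = 0.
Proof.
move=> h; rewrite /entry big1 // => r /eqP hr; rewrite big1 // => c /eqP hc.
by have := ltn_ord r; have := ltn_ord c; lia.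
Qed.

Lemma entryP (A : array n i) p q : (1 <= p <= i)%N -> (i <= q <= n)%N ->
  exists r c, [/\ p = (nat_of_ord c).+1, q = (i + nat_of_ord r)%N & entry A p q = A r c].
Proof.
move=> hp hq.
have hc : (p.-1 < i)%N by lia.
have hr : (q - i < n.+1 - i)%N by lia.
exists (Ordinal hr), (Ordinal hc); rewrite -entryE /=.
by split; [lia | lia | congr entry; lia].
Qed.

Lemma entry_mk F p q : (1 <= p <= i)%N -> (i <= q <= n)%N ->
  entry (mk_array n i F) p q = F p q.
Proof.
by move=> hp hq; have [r [c [-> -> ->]]] := entryP (mk_array n i F) hp hq; rewrite mxE.
Qed.

(** The array turned by half a turn, so that the common end of the Dyck paths
    comes first, with i empty lines y < i added in front.  This offset makes the
    index j of [nabove] refer to the same letter for all arrays of type A_n,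
    whatever i. *)
Definition fa (A : array n i) (x y : nat) : int := entry A (i - x) (n + i - y).

Lemma fa0 (A : array n i) x y : (i <= x)%N || (y < i)%N -> fa A x y = 0.
Proof. by move=> h; apply: entry_out; lia. Qed.

Lemma entry_fa (A : array n i) p q : (p <= i)%N -> (q <= n + i)%N ->
  entry A p q = fa A (i - p) (n + i - q).
Proof. by move=> hp hq; rewrite /fa; congr entry; lia. Qed.

Lemma fa_inj (A B : array n i) :
  (forall x y, (x < i)%N -> (y < N)%N -> fa A x y = fa B x y) -> A = B.
Proof.
move=> eqf; apply/matrixP => r c; have := ltn_ord r; have := ltn_ord c => hc hr.
by rewrite -!entryE !entry_fa ?eqf //; lia.
Qed.

Lemma fa_ge0 (A : array n i) :
  (forall r c, 0 <= A r c) <-> ge0_on i N (fa A).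
Proof.
split=> [h x y hx hy|h r c].
  case: (leqP i y) => hiy; last by rewrite fa0 // hiy orbT.
  by have [||r [c [_ _ e]]] := @entryP A (i - x) (n + i - y); [lia|lia|rewrite /fa e].
have := ltn_ord r; have := ltn_ord c => hc hr.
by rewrite -entryE entry_fa ?h //; lia.
Qed.

Lemma lpp_fa0 (A : array n i) x y : (y <= i)%N -> lpp (fa A) x y = 0.
Proof.
move=> hy; elim: x y hy => [//|x IHx]; elim=> [|y IHy] hy; first by rewrite lppx0.
by rewrite lppSS IHx // IHy ?fa0 ?hy ?orbT // ltnW.
Qed.

Lemma dyck_step_last b s : path dyck_step b s ->
  (b.1 <= (last b s).1)%N && (b.2 <= (last b s).2)%N.
Proof.
elim: s b => [|b' s IH] b /=; first by rewrite !leqnn.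
by case/andP => /orP[] /eqP-> /IH /=; lia.
Qed.

Lemma dyck_sum_le (A : array n i) b s : ge0_on i N (fa A) ->
    path dyck_step b s -> last b s = (i, n) -> (1 <= b.1)%N -> (i <= b.2)%N ->
  \sum_(b' <- b :: s) entry A b'.1 b'.2 <= lpp (fa A) (i - b.1).+1 (n + i - b.2).+1.
Proof.
move=> a0; elim: s b => [|b' s IH] b.
  move=> _ /= -> _ _ /=; rewrite big_seq1 /= lppSS entry_fa //; last by lia.
  by have := @lpp_ge0 (fa A) i N (i - i) (n + i - n).+1 a0; lia.
move=> hs; have hl := dyck_step_last hs; move: hs hl => /= /andP[hb hs] hl hlast b1 b2.
rewrite /= hlast /= in hl.
rewrite big_cons lppSS entry_fa; [|lia|lia].
have := IH b' hs hlast; move=> {}IH.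
have a0b : 0 <= fa A (i - b.1) (n + i - b.2) by apply: a0; lia.
case/orP: hb => /eqP eb; subst b'; have := dyck_step_last hs; rewrite hlast /= => hb'.
  have := IH b1 (leqW b2); rewrite /= => {}IH.
  by rewrite (_ : (n + i - b.2)%N = (n + i - b.2.+1).+1); lia.
have := IH (leqW b1) b2; rewrite /= => {}IH.
by rewrite (_ : (i - b.1)%N = (i - b.1.+1).+1); lia.
Qed.

(** A maximal path is followed backwards; on the border of the array only one of
    its two continuations remains. *)
Lemma dyck_exists (A : array n i) p q : ge0_on i N (fa A) ->
    (1 <= p <= i)%N -> (i <= q <= n)%N ->
  exists s, [/\ path dyck_step (p, q) s, last (p, q) s = (i, n) &
    lpp (fa A) (i - p).+1 (n + i - q).+1 <=
      \sum_(b <- (p, q) :: s) entry A b.1 b.2].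
Proof.
move=> a0 hp hq; have [d hd] := ubnP (i - p + (n - q)).
elim: d p q hp hq hd => // d IH p q hp hq hd.
have eA : fa A (i - p) (n + i - q) = entry A p q by rewrite -entry_fa //; lia.
have down : (p < i)%N -> exists s, [/\ path dyck_step (p, q) s, last (p, q) s = (i, n) &
    entry A p q + lpp (fa A) (i - p) (n + i - q).+1 <=
      \sum_(b <- (p, q) :: s) entry A b.1 b.2].
  move=> hpi; have [||| s [h1 h2 h3]] := IH p.+1 q; try lia.
  exists ((p.+1, q) :: s); split=> //=; first by rewrite h1 /dyck_step eqxx orbT.
  rewrite big_cons /= lerD2l; move: h3.
  by rewrite (_ : (i - p.+1).+1 = (i - p)%N) //; lia.
have right : (q < n)%N -> exists s, [/\ path dyck_step (p, q) s, last (p, q) s = (i, n) &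
    entry A p q + lpp (fa A) (i - p).+1 (n + i - q) <=
      \sum_(b <- (p, q) :: s) entry A b.1 b.2].
  move=> hqn; have [||| s [h1 h2 h3]] := IH p q.+1; try lia.
  exists ((p, q.+1) :: s); split=> //=; first by rewrite h1 /dyck_step eqxx.
  rewrite big_cons /= lerD2l; move: h3.
  by rewrite (_ : (n + i - q.+1).+1 = (n + i - q)%N) //; lia.
have r0 := @lpp_ge0 (fa A) i N (i - p).+1 (n + i - q) a0.
have d0 := @lpp_ge0 (fa A) i N (i - p) (n + i - q).+1 a0.
have z y : lpp (fa A) 0 y = 0 by [].
rewrite lppSS eA.
case: (ltnP p i) => hpi; case: (ltnP q n) => hqn.
- case: (lerP (lpp (fa A) (i - p) (n + i - q).+1) (lpp (fa A) (i - p).+1 (n + i - q))) => h.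
    by have [s [h1 h2 h3]] := right hqn; exists s; split=> //; lia.
  by have [s [h1 h2 h3]] := down hpi; exists s; split=> //; lia.
- have [s [h1 h2 h3]] := down hpi; exists s; split=> //.
  by move: d0; rewrite [lpp _ (i - p).+1 _]lpp_fa0; lia.
- have [s [h1 h2 h3]] := right hqn; exists s; split=> //.
  have e : (i - p)%N = 0%N by lia.
  by move: h3 r0; rewrite e z; lia.
exists [::]; split=> //=; first by congr pair; lia.
have e : (i - p)%N = 0%N by lia.
by rewrite big_seq1 /= e z lpp_fa0; lia.
Qed.

Lemma in_BmiP (m : nat) (A : array n i) : in_Bmi m A <-> valid N m%:Z i (fa A).
Proof.
split=> [[/fa_ge0 a0 hs]|[a0 hm]].
  split=> //; have [|| s [h1 h2 h3]] := @dyck_exists A 1 i a0; try lia.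
  have := hs ((1%N, i) :: s); rewrite /= eqxx h1 h2 eqxx => /(_ isT).
  apply: le_trans; move: h3.
  have -> : (i - 1).+1 = i by lia.
  by have -> : (n + i - i).+1 = N by lia.
split=> [|[//|b s] /and3P[/eqP-> hs /eqP hl]]; first exact/fa_ge0.
apply: le_trans (dyck_sum_le a0 hs hl _ _) _ => //; apply: le_trans hm.
by rewrite le_eqVlt; apply/orP; left; apply/eqP; congr lpp => /=; lia.
Qed.
End Arrays.

Lemma sum_nat_rev (P : nat -> int) K a b : (a <= b <= K.+1)%N ->
  \sum_(a <= j < b) P j = \sum_(K.+1 - b <= z < K.+1 - a) P (K - z)%N.
Proof.
case/andP=> ab; rewrite -(subnKC ab); move: (b - a)%N => d.
elim: d => [|d IH] hd; first by rewrite addn0 !big_geq.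
rewrite addnS big_nat_recr ?leq_addr //= IH; last by lia.
rewrite [RHS]big_ltn; last by lia.
rewrite [RHS]addrC (_ : (K.+1 - (a + d).+1).+1 = K.+1 - (a + d))%N; last by lia.
by congr (_ + P _); lia.
Qed.

(** * The functions phi and epsilon of an array *)

Section ArrayCrystal.
Variables n i m : nat.
Hypothesis hi : (1 <= i <= n)%N.
Local Notation N := n.+1.
Local Notation aext := (aext N m%:Z).
Implicit Type A : array n i.

Definition rowb A l : nat -> int := fa A ^~ (n + i - l)%N.
Definition rowc A l : nat -> int := aext (fa A) ^~ (n + i - l).+1.
Definition colb A l : nat -> int := fa A (i.-1 - l)%N.
Definition colc A l : nat -> int := fa A (i.-1 - l).+1.

Lemma rowbE A l x : (l <= n)%N -> rowb A l x = entry A (i - x) l.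
Proof. by move=> hl; rewrite /rowb /fa; congr entry; lia. Qed.

Lemma rowcE A l x : (i < l <= n)%N -> rowc A l x = entry A (i - x) l.-1.
Proof. by move=> hl; rewrite /rowc aextE /fa; [congr entry|]; lia. Qed.

Lemma colbE A l y : (l < i)%N -> colb A l y = entry A l.+1 (n + i - y).
Proof. by move=> hl; rewrite /colb /fa; congr entry; lia. Qed.

Lemma colcE A l y : (l < i)%N -> colc A l y = entry A l (n + i - y).
Proof. by move=> hl; rewrite /colc /fa; congr entry; lia. Qed.

Lemma sum_rowb A l a b : (l <= n)%N -> (a <= b <= i.+1)%N ->
  \sum_(a <= j < b) entry A j l = \sum_(i.+1 - b <= z < i.+1 - a) rowb A l z.
Proof.
move=> hl hab; rewrite (sum_nat_rev (fun j => entry A j l) hab).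
by apply: eq_bigr => z _; rewrite rowbE.
Qed.

Lemma sum_rowc A l a b : (i < l <= n)%N -> (a <= b <= i.+1)%N ->
  \sum_(a <= j < b) entry A j l.-1 = \sum_(i.+1 - b <= z < i.+1 - a) rowc A l z.
Proof.
move=> hl hab; rewrite (sum_nat_rev (fun j => entry A j l.-1) hab).
by apply: eq_bigr => z _; rewrite rowcE.
Qed.

Lemma sum_colb A l a b : (l < i)%N -> (a <= b <= (n + i).+1)%N ->
  \sum_(a <= j < b) entry A l.+1 j =
  \sum_((n + i).+1 - b <= z < (n + i).+1 - a) colb A l z.
Proof.
move=> hl hab; rewrite (sum_nat_rev (fun j => entry A l.+1 j) hab).
by apply: eq_bigr => z _; rewrite colbE.
Qed.

Lemma sum_colc A l a b : (l < i)%N -> (a <= b <= (n + i).+1)%N ->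
  \sum_(a <= j < b) entry A l j =
  \sum_((n + i).+1 - b <= z < (n + i).+1 - a) colc A l z.
Proof.
move=> hl hab; rewrite (sum_nat_rev (fun j => entry A l j) hab).
by apply: eq_bigr => z _; rewrite colcE.
Qed.

Lemma Sl_profile A l p : (i < l <= n)%N -> (1 <= p <= i)%N ->
  Sl A l p = profile (rowb A l) (rowc A l) i (i - p).
Proof.
move=> hl hp; rewrite /Sl sum_rowc ?sum_rowb //; try lia.
have -> : (i.+1 - p)%N = (i - p).+1 by lia.
have -> : (i.+1 - 1)%N = i by lia.
by rewrite subSS subnn big_mkord addrC.
Qed.

Lemma colb0 A l y : (y < i)%N -> colb A l y = 0.
Proof. by move=> h; rewrite /colb fa0 // h orbT. Qed.

Lemma colc0 A l y : (y < i)%N -> colc A l y = 0.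
Proof. by move=> h; rewrite /colc fa0 // h orbT. Qed.

Lemma sum_low0 (f : nat -> int) k : (forall y, (y < i)%N -> f y = 0) -> (i <= k)%N ->
  \sum_(i <= z < k) f z = \sum_(z < k) f z.
Proof.
move=> f0 hk; rewrite -(big_mkord xpredT f) [RHS](@big_cat_nat _ _ _ i) //=.
have -> : \sum_(0 <= z < i) f z = 0.
  by rewrite big_nat big1 // => z /andP[_ hz]; rewrite f0.
by rewrite add0r.
Qed.

Lemma Tl_profile A l p : (l < i)%N -> (i <= p <= n)%N ->
  Tl A l p = profile (colb A l) (colc A l) N (n + i - p).
Proof.
move=> hl hp; rewrite /Tl sum_colc ?sum_colb //; try lia.
have -> : ((n + i).+1 - p)%N = (n + i - p).+1 by lia.
have -> : ((n + i).+1 - i)%N = N by lia.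
have -> : ((n + i).+1 - n.+1)%N = i by lia.
rewrite sum_low0 1?addrC //; last by lia.
exact: colb0.
Qed.

Section Valid.
Variable A : array n i.
Hypothesis vA : valid N m%:Z i (fa A).

Lemma rowb_ge0 l x : (i <= l <= n)%N -> (x < i)%N -> 0 <= rowb A l x.
Proof. by case: vA => a0 _ hl hx; apply: a0; lia. Qed.

Lemma rowc_ge0 l x : (i <= l <= n)%N -> (x < i)%N -> 0 <= rowc A l x.
Proof.
case: (vA) => a0 _ hl hx; rewrite /rowc /aext; case: ifP => h; first by apply: a0.
by case: eqP => // _; have := valid_lpp vA (_ : (1 <= i)%N) (leqnn N); lia.
Qed.

Lemma colb_ge0 l x : (0 < l < i)%N -> (x < N)%N -> 0 <= colb A l x.
Proof. by case: vA => a0 _ hl hx; apply: a0; lia. Qed.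

Lemma colc_ge0 l x : (0 < l < i)%N -> (x < N)%N -> 0 <= colc A l x.
Proof. by case: vA => a0 _ hl hx; apply: a0; lia. Qed.

(** Since [fa] reverses the order of p, the smallest maximizer of S_l is the
    last one of the profile. *)
Lemma array_row l : (i < l <= n)%N ->
  [/\ array_phi m l A = pluses (rowb A l) (rowc A l) i,
      array_eps l A = minuses (rowb A l) (rowc A l) i,
      p_plus A l = (i - plus_pos (rowb A l) (rowc A l) i)%N &
      q_plus A l = (i - minus_pos (rowb A l) (rowc A l) i)%N].
Proof.
move=> hl; have i0 : (0 < i)%N by lia.
have b0 x : (x < i.-1.+1)%N -> 0 <= rowb A l x by move=> hx; apply: rowb_ge0; lia.
have [p1 p2 p3] := profile_plus_pos (rowc A l) b0.
have [q1 q2 q3] := profile_minus_pos (rowc A l) b0.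
have pi := plus_pos_lt (rowb A l) (rowc A l) i0.
have qi := minus_pos_lt (rowb A l) (rowc A l) i0.
rewrite !prednK // in p1 p2 p3 q1 q2 q3.
set P := plus_pos _ _ i in p1 p2 p3 pi *; set Q := minus_pos _ _ i in q1 q2 q3 qi *.
have SP x : (x < i)%N -> Sl A l (i - x) = profile (rowb A l) (rowc A l) i x.
  by move=> hx; rewrite Sl_profile ?subKn //; lia.
have pE : p_plus A l = (i - P)%N.
  apply: min_argmaxE; first by lia.
    by move=> q hq; rewrite !Sl_profile ?subKn; [apply: p2| | | | |]; lia.
  by move=> q hq; rewrite !Sl_profile ?subKn; [apply: p3| | | | |]; lia.
have qE : q_plus A l = (i - Q)%N.
  apply: max_argmaxE; first by lia.
    by move=> q hq; rewrite !Sl_profile ?subKn; [apply: q2| | | | |]; lia.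
  by move=> q hq; rewrite !Sl_profile ?subKn; [apply: q3| | | | |]; lia.
have li : (l == i) = false by lia.
have ll : (i < l)%N by lia.
split=> //.
  rewrite /array_phi li ll pE; apply: (@addIr _ (\sum_(1 <= j < i.+1) entry A j l)).
  rewrite [in RHS]sum_rowb; try lia.
  have e1 : (i.+1 - 1)%N = i by lia.
  rewrite e1 subnn big_mkord -p1 -SP // /Sl.
  rewrite (@big_cat_nat _ _ _ (i - P) 1 i.+1) /=; try lia.
  by rewrite addrA subrK.
rewrite /array_eps li ll qE; apply: (@addIr _ (\sum_(1 <= j < i.+1) entry A j l.-1)).
rewrite [in RHS]sum_rowc; try lia.
have e1 : (i.+1 - 1)%N = i by lia.
rewrite e1 subnn big_mkord -q1 -SP // /Sl.
rewrite (@big_cat_nat _ _ _ (i - Q).+1 1 i.+1) /=; try lia.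
by rewrite [X in _ + X]addrC addrA subrK addrC.
Qed.

(** The profile also runs over the empty lines y < i, where it is constant and at
    most its value at i, so that these lines change no maximum.  The smallest
    index could still select one of them; a surviving minus excludes that. *)
Lemma array_col l : (0 < l < i)%N ->
  [/\ array_phi m l A = minuses (colb A l) (colc A l) N,
      array_eps l A = pluses (colb A l) (colc A l) N,
      0 < minuses (colb A l) (colc A l) N ->
        (i <= minus_pos (colb A l) (colc A l) N)%N /\
        p_minus A l = (n + i - minus_pos (colb A l) (colc A l) N)%N &
      (i <= plus_pos (colb A l) (colc A l) N)%N /\
      q_minus A l = (n + i - plus_pos (colb A l) (colc A l) N)%N].
Proof.
move=> hl; have li : (l < i)%N by lia.
have b0 x : (x < N)%N -> 0 <= colb A l x by move=> hx; apply: colb_ge0; lia.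
have [p1 p2 p3] := profile_plus_pos (colc A l) b0.
have [q1 q2 q3] := profile_minus_pos (colc A l) b0.
have pi := plus_pos_lt (colb A l) (colc A l) (ltn0Sn n).
have qi := minus_pos_lt (colb A l) (colc A l) (ltn0Sn n).
set P := plus_pos _ _ N in p1 p2 p3 pi *; set Q := minus_pos _ _ N in q1 q2 q3 qi *.
have flat x : (x < i)%N -> profile (colb A l) (colc A l) N x = \sum_(z < N) colc A l z.
  move=> hx; rewrite /profile big1 ?add0r; last first.
    by move=> z _; rewrite colb0 //; have := ltn_ord z; lia.
  rewrite -(sum_low0 (k := N)); [|exact: colc0|by lia].
  rewrite (@big_cat_nat _ _ _ i x N) /=; try lia.
  by rewrite big_nat big1 ?add0r // => z hz; rewrite colc0; lia.
have flat_le x : (x < i)%N ->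
    profile (colb A l) (colc A l) N x <= profile (colb A l) (colc A l) N i.
  move=> hx; rewrite flat // /profile -(sum_low0 (k := N)); [|exact: colc0|by lia].
  by rewrite lerDr sumr_ge0 // => z _; apply: b0; have := ltn_ord z; lia.
have TP p : (i <= p <= n)%N -> Tl A l p = profile (colb A l) (colc A l) N (n + i - p).
  exact: Tl_profile.
have iP : (i <= P)%N.
  rewrite leqNgt; apply/negP => h; have := p3 i (_ : (P < i < N)%N).
  by have := flat_le P h; lia.
have TPP : Tl A l (n + i - P) = profile (colb A l) (colc A l) N P.
  by rewrite TP; [congr profile|]; lia.
(* a first maximizer on the empty lines may be replaced by i *)
pose R := maxn Q i.
have RE : profile (colb A l) (colc A l) N R = profile (colb A l) (colc A l) N Q.
  rewrite /R; case: (ltnP Q i) => h.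
    have := flat_le Q h; have := q2 i (_ : (i < N)%N); lia.
  by [].
have TPR : Tl A l (n + i - R) = profile (colb A l) (colc A l) N R.
  by rewrite TP; [congr profile|]; lia.
have pE : p_minus A l = (n + i - R)%N.
  apply: max_argmaxE; first by lia.
    by move=> q hq; rewrite TPR RE TP //; apply: q2; lia.
  by move=> q hq; rewrite TPR RE TP; [apply: q3|]; lia.
have qE : q_minus A l = (n + i - P)%N.
  apply: min_argmaxE; first by lia.
    by move=> q hq; rewrite TPP TP //; apply: p2; lia.
  by move=> q hq; rewrite TPP TP; [apply: p3|]; lia.
have li1 : (l == i) = false by lia.
have li2 : (i < l)%N = false by lia.
have e1 : ((n + i).+1 - i)%N = N by lia.
have e2 : ((n + i).+1 - N)%N = i by lia.
split=> //.
- rewrite /array_phi li1 li2 pE; apply: (@addIr _ (\sum_(i <= j < N) entry A l j)).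
  rewrite [in RHS]sum_colc ?e1 ?e2; try lia.
  rewrite (sum_low0 (f := colc A l)); [|exact: colc0|by lia].
  rewrite -q1 -RE -TPR /Tl.
  rewrite (@big_cat_nat _ _ _ (n + i - R).+1 i N) /=; try lia.
  by rewrite [X in _ + X]addrC addrA subrK addrC.
- rewrite /array_eps li1 li2 qE; apply: (@addIr _ (\sum_(i <= j < N) entry A l.+1 j)).
  rewrite [in RHS]sum_colb ?e1 ?e2; try lia.
  rewrite (sum_low0 (f := colb A l)); [|exact: colb0|by lia].
  rewrite -p1 -TPP /Tl.
  rewrite (@big_cat_nat _ _ _ (n + i - P) i N) /=; try lia.
  by rewrite addrA subrK.
- move=> hm; have iQ : (i <= Q)%N.
    by rewrite leqNgt; apply/negP => h; have := flat Q h; lia.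
  by rewrite pE /R (maxn_idPl iQ).
Qed.

Lemma rowc_corner x : rowc A i x = if x == 0%N then m%:Z - lpp (fa A) 1 N else 0.
Proof. by rewrite /rowc addnK /aext ltnn. Qed.

(** All pluses lie in the first block, which is therefore the block of the
    operator.  They are at least as many as the minus signs behind them, because
    the path along the first row and the last column weighs at most m. *)
Lemma array_corner : 
  [/\ array_phi m i A = pluses (rowb A i) (rowc A i) i,
      array_eps i A = minuses (rowb A i) (rowc A i) i &
      0 < pluses (rowb A i) (rowc A i) i -> plus_pos (rowb A i) (rowc A i) i = 0%N].
Proof.
have i0 : (0 < i)%N by lia.
have b0 x : (x < i)%N -> 0 <= rowb A i x by move=> hx; apply: rowb_ge0; lia.
have [a0 am] := vA.
have lm1 : lpp (fa A) 1 N <= m by have := valid_lpp vA i0 (leqnn N); lia.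
have FE : pluses (rowb A i) (rowc A i) i = Num.max 0
    (m%:Z - lpp (fa A) 1 N + rowb A i 0%N - \sum_(x < i) rowb A i x).
  rewrite pluses_single // ?rowc_corner ?eqxx //; first by lia.
  by move=> x hx; rewrite rowc_corner ifF //; lia.
have bound : lpp (fa A) 1 N + \sum_(x < i) rowb A i x - rowb A i 0%N <= m.
  have key k : lpp (fa A) 1 N + \sum_(x < k.+1) rowb A i x - rowb A i 0%N <=
      lpp (fa A) k.+1 N.
    elim: k => [|k IH]; first by rewrite sum_ordS big_ord0; lia.
    rewrite (sum_ordS _ k.+1) (lppSS _ k.+1).
    have -> : fa A k.+1 n = rowb A i k.+1 by rewrite /rowb addnK.
    by lia.
  by have := key i.-1; rewrite prednK // => h; apply: le_trans h am.
have sumL : lpp (fa A) 1 N = \sum_(i <= j < N) entry A i j.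
  rewrite (@lpp1 _ i.-1 N N) ?prednK // (@sum_nat_rev _ (n + i)); last by lia.
  have -> : ((n + i).+1 - i)%N = N by lia.
  have -> : ((n + i).+1 - N)%N = i by lia.
  rewrite sum_low0; [|by move=> y hy; rewrite entry_out //; lia|by lia].
  by apply: eq_bigr => z _; rewrite /fa subn0.
have sumb : \sum_(x < i) rowb A i x - rowb A i 0%N = \sum_(1 <= j < i) entry A j i.
  rewrite sum_rowb; try lia.
  rewrite subSn // subnn subn1 /= -(big_mkord xpredT (rowb A i)) big_ltn //.
  by rewrite [rowb A i 0 + _]addrC addrK.
have b00 : rowb A i 0%N = entry A i i by rewrite rowbE ?subn0 //; lia.
have phiE : array_phi m i A = pluses (rowb A i) (rowc A i) i.
  by rewrite /array_phi eqxx FE -sumb -sumL; lia.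
split=> //.
  have := pluses_minuses (rowb A i) (rowc A i) i.
  rewrite (sum_ordB (rowc A i)) -phiE /array_phi eqxx /array_eps eqxx -sumL -sumb.
  have -> : \sum_(x < i) rowc A i x = m%:Z - lpp (fa A) 1 N.
    have key k : \sum_(x < k.+1) rowc A i x = m%:Z - lpp (fa A) 1 N.
      elim: k => [|k IH]; rewrite sum_ordS ?IH ?big_ord0 rowc_corner //=; lia.
    by have := key i.-1; rewrite prednK.
  by rewrite b00; lia.
by move=> h; have := plus_pos_gt0 b0 h; rewrite rowc_corner; case: eqP.
Qed.
End Valid.
End ArrayCrystal.

(** * The crystal operators of arrays *)

Lemma lpp_rows_eq M N a a' y : (y.+1 < N)%N ->
    (forall x y', (x < M)%N -> (y' < N)%N -> y' != y -> y' != y.+1 ->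
      a' x y' = a x y') ->
    (forall x, (x <= M)%N ->
      pass (pass (lpp a ^~ y) (a' ^~ y)) (a' ^~ y.+1) x =
      pass (pass (lpp a ^~ y) (a ^~ y)) (a ^~ y.+1) x) ->
  lpp a' M N = lpp a M N.
Proof.
move=> hy eqa eqw.
have eu x : (x <= M)%N -> lpp a' x y = lpp a x y.
  move=> hx; apply: (@eq_lpp _ _ M y) => // x' y' hx' hy'.
  by apply: eqa; lia.
rewrite (@eq_lpp_above N M a a' y.+2) //; last by lia.
  move=> x hx; rewrite !lpp_row.
  have -> : lpp a ^~ y.+1 = pass (lpp a ^~ y) (a ^~ y).
    by apply: functional_extensionality => z; rewrite lpp_row.
  rewrite -eqw //; apply: (@eq_pass_l _ _ _ M) => // z hz.
  by rewrite lpp_row; apply: (@eq_pass_l _ _ _ M) => // z' hz'; rewrite eu.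
by move=> x y' hx hy'; apply: eqa; lia.
Qed.

Lemma sum_nat_ltn (f : nat -> int) a b : (a < b)%N ->
  \sum_(a <= j < b) f j = f a + \sum_(a.+1 <= j < b) f j.
Proof. exact: big_ltn. Qed.

Lemma lpp_swap a x y : lpp (fun x y => a y x) x y = lpp a y x.
Proof.
elim: x y => [|x IHx]; first by move=> y; rewrite lppx0.
by elim=> [|y IHy]; rewrite ?lppx0 // !lppSS IHx IHy maxC.
Qed.

Section ArrayMoves.
Variables n i m : nat.
Hypothesis hi : (1 <= i <= n)%N.
Local Notation N := n.+1.
Local Notation valid := (valid N m%:Z).
Local Notation tm A l := (tminus N m%:Z i (fa A) (N - l)).
Local Notation tp A l := (tplus N m%:Z i (fa A) (N - l)).
Implicit Type A : array n i.

Lemma fa_add A p q z x y : (1 <= p <= i)%N -> (i <= q <= n)%N ->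
    (x < i)%N -> (y < N)%N ->
  fa (add_entry p q z A) x y =
    fa A x y + (if (x == i - p)%N && (y == n + i - q)%N then z else 0).
Proof.
move=> hp hq hx hy; case: (leqP i y) => hiy; last first.
  rewrite !fa0 ?hiy ?orbT // ifF ?addr0 //; lia.
rewrite /fa /add_entry entry_mk; try lia.
congr (_ + _); rewrite xpair_eqE.
by have -> : ((i - x == p) && (n + i - y == q))%N = ((x == i - p) && (y == n + i - q))%N by lia.
Qed.

Lemma fa_move A p q p' q' : (1 <= p <= i)%N -> (i <= q <= n)%N ->
    (1 <= p' <= i)%N -> (i <= q' <= n)%N ->
  moved N i (fa A) (fa (add_entry p' q' 1 (add_entry p q (-1) A)))
    (i - p, n + i - q)%N (i - p', n + i - q')%N.
Proof.
move=> hp hq hp' hq' x y hx hy; rewrite !fa_add //=.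
by case: ifP; case: ifP; lia.
Qed.

Lemma add_entryC A p q z p' q' z' :
  add_entry p q z (add_entry p' q' z' A) = add_entry p' q' z' (add_entry p q z A).
Proof.
apply/matrixP => r c; have := ltn_ord r; have := ltn_ord c => hc hr.
by rewrite !mxE !entry_mk ?addrA ?[_ + _ + (if _ then z else _)]addrAC //; lia.
Qed.

Section Valid.
Variable A : array n i.
Hypothesis vA : valid i (fa A).

(** The signature of the two lines of the array is that of the two lines of the
    tableau; epsilon then follows from phi, because both differences are the same
    sum. *)
Lemma array_lines l : (1 <= l <= n)%N ->
  array_phi m l A = pluses (tm A l) (tp A l) i /\
  array_eps l A = minuses (tm A l) (tp A l) i.
Proof.
move=> hl; have D0 : (0 < N - l)%N by lia.
have := pluses_minuses (tm A l) (tp A l) i.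
case: (ltngtP l i) => hli.
- have hx : ((i.-1 - l).+1 + N = i + (N - l))%N by lia.
  have hD : (0 < N - l < N)%N by lia.
  have [-> -> _] := crystal_cols vA hx hD.
  have [|-> -> _ _] := array_col hi vA (l := l); first by lia.
  have := pluses_minuses (colb A l) (colc A l) N.
  have -> : \sum_(x < N) (colc A l x - colb A l x) =
      - \sum_(x < N) (fa A (i.-1 - l) x - fa A (i.-1 - l).+1 x).
    by rewrite -sumrN; apply: eq_bigr => y _; rewrite opprB.
  by rewrite /colb /colc; lia.
- have hD : (N - l + i <= N)%N by lia.
  have [] := crystal_rows vA D0 hD.
  rewrite (_ : (N - l + i).-1 = (n + i - l)%N); last by lia.
  move=> -> -> _; have [|-> -> _ _] := array_row hi vA (l := l); first by lia.
  have := pluses_minuses (rowb A l) (rowc m A l) i.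
  by rewrite /rowb /rowc; lia.
- have hD : (N - l + i <= N)%N by lia.
  have [] := crystal_rows vA D0 hD.
  rewrite (_ : (N - l + i).-1 = (n + i - l)%N); last by lia.
  move=> -> -> _; rewrite hli; have [-> -> _] := array_corner hi vA.
  have := pluses_minuses (rowb A i) (rowc m A i) i.
  by rewrite /rowb /rowc; lia.
Qed.

Lemma array_f_row l : (i < l <= n)%N -> let p := plus_pos (rowb A l) (rowc m A l) i in
  0 < pluses (rowb A l) (rowc m A l) i -> exists A', array_f m l A = Some A' /\
    moved N i (fa A) (fa A') (p, (n + i - l).+1)%N (p, n + i - l)%N.
Proof.
move=> hl p hF; have [e1 _ e2 _] := array_row hi vA hl.
have hp : (p < i)%N by apply: plus_pos_lt; lia.
rewrite /array_f ifF; last by rewrite e1; lia.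
rewrite ifF ?ifT; try lia.
rewrite e2 -/p; eexists; split; first by [].
have := @fa_move A (i - p) l.-1 (i - p) l; rewrite subKn; last by lia.
have -> : (n + i - l.-1 = (n + i - l).+1)%N by lia.
by apply; lia.
Qed.

Lemma array_f_corner : 0 < array_phi m i A ->
  exists A', array_f m i A = Some A' /\ moved N i (fa A) (fa A') (0, N)%N (0, n)%N.
Proof.
move=> hF; rewrite /array_f eqxx ifF; last by lia.
eexists; split; first by [].
move=> x y hx hy /=; rewrite fa_add //; try lia.
by rewrite subnn addnK; case: ifP; lia.
Qed.

Lemma array_f_col l : (0 < l < i)%N -> let q := minus_pos (colb A l) (colc A l) N in
  0 < minuses (colb A l) (colc A l) N -> exists A', array_f m l A = Some A' /\
    moved N i (fa A) (fa A') (i.-1 - l, q)%N ((i.-1 - l).+1, q)%N.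
Proof.
move=> hl q hF; have [e1 _ e2 _] := array_col hi vA hl.
have [hq e3] := e2 hF.
have hq2 : (q < N)%N by apply: minus_pos_lt.
rewrite /array_f ifF; last by rewrite e1; lia.
rewrite ifF ?ifF; try lia.
rewrite e3 -/q add_entryC; eexists; split; first by [].
have := @fa_move A l.+1 (n + i - q) l (n + i - q); rewrite subKn; last by lia.
have -> : (i - l.+1 = i.-1 - l)%N by lia.
have -> : (i - l = (i.-1 - l).+1)%N by lia.
by apply; lia.
Qed.

Lemma array_f_crystal l : (1 <= l <= n)%N -> 0 < array_phi m l A ->
  exists A', [/\ array_f m l A = Some A', valid i (fa A') &
    nabove_bumped N m%:Z i (fa A) (fa A') (N - l) (plus_pos (tm A l) (tp A l) i)].
Proof.
move=> hl hF; have D0 : (0 < N - l)%N by lia.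
case: (ltngtP l i) => hli.
- have hx : ((i.-1 - l).+1 + N = i + (N - l))%N by lia.
  have hD : (0 < N - l < N)%N by lia.
  have hl' : (0 < l < i)%N by lia.
  have [_ _ hX] := crystal_cols vA hx hD.
  have [e1 _ _ _] := array_col hi vA hl'.
  have [|A' [e2 hmv]] := array_f_col hl'; first by rewrite -e1.
  exists A'; have [|//|v1 v2] := hX (fa A'); first by rewrite -[minuses _ _ _]e1.
  by split.
- have hD : (N - l + i <= N)%N by lia.
  have hl' : (i < l <= n)%N by lia.
  have [] := crystal_rows vA D0 hD.
  have -> : ((N - l + i).-1 = n + i - l)%N by lia.
  move=> _ _ hX; have [e1 _ _ _] := array_row hi vA hl'.
  have [|A' [e2 hmv]] := array_f_row hl'; first by rewrite -e1.
  exists A'; have [|//|v1 v2] := hX (fa A'); first by rewrite -[pluses _ _ _]e1.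
  by split.
- have hD : (N - l + i <= N)%N by lia.
  have [] := crystal_rows vA D0 hD.
  have -> : ((N - l + i).-1 = n + i - l)%N by lia.
  rewrite hli in hF *; move=> _ _ hX; have [e1 _ ep] := array_corner hi vA.
  have [A' [e2 hmv]] := array_f_corner hF; rewrite e1 in hF.
  exists A'; have [|v1 v2] := hX (fa A') hF; last by split.
  move: (ep hF); rewrite /rowb /rowc => ->; rewrite addnK; exact: hmv.
Qed.

End Valid.

Lemma moved_back M a a' b s t : moved N M a a' s t -> moved N M a' b t s ->
  forall x y, (x < M)%N -> (y < N)%N -> b x y = a x y.
Proof. by move=> h1 h2 x y hx hy; rewrite h2 // h1 //; lia. Qed.

(** By [pass_raise] the times behind the two lines are unchanged, so the raised
    array satisfies the Dyck condition. *)
Lemma array_e_row A l : valid i (fa A) -> (i < l <= n)%N -> 0 < array_eps l A ->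
  exists A', [/\ array_e l A = Some A', valid i (fa A') & array_f m l A' = Some A].
Proof.
move=> vA hl hE; have [_ e1 _ e2] := array_row hi vA hl.
set b := rowb A l in e1 e2; set c := rowc m A l in e1 e2.
set q := minus_pos b c i in e2.
have hq : (q < i)%N by apply: minus_pos_lt; lia.
pose A' := add_entry (i - q) l (-1) (add_entry (i - q) l.-1 1 A).
have e3 : array_e l A = Some A'.
  rewrite /array_e ifF; last by lia.
  rewrite ifF ?ifT; try lia.
  by rewrite e2.
have hmv : moved N i (fa A) (fa A') (q, n + i - l)%N (q, (n + i - l).+1)%N.
  rewrite /A' add_entryC; have := @fa_move A (i - q) l (i - q) l.-1.
  rewrite subKn; last by lia.
  have -> : (n + i - l.-1 = (n + i - l).+1)%N by lia.
  by apply; lia.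
have b0 x : (x < i)%N -> 0 <= b x by move=> hx; apply: (rowb_ge0 hi vA); lia.
have c0 x : (x < i)%N -> 0 <= c x by move=> hx; apply: (rowc_ge0 hi vA); lia.
have hE' : 0 < minuses b c i by rewrite -e1.
have bq := minus_pos_gt0 c0 hE'; rewrite -/q in bq.
have hb x : (x < i)%N -> rowb A' l x = decr b q x.
  by move=> hx; rewrite /rowb hmv /= /decr; [rewrite /b /rowb|..]; lia.
have hc x : (x < i)%N -> rowc m A' l x = incr c q x.
  by move=> hx; rewrite /rowc /c /rowc /incr !aextE ?hmv //=; lia.
have [a0 am] := vA.
have va' : valid i (fa A').
  split=> [x y hx hy|].
    rewrite hmv //=; have := a0 x y hx hy; case: (x =P q) => [->|_] /=; last by lia.
    by case: (y =P (n + i - l)%N) => [->|_] /=; [move: bq; rewrite /b /rowb|]; lia.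
  rewrite (@lpp_rows_eq _ _ (fa A) _ (n + i - l)) //; first by lia.
    by move=> x y hx hy h1 h2; rewrite hmv //=; lia.
  have u1 : 0 <= lpp (fa A) 1 (n + i - l).
    by have := valid_lpp vA (_ : (1 <= i)%N) (_ : (n + i - l <= N)%N); lia.
  have umono x : (0 < x < i)%N -> lpp (fa A) x (n + i - l) <= lpp (fa A) x.+1 (n + i - l).
    by move=> hx; apply: (lpp_mono a0); lia.
  have [hw _] := @pass_raise (lpp (fa A) ^~ (n + i - l)%N) b c i u1 umono b0 c0 hE'.
  have cE : c =1 fa A ^~ (n + i - l).+1 by move=> x; rewrite /c /rowc aextE //; lia.
  move=> x hx; rewrite -[RHS](@eq_pass _ c _ i) // -hw // -/q.
  rewrite (@eq_pass_l _ (pass (lpp (fa A) ^~ (n + i - l)%N) (decr b q)) _ i) //.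
    apply: (@eq_pass _ _ _ i) => // z hz; rewrite -hc // /rowc aextE //; lia.
  by move=> z hz; apply: (@eq_pass _ _ _ i) => // t ht; rewrite -hb.
exists A'; split=> //.
have [f1 f2] := pluses_raise hE'; rewrite -/q in f1 f2.
have [g1 _ g2 _] := eq_pluses hb hc.
have [|A2 [-> hmv2]] := array_f_row va' hl; first by rewrite g1 f1; have := pluses_ge0 b c0; lia.
rewrite g2 f2 in hmv2; congr Some; apply: fa_inj => //.
exact: moved_back hmv hmv2.
Qed.

Lemma array_e_corner A : valid i (fa A) -> 0 < array_eps i A ->
  exists A', [/\ array_e i A = Some A', valid i (fa A') & array_f m i A' = Some A].
Proof.
move=> vA hE; have i0 : (0 < i)%N by lia.
have [a0 am] := vA.
pose A' := add_entry i i (-1) A.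
have e3 : array_e i A = Some A' by rewrite /array_e eqxx ifF //; lia.
have eE : array_eps i A = fa A 0 n.
  by rewrite /array_eps eqxx /fa subn0; congr entry; lia.
have hfa x y : (x < i)%N -> (y < N)%N ->
    fa A' x y = fa A x y - ((x == 0%N) && (y == n))%:R.
  move=> hx hy; rewrite /A' fa_add //; try lia.
  by rewrite subnn addnK; case: ifP; lia.
have a0' : ge0_on i N (fa A').
  move=> x y hx hy; rewrite hfa //; have := a0 x y hx hy.
  case: (x =P 0%N) => [->|_] /=; last by lia.
  by case: (y =P n) => [->|_] /=; lia.
have le_lpp x y : (x <= i)%N -> (y <= N)%N -> lpp (fa A') x y <= lpp (fa A) x y.
  elim: x y => [//|x IHx]; elim=> [|y IHy] hx hy; first by rewrite !lppx0.
  rewrite !lppSS hfa //; have := IHx y.+1 (ltnW hx) hy; have := IHy hx (ltnW hy).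
  by lia.
have va' : valid i (fa A').
  by split=> //; apply: le_trans am; apply: le_lpp.
exists A'; split=> //.
have entE p q : (1 <= p <= i)%N -> (i <= q <= n)%N ->
    entry A' p q = entry A p q - ((p == i) && (q == i))%:R.
  by move=> hp hq; rewrite !entry_fa ?hfa //; lia.
have phiE : array_phi m i A' = array_phi m i A + 1.
  rewrite /array_phi eqxx (sum_nat_ltn (entry A' i)); last by lia.
  rewrite (sum_nat_ltn (entry A i)); last by lia.
  have -> : \sum_(1 <= j < i) entry A' j i = \sum_(1 <= j < i) entry A j i.
    by apply: eq_big_nat => j hj; rewrite entE; lia.
  have -> : \sum_(i.+1 <= j < N) entry A' i j = \sum_(i.+1 <= j < N) entry A i j.
    by apply: eq_big_nat => j hj; rewrite entE; lia.
  by rewrite entE ?eqxx; lia.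
have phi_ge0 : 0 <= array_phi m i A.
  have [-> _ _] := array_corner hi vA; apply: pluses_ge0 => x hx.
  by apply: (rowc_ge0 hi vA) => //; lia.
have [|A2 [-> hmv2]] := @array_f_corner A'; first by lia.
congr Some; apply: fa_inj => // x y hx hy.
by rewrite hmv2 //= hfa //; lia.
Qed.

(** As for rows, with [pass_lower] in place of [pass_raise]: for columns the
    raising operator is the one that lowers the signature. *)
Lemma array_e_col A l : valid i (fa A) -> (0 < l < i)%N -> 0 < array_eps l A ->
  exists A', [/\ array_e l A = Some A', valid i (fa A') & array_f m l A' = Some A].
Proof.
move=> vA hl hE; have [_ e1 _ [iq e2]] := array_col hi vA hl.
set b := colb A l in e1 iq e2; set c := colc A l in e1 iq e2.
set q := plus_pos b c N in iq e2.
have hq : (q < N)%N by apply: plus_pos_lt.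
pose x0 := (i.-1 - l)%N.
pose A' := add_entry l.+1 (n + i - q) 1 (add_entry l (n + i - q) (-1) A).
have e3 : array_e l A = Some A'.
  rewrite /array_e ifF; last by lia.
  rewrite ifF ?ifF; try lia.
  by rewrite e2.
have hmv : moved N i (fa A) (fa A') (x0.+1, q)%N (x0, q)%N.
  have := @fa_move A l (n + i - q) l.+1 (n + i - q).
  rewrite subKn; last by lia.
  have -> : (i - l = x0.+1)%N by rewrite /x0; lia.
  have -> : (i - l.+1 = x0)%N by rewrite /x0; lia.
  by apply; lia.
have b0 x : (x < N)%N -> 0 <= b x by move=> hx; apply: (colb_ge0 hi vA); lia.
have c0 x : (x < N)%N -> 0 <= c x by move=> hx; apply: (colc_ge0 hi vA); lia.
have hE' : 0 < pluses b c N by rewrite -e1.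
have cq := plus_pos_gt0 b0 hE'; rewrite -/q in cq.
have hb x : (x < N)%N -> colb A' l x = incr b q x.
  by move=> hx; rewrite /colb -/x0 hmv /= /incr; [rewrite /b /colb -/x0|..]; lia.
have hc x : (x < N)%N -> colc A' l x = decr c q x.
  by move=> hx; rewrite /colc -/x0 hmv /= /decr; [rewrite /c /colc -/x0|..]; lia.
have [a0 am] := vA.
have va' : valid i (fa A').
  split=> [x y hx hy|].
    rewrite hmv //=; have := a0 x y hx hy; case: (y =P q) => [->|_] /=; last by lia.
    by case: (x =P x0.+1) => [->|_] /=; [move: cq; rewrite /c /colc -/x0|]; lia.
  suff : lpp (fun x y => fa A' y x) N i = lpp (fun x y => fa A y x) N i.
    by rewrite (lpp_swap (fa A')) (lpp_swap (fa A)) => ->.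
  apply: (@lpp_rows_eq _ _ _ _ x0); first by lia.
    by move=> x y hx hy h1 h2; rewrite hmv //=; lia.
  have u1 : 0 <= lpp (fa A) x0 1.
    by have := valid_lpp vA (_ : (x0 <= i)%N) (_ : (1 <= N)%N); lia.
  have [hw _] := @pass_lower (lpp (fa A) x0) b c N u1 b0 hE'.
  have sw z : lpp (fun x y => fa A y x) z x0 = lpp (fa A) x0 z by apply: lpp_swap.
  move=> x hx.
  have -> : (lpp (fun x y => fa A y x))^~ x0 = lpp (fa A) x0.
    by apply: functional_extensionality.
  rewrite -[RHS](hw x hx) -/q.
  rewrite (@eq_pass_l _ (pass (lpp (fa A) x0) (incr b q)) _ N) //.
    by apply: (@eq_pass _ _ _ N) => // z hz; rewrite -hc.
  by move=> z hz; apply: (@eq_pass _ _ _ N) => // t ht; rewrite -hb.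
exists A'; split=> //.
have [f1 f2 f3] := minuses_lower hE' b0; rewrite -/q in f1 f2 f3.
have [_ g1 _ g2] := eq_pluses hb hc.
have [|A2 [-> hmv2]] := array_f_col va' hl.
  by rewrite g1 f2; have := minuses_ge0 b c N; lia.
rewrite g2 f3 in hmv2; congr Some; apply: fa_inj => //.
exact: moved_back hmv hmv2.
Qed.

Lemma array_e_crystal A l : valid i (fa A) -> (1 <= l <= n)%N -> 0 < array_eps l A ->
  exists A', [/\ array_e l A = Some A', valid i (fa A') & array_f m l A' = Some A].
Proof.
move=> vA hl hE; case: (ltngtP l i) => hli.
- by apply: array_e_col => //; lia.
- by apply: array_e_row => //; lia.
- by rewrite hli in hE *; apply: array_e_corner.
Qed.
End ArrayMoves.

(** * The map pr is rowmotion *)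

Lemma sum_telescope (g : nat -> int) k : (0 < k)%N ->
  \sum_(2 <= j < k.+1) (g j.-1 - g j) = g 1%N - g k.
Proof.
case: k => // k _; elim: k => [|k IH]; first by rewrite big_geq // subrr.
by rewrite big_nat_recr //= IH addrA subrK.
Qed.

Lemma sum_shift_telescope (e h : nat -> int) k : (0 < k)%N ->
  \sum_(2 <= j < k.+1) (e j.-1 + h j - h j.-1) =
  \sum_(1 <= j < k) e j + h k - h 1%N.
Proof.
case: k => // k _; elim: k => [|k IH]; first by rewrite !big_geq // add0r subrr.
rewrite big_nat_recr //= IH [in RHS]big_nat_recr //=.
by move: (\sum_(1 <= j < k.+1) e j) => S; rewrite addrACA addrC; lia.
Qed.

Section Promotion.
Variables n i m : nat.
Hypothesis hi : (1 <= i <= n)%N.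
Local Notation N0 := (n.+1 - i)%N.

Section Columns.
Variables x y : nat -> int.
Hypothesis y_ge0 : forall r, (i <= r <= n)%N -> 0 <= y r.

Let c t : int := x (n - t)%N.
Let b t : int := y (n - t)%N.

(** The column functions of pr are the signature of the two columns read from
    the bottom, by the same correspondence as for the operators. *)
Lemma colq_coleps s : (i <= s <= n)%N ->
  coleps n s x y = pluses b c (n - s).+1 /\
  colq n s x y = (n - plus_pos b c (n - s).+1)%N.
Proof.
move=> hs.
have b0 t : (t < (n - s).+1)%N -> 0 <= b t by move=> ht; apply: y_ge0; lia.
have [p1 p2 p3] := profile_plus_pos c b0.
have pk := plus_pos_lt b c (ltn0Sn (n - s)).
set P := plus_pos _ _ _ in p1 p2 p3 pk *.
have FE p : (s <= p <= n)%N ->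
    \sum_(s <= r < p.+1) x r + \sum_(p <= r < n.+1) y r = profile b c (n - s).+1 (n - p).
  move=> hp; rewrite (@sum_nat_rev x n) ?(@sum_nat_rev y n); try lia.
  have -> : (n.+1 - p)%N = (n - p).+1 by lia.
  have -> : (n.+1 - s)%N = (n - s).+1 by lia.
  by rewrite subSS subnn big_mkord addrC.
have qE : colq n s x y = (n - P)%N.
  apply: min_argmaxE; first by lia.
    by move=> q hq; rewrite !FE ?subKn; try lia; apply: p2; lia.
  by move=> q hq; rewrite !FE ?subKn; try lia; apply: p3; lia.
split=> //; rewrite /coleps qE.
apply: (@addIr _ (\sum_(s <= r < n.+1) y r)).
rewrite [in RHS](@sum_nat_rev y n); last by lia.
have -> : (n.+1 - s)%N = (n - s).+1 by lia.
rewrite subnn big_mkord -p1.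
have := FE (n - P)%N; rewrite subKn; last by lia.
move=> <-; last by lia.
rewrite (@big_cat_nat _ _ _ (n - P) s n.+1) /=; try lia.
by rewrite addrA subrK.
Qed.

Lemma coleps_n : coleps n n x y = x n + Num.max 0 (- y n).
Proof.
have [|-> _] := @colq_coleps n; first by lia.
by rewrite subnn /= /b /c subn0; lia.
Qed.

(** Adding a row on top: the excess over y s is passed on, and q_- moves to s
    exactly when there is no excess. *)
Lemma colepsS s : (i <= s < n)%N ->
  coleps n s x y = x s + Num.max 0 (coleps n s.+1 x y - y s) /\
  colq n s x y = if coleps n s.+1 x y <= y s then s else colq n s.+1 x y.
Proof.
move=> hs.
have [|-> ->] := @colq_coleps s; first by lia.
have [|-> ->] := @colq_coleps s.+1; first by lia.
have -> : (n - s)%N = (n - s.+1).+1 by lia.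
have cs : c (n - s.+1).+1 = x s by rewrite /c; congr x; lia.
have bs : b (n - s.+1).+1 = y s by rewrite /b; congr y; lia.
rewrite (plusesS b c (n - s.+1).+1) cs bs; split=> //.
rewrite -[plus_pos b c (n - s.+1).+2]/(if pluses b c (n - s.+1).+1 <= b (n - s.+1).+1
  then (n - s.+1).+1 else plus_pos b c (n - s.+1).+1) bs.
by case: ifP => // _; lia.
Qed.

Lemma colq_spec s : (i <= s <= n)%N ->
  [/\ (s <= colq n s x y <= n)%N,
      (colq n s x y < n)%N -> coleps n (colq n s x y).+1 x y <= y (colq n s x y) &
      forall r, (s <= r < colq n s x y)%N -> y r < coleps n r.+1 x y].
Proof.
move=> hs; have [d hd] := ubnP (n - s); elim: d s hs hd => // d IH s hs hd.
case: (ltnP s n) => hsn; last first.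
  have -> : s = n by lia.
  have [|_ ->] := @colq_coleps n; first by lia.
  have : (plus_pos b c (n - n).+1 < (n - n).+1)%N by apply: plus_pos_lt.
  by move=> h; split; [lia|lia|move=> r; lia].
have [|_ ->] := @colepsS s; first by lia.
case: ifP => h.
  by split=> //; [lia|move=> r; lia].
have [||h1 h2 h3] := IH s.+1; try lia.
split=> //; first by lia.
move=> r hr; case: (r =P s) => [->|ne]; first by lia.
by apply: h3; lia.
Qed.

(** Each l_j is the first row without excess, so the cuts are all the rows
    without excess. *)
Lemma mem_cuts_from f s r : (i <= s <= n)%N -> (n <= f + s)%N ->
  (r \in cuts_from n f s x y) = (s <= r < n)%N && (coleps n r.+1 x y <= y r).
Proof.
elim: f s => [|f IH] s hs hf; first by rewrite in_nil; lia.
rewrite [cuts_from _ _ _ _ _]/=; have [h1 h2 h3] := colq_spec hs.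
set l := colq n s x y in h1 h2 h3 *.
case: eqP => [ln|ln].
  rewrite in_nil; case: (boolP (s <= r < n)%N) => //= hr.
  by have := h3 r; lia.
rewrite in_cons IH; try lia.
case: (r =P l) => [->|rl] /=; first by have := h2; lia.
case: (leqP l.+1 r) => hr; last by have := h3 r; lia.
have -> : (s <= r)%N by lia.
by [].
Qed.

Lemma mem_cuts r : (r \in cuts n i x y) =
  (i <= r < n)%N && (coleps n r.+1 x y <= y r).
Proof. by rewrite /cuts mem_cuts_from //; lia. Qed.

Lemma pr_columnE r : (i < r <= n)%N ->
  pr_column n i x y r = Num.min (y r.-1) (coleps n r x y).
Proof.
move=> hr; rewrite /pr_column ifF; last by lia.
rewrite mem_cuts (_ : (i <= r.-1 < n)%N); last by lia.
by rewrite prednK /=; [case: ifP|]; lia.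
Qed.

Lemma next_columnE r : (i <= r < n)%N ->
  next_column n i x y r = x r + y r - Num.min (y r) (coleps n r.+1 x y).
Proof.
move=> hr; rewrite /next_column mem_cuts hr /=.
by case: ifP => h; [|rewrite ifF]; lia.
Qed.

Lemma next_columnE_n : next_column n i x y n = x n + y n.
Proof. by rewrite /next_column mem_cuts ltnn andbF /= eqxx. Qed.
End Columns.

(** The array turned by half a turn, without empty lines.  Rowmotion of [fa] would
    fill some of these lines, so pr is compared with rowmotion here. *)
Definition fo (A : array n i) (x y : nat) : int := entry A (i - x) (n - y).
Local Notation valid := (valid N0 m%:Z).
Local Notation rowmotion := (rowmotion N0 m%:Z).

Lemma foE (A : array n i) p q : (p <= i)%N -> (q <= n)%N ->
  entry A p q = fo A (i - p) (n - q).
Proof. by move=> hp hq; rewrite /fo; congr entry; lia. Qed.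

Section Valid.
Variable A : array n i.
Hypothesis vA : valid i (fo A).
Let a := fo A.

(** If y gives the increments of last-passage times along a column, the
    recursion [colepsS] is the recursion of last-passage times. *)
Lemma coleps_lpp X y : (0 < X < i)%N ->
    (forall r, (i <= r <= n)%N -> y r = lpp a X (n - r).+1 - lpp a X (n - r)) ->
  forall r, (i <= r <= n)%N ->
    coleps n r (entry A (i - X)) y = lpp a X.+1 (n - r).+1 - lpp a X (n - r).+1.
Proof.
move=> hX hy; have [a0 _] := vA.
have y0 r : (i <= r <= n)%N -> 0 <= y r.
  by move=> hr; rewrite hy //; have := @lpp_mono a i N0 X (n - r) X (n - r).+1 a0; lia.
have xE r : (i <= r <= n)%N -> entry A (i - X) r = a X (n - r)%N.
  by move=> hr; rewrite foE; [congr fo|..]; lia.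
move=> r hr; have [d hd] := ubnP (n - r); elim: d r hr hd => // d IH r hr hd.
case: (ltnP r n) => hrn; last first.
  have -> : r = n by lia.
  rewrite coleps_n // hy ?xE //; try lia.
  rewrite subnn lppSS !lppx0.
  by have := @lpp_ge0 a i N0 X 1 a0; lia.
have [|-> _] := @colepsS (entry A (i - X)) y y0 r; first by lia.
rewrite IH ?hy ?xE; try lia.
rewrite (lppSS a X (n - r)).
have -> : (n - r.+1).+1 = (n - r)%N by lia.
by lia.
Qed.

Lemma aux_lpp d r : (d < i)%N -> (i <= r <= n)%N ->
  aux_column_rec A d r = lpp a d.+1 (n - r).+1 - lpp a d.+1 (n - r).
Proof.
have [a0 _] := vA.
elim: d r => [|d IH] r hd hr.
  rewrite /= foE //; try lia.
  rewrite subnn lppSS; have := @lpp_ge0 a i N0 1 (n - r) a0.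
  by rewrite [lpp _ 0 _]/lpp -/a; lia.
have IH' : forall r, (i <= r <= n)%N ->
    aux_column_rec A d r = lpp a d.+1 (n - r).+1 - lpp a d.+1 (n - r).
  by move=> r' hr'; apply: IH => //; lia.
have y0 r' : (i <= r' <= n)%N -> 0 <= aux_column_rec A d r'.
  by move=> hr'; rewrite IH' //; have := @lpp_mono a i N0 d.+1 (n - r') d.+1 (n - r').+1 a0; lia.
have xE r' : (i <= r' <= n)%N -> entry A (i - d.+1) r' = a d.+1 (n - r')%N.
  by move=> hr'; rewrite foE; [congr fo|..]; lia.
rewrite [LHS]/=; case: (ltnP r n) => hrn.
  rewrite next_columnE //; last by lia.
  rewrite coleps_lpp //; try lia.
  rewrite IH' // xE // (lppSS a d.+1 (n - r)).
  have -> : (n - r.+1).+1 = (n - r)%N by lia.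
  by lia.
have -> : r = n by lia.
rewrite next_columnE_n // IH' ?xE; try lia.
by rewrite subnn (lppSS a d.+1 0) !lppx0; have := @lpp_ge0 a i N0 d.+1 1 a0; lia.
Qed.

Lemma aux_column_lpp k r : (1 <= k <= i)%N -> (i <= r <= n)%N ->
  aux_column A k r = lpp a (i - k).+1 (n - r).+1 - lpp a (i - k).+1 (n - r).
Proof. by move=> hk hr; rewrite /aux_column aux_lpp //; lia. Qed.

Lemma pr_col_lpp k r : (2 <= k <= i)%N -> (i <= r <= n)%N ->
  pr_column n i (entry A k.-1) (aux_column A k) r = rowmotion i a (i - k) (n - r).
Proof.
move=> hk hr; have [a0 _] := vA.
have y0 r' : (i <= r' <= n)%N -> 0 <= aux_column A k r'.
  move=> hr'; rewrite aux_column_lpp //; last by lia.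
  by have := @lpp_mono a i N0 (i - k).+1 (n - r') (i - k).+1 (n - r').+1 a0; lia.
have kE : k.-1 = (i - (i - k).+1)%N by lia.
have epsE r' : (i <= r' <= n)%N -> coleps n r' (entry A k.-1) (aux_column A k) =
    lpp a (i - k).+2 (n - r').+1 - lpp a (i - k).+1 (n - r').+1.
  move=> hr'; rewrite kE coleps_lpp //; first by lia.
  by move=> r2 hr2; rewrite aux_column_lpp //; lia.
rewrite /rowmotion ifT; last by lia.
case: (r =P i) => [->|ne].
  rewrite /pr_column eqxx epsE; last by lia.
  have -> : (n - i).+1 = N0 by lia.
  rewrite /lppm ltnn; have := valid_lpp vA (_ : ((i - k).+2 <= i)%N) (leqnn N0).
  by rewrite -/a; lia.
rewrite pr_columnE //; last by lia.
rewrite epsE // aux_column_lpp; try lia.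
have -> : (n - r.-1)%N = (n - r).+1 by lia.
by rewrite /lppm ifT; lia.
Qed.

(** The auxiliary columns are the increments of last-passage times along the
    columns ([aux_lpp]), so that each entry of the columns k >= 2 is a difference
    of such times.  The first column is defined by subtraction; there the sums
    telescope. *)
Lemma fo_pr x y : (x < i)%N -> (y < N0)%N -> fo (pr m A) x y = rowmotion i a x y.
Proof.
move=> hx hy; have [a0 _] := vA.
rewrite /fo entry_mk; try lia.
have -> : y = (n - (n - y))%N by lia.
have : (i <= n - y <= n)%N by lia.
move: (n - y)%N => r hr {hy}; rewrite subKn; last by lia.
rewrite /pr_entry; case: ifP => hk.
  by rewrite pr_col_lpp; [congr rowmotion|..]; lia.
have -> : x = i.-1 by lia.
have colE j r' : (2 <= j < i.+1)%N -> (i <= r' <= n)%N ->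
    pr_column n i (entry A j.-1) (aux_column A j) r' = rowmotion i a (i - j) (n - r').
  by move=> hj hr'; apply: pr_col_lpp; lia.
have i0 : (0 < i)%N by lia.
have -> : rowmotion i a i.-1 (n - r) =
    lppm N0 m%:Z a i (n - r).+2 - lpp a i (n - r).+1.
  by rewrite /rowmotion ifF prednK //; lia.
have L0 := valid_lpp vA i0 (leqnn N0).
case: (r =P i) => [->|ne].
  have -> : (n - i).+1 = N0 by lia.
  rewrite /lppm ltnn.
  have -> : \sum_(i <= j < n.+1) entry A i j = lpp a 1 N0.
    rewrite (@lpp1 a i.-1 N0 N0) ?prednK // (@sum_nat_rev _ n) ?subnn; last by lia.
    rewrite big_mkord; apply: eq_bigr => z _.
    have hz := ltn_ord z; rewrite foE; try lia.
    by rewrite /a subnn; congr fo; lia.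
  rewrite (@eq_big_nat _ _ _ 2 i.+1 _
    (fun j => lpp a (i - j.-1).+1 N0 - lpp a (i - j).+1 N0)); last first.
    move=> j hj; rewrite colE //; last by lia.
    rewrite /rowmotion ifT; last by lia.
    have -> : (n - i).+1 = N0 by lia.
    have -> : (i - j.-1)%N = (i - j).+1 by lia.
    rewrite /lppm ltnn; have := valid_lpp vA (_ : ((i - j).+2 <= i)%N) (leqnn N0).
    by rewrite -/a; lia.
  rewrite (sum_telescope (fun j => lpp a (i - j).+1 N0)) //.
  have -> : (i - 1).+1 = i by lia.
  by rewrite subnn; lia.
pose h j := lpp a (i - j).+1 (n - r).+2 - lpp a (i - j).+1 (n - r).+1.
rewrite (@eq_big_nat _ _ _ 2 i.+1 _
  (fun j => entry A j.-1 r.-1 + h j - h j.-1)); last first.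
  move=> j hj; rewrite colE //.
  rewrite /rowmotion ifT; last by lia.
  rewrite /h foE; try lia.
  have -> : (i - j.-1)%N = (i - j).+1 by lia.
  have -> : (n - r.-1)%N = (n - r).+1 by lia.
  rewrite (lppSS a (i - j).+1 (n - r).+1) /lppm ifT -/a; last by lia.
  by lia.
rewrite (sum_shift_telescope (fun j => entry A j r.-1)) //.
have -> : \sum_(1 <= j < i.+1) entry A j r.-1 =
    \sum_(1 <= j < i) entry A j r.-1 + entry A i r.-1 by rewrite big_nat_recr.
have -> : h 1%N = lpp a i (n - r).+2 - lpp a i (n - r).+1.
  by rewrite /h; have -> : (i - 1).+1 = i by lia.
have -> : h i = entry A i r.-1.
  rewrite /h subnn (lppSS a 0 (n - r).+1) foE; try lia.
  have := @lpp_ge0 a i N0 1 (n - r).+1 a0.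
  rewrite subnn [lpp _ 0 _]/lpp; have -> : (n - r.-1)%N = (n - r).+1 by lia.
  by rewrite -/a; lia.
by rewrite /lppm ifT; lia.
Qed.
End Valid.
End Promotion.

(** * Times without offset, and the recursion for rowmotion *)

Section Shift.
Variables (N0 i M : nat) (m : int).

Lemma lpp_shift k a b :
    (forall x y, (x < k)%N -> (y < i)%N -> a x y = 0) ->
    (forall x y, (x < k)%N -> (y < N0)%N -> a x (y + i)%N = b x y) ->
  forall x y, (x <= k)%N -> (y <= N0 + i)%N ->
    lpp a x y = lpp b x (y - i)%N.
Proof.
move=> a0 ab; elim=> [//|x IHx]; elim=> [|y IHy] hx hy; first by rewrite !lppx0.
have h1 := IHx y.+1 (ltnW hx) hy; have h2 := IHy hx (ltnW hy).
rewrite lppSS h1 h2; case: (ltnP y i) => hyi.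
  have -> : (y.+1 - i = 0)%N by lia.
  have -> : (y - i = 0)%N by lia.
  by rewrite !lppx0 a0 //; lia.
have -> : (y.+1 - i = (y - i).+1)%N by lia.
by rewrite lppSS -ab ?subnK //; lia.
Qed.

(** Rowmotion does not respect the empty lines, but it spoils only a triangle
    growing by one column at each step, and the boundary values [nabove] do not
    see it. *)
Lemma iter_rowmotion_shift s a b : valid N0 m M b ->
    (forall x y, (x < M)%N -> (y < i)%N -> a x y = 0) ->
    (forall x y, (x < M)%N -> (y < N0)%N -> a x (y + i)%N = b x y) ->
  (forall x y, (x < M - s)%N -> (y < i)%N -> iter s (rowmotion (N0 + i) m M) a x y = 0) /\
  (forall x y, (x < M - s)%N -> (y < N0)%N ->
     iter s (rowmotion (N0 + i) m M) a x (y + i)%N = iter s (rowmotion N0 m M) b x y).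
Proof.
move=> vb a0 ab; elim: s => [|s [IH0 IHb]]; first by rewrite subn0.
have vs : valid N0 m M (iter s (rowmotion N0 m M) b).
  by elim: (s) => [//|s' IH]; rewrite iterS; apply: valid_rowmotion.
rewrite !iterS; move: IH0 IHb vs.
move: (iter s _ a) (iter s _ b) => as_ bs IH0 IHb vs.
have sh := lpp_shift IH0 IHb.
split=> x y hx hy; rewrite /rowmotion ifT; try lia.
  rewrite /lppm (sh x.+2 y.+1) ?(sh x.+1 y.+1); try lia.
  have -> : (y.+1 - i = 0)%N by lia.
  rewrite !lppx0; case: ifP => h; last first.
    by have := valid_lpp vs (leqnn M) (leqnn N0); lia.
  rewrite sh; try lia.
  by have := valid_lpp vs (_ : (x.+1 <= M)%N) (_ : (y.+2 - i <= N0)%N); lia.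
rewrite ifT; last by lia.
rewrite /lppm (sh x.+2 (y + i).+1) ?(sh x.+1 (y + i).+1); try lia.
have -> : ((y + i).+1 - i = y.+1)%N by lia.
case: (leqP y.+2 N0) => hy2.
  rewrite ifT ?sh; try lia.
  by have -> : ((y + i).+2 - i = y.+2)%N by lia.
by rewrite ifF //; lia.
Qed.

Lemma nabove_shift a b x j : valid N0 m M b ->
    (forall x y, (x < M)%N -> (y < i)%N -> a x y = 0) ->
    (forall x y, (x < M)%N -> (y < N0)%N -> a x (y + i)%N = b x y) ->
    (x < M)%N ->
  nabove (N0 + i) m M a x j = nabove N0 m M b x (j - i)%N.
Proof.
move=> vb a0 ab hx; have [h0 hb] := iter_rowmotion_shift (M.-1 - x) vb a0 ab.
rewrite /nabove /lppm; case: (leqP (j - i) N0) => hj.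
  by rewrite ifT ?(lpp_shift h0 hb) //; lia.
by rewrite ifF //; lia.
Qed.
End Shift.

(** The times of the tableau of rowmotion a are obtained from those of the
    tableau of a by toggling, cell by cell. *)
Lemma nabove_rowmotion N (m : int) M a x j : (x < M)%N -> (j < N)%N ->
  let X := nabove N m M a in let Y := nabove N m M (rowmotion N m M a) in
  Y x j.+1 = (if (x.+1 < M)%N then Num.min (X x j.+2) (Y x.+1 j.+1) else X x j.+2)
     + Num.max (if x is x'.+1 then X x' j.+1 else 0) (Y x j) - X x j.+1.
Proof.
move=> hx hj X Y.
pose b := iter (M.-1 - x) (rowmotion N m M) a.
have YE k : Y x k = lppm N m (rowmotion N m M b) x.+1 k by rewrite /Y /nabove -iterSr.
have XE k : X x k = lppm N m b x.+1 k by [].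
have Y1E k : (x.+1 < M)%N -> Y x.+1 k = lppm N m b x.+2 k.
  move=> hx1; rewrite /Y /nabove -iterSr /b.
  by have -> : (M.-1 - x = (M.-1 - x.+1).+1)%N by lia.
have X1E : (if x is x'.+1 then X x' j.+1 else 0) = lpp (rowmotion N m M b) x j.+1.
  rewrite -[rowmotion N m M b]/(iter (M.-1 - x).+1 (rowmotion N m M) a).
  case: (x) hx => [//|x'] hx; rewrite /X /nabove /lppm hj.
  by have -> : ((M.-1 - x'.+1).+1 = M.-1 - x')%N by lia.
rewrite X1E !YE !XE.
have -> : lppm N m (rowmotion N m M b) x.+1 j = lpp (rowmotion N m M b) x.+1 j by rewrite /lppm ltnW.
have -> : lppm N m (rowmotion N m M b) x.+1 j.+1 = lpp (rowmotion N m M b) x.+1 j.+1.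
  by rewrite /lppm hj.
have eb : lppm N m b x.+1 j.+1 = lpp b x.+1 j.+1 by rewrite /lppm hj.
rewrite lppSS {1}/rowmotion eb; case: ifP => hx1; last by lia.
by rewrite Y1E // [lppm _ _ _ x.+2 _]/lppm hj; lia.
Qed.

(** * Adding one sign to a word *)

Lemma pluses_zero (b a : nat -> int) k : (forall x, (x < k)%N -> a x = 0) ->
  (forall x, (x < k)%N -> 0 <= b x) -> pluses b a k = 0.
Proof.
elim: k => [//|k IH] ha hb; rewrite plusesS IH ?ha //; last first.
- by move=> x hx; apply: hb; lia.
- by move=> x hx; apply: ha; lia.
by have := hb k (ltnSn _); lia.
Qed.

(** A minus placed in front of its block r can only be matched by pluses of
    earlier blocks; if the minus signs already exhaust those, it survives. *)
Lemma pluses_add_minus b a r k : pluses b a r <= b r -> (r < k)%N ->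
  [/\ pluses (incr b r) a k = pluses b a k,
      minuses (incr b r) a k = minuses b a k + 1 &
      plus_pos (incr b r) a k = plus_pos b a k].
Proof.
move=> hr; elim: k => [//|k IH]; rewrite ltnS leq_eqVlt => /orP[/eqP rk|rk].
  subst k; have [x hx|//|e1 e2 e3 _] := @eq_pluses (incr b r) a b a r.
    by rewrite /incr; lia.
  rewrite /= e1 e2 e3 /incr eqxx; split; try lia.
  by rewrite !ifT //; lia.
have [e1 e2 e3] := IH rk.
rewrite /= e1 e2 e3 /incr (_ : (k == r) = false); last by lia.
by rewrite addr0; split=> //; lia.
Qed.

(** The new plus is to the left of all others and behind no minus of the blocks
    up to r: either it survives and is the leftmost one, or it cancels a
    surviving minus. *)
Lemma pluses_add_plus b a r k : (r < k)%N ->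
    (forall x, (x < k)%N -> 0 <= b x) ->
    (forall x, (x < r)%N -> a x = 0) -> (forall x, (x <= r)%N -> b x = 0) ->
    let a' := incr a r in
  (minuses b a k = 0 /\
   [/\ pluses b a' k = pluses b a k + 1, minuses b a' k = 0 & plus_pos b a' k = r]) \/
  (0 < minuses b a k /\
   [/\ pluses b a' k = pluses b a k, minuses b a' k = minuses b a k - 1,
       plus_pos b a' k = plus_pos b a k & (r < plus_pos b a k)%N]).
Proof.
move=> + hb ha hbr a'; elim: k hb => [//|k IH] hb.
rewrite ltnS leq_eqVlt => /orP[/eqP rk|rk].
  left; subst k.
  have b0 x : (x < r)%N -> 0 <= b x by move=> hx; apply: hb; lia.
  have [//|x hx|e1 e2 e3 _] := @eq_pluses b a' b a r.
    by rewrite /a' /incr; lia.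
  have p0 := pluses_zero ha b0.
  have m0 : minuses b a r = 0.
    have := pluses_minuses b a r; rewrite p0 big1 => [|x _]; first by lia.
    by rewrite ha ?hbr ?subrr //; have := ltn_ord x; lia.
  rewrite /= e1 e2 p0 m0 /a' /incr eqxx hbr // lexx.
  by split; [|split]; lia.
have {}IH := IH (fun x hx => hb x (leqW hx)) rk.
have a'k : a' k = a k by rewrite /a' /incr; lia.
have bk := hb k (ltnSn _).
case: IH => -[h0 [e1 e2 e3]].
  case: (lerP (b k) (pluses b a k)) => h.
    left; rewrite /= e1 e2 e3 a'k h0 ifF; last by lia.
    by split; [lia|split; lia].
  have q1 : plus_pos b a' k.+1 = k by rewrite /= e1 ifT //; lia.
  have q2 : plus_pos b a k.+1 = k by rewrite /= ifT //; lia.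
  right; rewrite q1 q2 /= e1 e2 a'k h0.
  by split; [lia|split; lia].
move=> hrp; right; rewrite /= e1 e2 e3 a'k.
by split; [lia|split=> //; [lia|case: ifP => _; lia]].
Qed.

(** * Tableaux as Gelfand-Tsetlin patterns *)

Lemma card_ord_lt m k : (k <= m)%N -> #|[set c : 'I_m | (c < k)%N]| = k.
Proof.
move=> h; rewrite cardsE -sum1_card (eq_bigl (fun c : 'I_m => (c < k)%N)) //.
by rewrite -(big_ord_widen m (fun=> 1%N) h) big_const_ord iter_addn_0 mul1n.
Qed.

(** The entry in column c of a row whose number of entries at most v is z r v. *)
Definition val_at (n : nat) (z : nat -> nat -> nat) (r c : nat) : nat :=
  \sum_(v < n.+1) (z r v <= c).

Lemma val_at_le n z r c v :
    (forall v v', (v <= v' <= n)%N -> (z r v <= z r v')%N) -> (v <= n)%N ->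
  (val_at n z r c <= v)%N = (c < z r v)%N.
Proof.
move=> mono hv; rewrite /val_at.
rewrite -(big_mkord xpredT (fun v => (z r v <= c) : nat)).
apply/idP/idP => [|h].
  apply: contraTT; rewrite -leqNgt -ltnNge => h.
  rewrite (@big_cat_nat _ _ _ v.+1) //=.
  apply: leq_trans (leq_addr _ _).
  rewrite (@eq_big_nat _ _ _ _ _ _ (fun=> 1%N)); last first.
    by move=> j hj; have := mono j v; lia.
  by rewrite big_const_nat subn0 iter_addn_0 mul1n.
rewrite (@big_cat_nat _ _ _ v) //=; last by lia.
have -> : (\sum_(v <= j < n.+1) (z r j <= c) = 0)%N.
  by rewrite big_nat big1 // => j hj; have := mono v j; lia.
rewrite addn0.
apply: (@leq_trans (\sum_(0 <= j < v) 1)); first by apply: leq_sum => j _; apply: leq_b1.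
by rewrite big_const_nat subn0 iter_addn_0 mul1n.
Qed.

Section Tableaux.
Variables n i m : nat.
Implicit Types (T : tableau i m) (x : nat -> nat -> nat).

(** Determines x only inside the range of rows and letters, which avoids a choice
    of values elsewhere. *)
Definition counts T x := forall (r : 'I_i) (c : 'I_m) v, (v <= n.+1)%N ->
  (T r c <= v)%N = (c < x r v)%N.

(** The second condition is the strict increase along columns. *)
Definition pattern x : Prop :=
  [/\ forall r v, (r < i)%N -> (v <= n)%N -> (x r v <= x r v.+1)%N,
      forall r v, (r.+1 < i)%N -> (v <= n)%N -> (x r.+1 v.+1 <= x r v)%N,
      forall r, (r < i)%N -> x r 0%N = 0%N &
      forall r, (r < i)%N -> x r n.+1 = m].

Lemma pattern_mono x r v v' : pattern x -> (r < i)%N -> (v <= v' <= n.+1)%N ->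
  (x r v <= x r v')%N.
Proof.
move=> [p1 _ _ _] hr /andP[]; elim: v' => [|v' IH]; first by case: v.
rewrite leq_eqVlt => /orP[/eqP-> //|h1] h2.
by apply: leq_trans (IH h1 (ltnW h2)) (p1 _ _ hr _).
Qed.

Lemma pattern_le x r v : pattern x -> (r < i)%N -> (v <= n.+1)%N -> (x r v <= m)%N.
Proof.
by move=> px hr hv; have [_ _ _ p4] := px; rewrite -(p4 r hr); apply: pattern_mono => //; lia.
Qed.

Definition tab_of x : tableau i m := \matrix_(r, c) val_at n x r c.

Lemma pattern_val_at_le x r c v : pattern x -> (r < i)%N -> (c < m)%N -> (v <= n.+1)%N ->
  (val_at n x r c <= v)%N = (c < x r v)%N.
Proof.
move=> px hr hc; rewrite leq_eqVlt => /orP[/eqP->|hv].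
  have [_ _ _ ->] := px; last by []; rewrite hc /val_at.
  rewrite -[X in (_ <= X)%N](card_ord n.+1) -sum1_card.
  by apply: leq_sum => j _; apply: leq_b1.
by apply: val_at_le => // w w' hw; apply: pattern_mono px hr _; lia.
Qed.

Lemma counts_tab_of x : pattern x -> counts (tab_of x) x.
Proof. by move=> px r c v hv; rewrite mxE pattern_val_at_le. Qed.

Lemma counts_eq T T' x x' : pattern x -> counts T x -> counts T' x' ->
    (forall r v, (r < i)%N -> (v <= n.+1)%N -> x r v = x' r v) -> T = T'.
Proof.
move=> [_ _ _ p4] hT hT' exx; apply/matrixP => r c.
have e v : (v <= n.+1)%N -> (T r c <= v)%N = (T' r c <= v)%N.
  by move=> hv; rewrite hT // hT' // exx.
have t1 : (T r c <= n.+1)%N by rewrite hT // p4.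
have t2 : (T' r c <= n.+1)%N by rewrite -e.
apply/eqP; rewrite eqn_leq -e // leqnn /= -?e //.
by rewrite e // leqnn.
Qed.

Lemma counts_fun T x x' : counts T x -> counts T x' ->
    (forall r v, (r < i)%N -> (v <= n.+1)%N -> (x r v <= m)%N) ->
    (forall r v, (r < i)%N -> (v <= n.+1)%N -> (x' r v <= m)%N) ->
  forall r v, (r < i)%N -> (v <= n.+1)%N -> x r v = x' r v.
Proof.
move=> h h' b b' r v hr hv.
have key (c : 'I_m) : (c < x r v)%N = (c < x' r v)%N.
  by rewrite -(h (Ordinal hr)) // -(h' (Ordinal hr)).
have := b r v hr hv; have := b' r v hr hv => h1 h2.
case: (ltngtP (x r v) (x' r v)) => // hlt.
  have hm : (x r v < m)%N by lia.
  by have := key (Ordinal hm); rewrite /= ltnn hlt.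
have hm : (x' r v < m)%N by lia.
by have := key (Ordinal hm); rewrite /= ltnn hlt.
Qed.

Lemma counts_ssyt T x : pattern x -> counts T x -> is_ssyt n T.
Proof.
move=> px hT; have [p1 p2 p3 p4] := px; split.
- move=> r c; rewrite (hT r c n.+1) // p4 // ltn_ord andbT.
  by rewrite ltnNge (hT r c 0%N) // p3.
- move=> r c c' hc; case: (leqP (T r c') n.+1) => h.
    by rewrite hT //; apply: leq_ltn_trans hc _; rewrite -hT.
  by move: h; rewrite ltnNge hT // p4 // ltn_ord.
have step (r r' : 'I_i) c : nat_of_ord r' = r.+1 -> (T r c < T r' c)%N.
  move=> er; have h : (T r' c <= n.+1)%N by rewrite hT // p4.
  case E : (T r' c) h => [|v] h.
    by have := hT r' c 0%N isT; rewrite E p3.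
  have := hT r' c v.+1 h; rewrite E leqnn => /esym hc.
  rewrite ltnS hT; last by lia.
  apply: leq_trans hc _; rewrite er; apply: p2; last by lia.
  by rewrite -er.
move=> r r' c; have [d hd] := ubnP (r' - r)%N; elim: d r' hd => // d IH r' hd hr.
case: (nat_of_ord r' =P r.+1) => [|ne]; first exact: step.
have hr1 : (r'.-1 < i)%N by have := ltn_ord r'; lia.
apply: leq_trans (IH (Ordinal hr1) _ _) (ltnW (step (Ordinal hr1) r' c _)) => /=; lia.
Qed.

Lemma ssyt_counts T : is_ssyt n T -> exists x, pattern x /\ counts T x.
Proof.
move=> [t1 t2 t3].
pose x r v := if (insub r : option 'I_i) is Some r' then #|[set c | (T r' c <= v)%N]| else 0%N.
have xE (r : 'I_i) v : x r v = #|[set c | (T r c <= v)%N]| by rewrite /x valK.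
have hc (r : 'I_i) (c : 'I_m) v : (T r c <= v)%N = (c < x r v)%N.
  rewrite xE; apply/idP/idP => h.
    apply: (@leq_trans #|[set c' : 'I_m | (c' < c.+1)%N]|).
      by rewrite card_ord_lt // ltn_ord.
    apply: subset_leq_card; apply/subsetP => c'; rewrite !inE => hc'.
    by apply: leq_trans h; apply: t2.
  apply: contraLR h; rewrite -leqNgt -ltnNge => h.
  apply: (@leq_trans #|[set c' : 'I_m | (c' < c)%N]|).
    apply: subset_leq_card; apply/subsetP => c'; rewrite !inE => hc'.
    rewrite ltnNge; apply/negP => /(t2 r) hle.
    by have := leq_trans hle hc'; rewrite leqNgt h.
  by rewrite card_ord_lt // ltnW.
exists x; split; last by move=> r c v _; apply: hc.
split=> [r v hr hv|r v hr hv|r hr|r hr].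
- rewrite -[r]/(val (Ordinal hr)) !xE; apply: subset_leq_card; apply/subsetP => c.
  by rewrite !inE => h; apply: leqW.
- have hr0 : (r < i)%N by lia.
  rewrite -[r.+1]/(val (Ordinal hr)) -[r]/(val (Ordinal hr0)) !xE.
  apply: subset_leq_card; apply/subsetP => c; rewrite !inE => h.
  by rewrite -ltnS; apply: leq_trans h; apply: t3 => /=.
- rewrite -[r]/(val (Ordinal hr)) xE; apply/eqP; rewrite cards_eq0; apply/eqP/setP => c.
  by rewrite !inE leqNgt; have /andP[-> _] := t1 (Ordinal hr) c.
- rewrite -[r]/(val (Ordinal hr)) xE -[RHS](card_ord m) -cardsT; apply: eq_card => c.
  by rewrite !inE; have /andP[_ ->] := t1 (Ordinal hr) c.
Qed.
End Tableaux.

(** * The signature of a tableau *)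

Section Signature.
Variables n i m : nat.
Local Notation box := ('I_i * 'I_m)%type.
Implicit Types (T : tableau i m) (b : box) (s : seq box).

Definition reduced_of (l : nat) T s : seq (bool * box) :=
  foldr (@cons_cancel i m) [::]
    [seq (T b.1 b.2 == l, b) | b <- s & (T b.1 b.2 == l) || (T b.1 b.2 == l.+1)].

Lemma reduced_cons l T b s : reduced_of l T (b :: s) =
  if (T b.1 b.2 == l) || (T b.1 b.2 == l.+1)
  then cons_cancel (T b.1 b.2 == l, b) (reduced_of l T s) else reduced_of l T s.
Proof. by rewrite /reduced_of /=; case: ifP. Qed.

Lemma foldr_cancel_shape (w : seq (bool * box)) : exists ms ps,
  foldr (@cons_cancel i m) [::] w = [seq (false, b) | b <- ms] ++ [seq (true, b) | b <- ps].
Proof.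
elim: w => [|[sg b] w [ms [ps IH]]]; first by exists [::], [::].
rewrite /= IH; case: sg; last by exists (b :: ms), ps.
case: ms {IH} => [|b' ms]; last by exists ms, ps.
by case: ps => [|b' ps]; [exists [::], [:: b]|exists [::], [:: b, b' & ps]].
Qed.

Lemma foldr_cancel_sub (w : seq (bool * box)) :
  {subset foldr (@cons_cancel i m) [::] w <= w}.
Proof.
elim: w => [//|y w IH] y' /=; rewrite /cons_cancel; case: ifP => _.
  by move=> /mem_behead /IH; rewrite inE => ->; rewrite orbT.
by rewrite !inE => /orP[->//|/IH ->]; rewrite orbT.
Qed.

Lemma uniq_reading : uniq (reading i m).
Proof.
rewrite /reading allpairs_uniq //; last by move=> [c r] [c' r'] _ _ /= [-> ->].
  by rewrite rev_uniq enum_uniq.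
by rewrite enum_uniq.
Qed.

(** Turning the leftmost surviving plus into a minus cancels nothing new: the
    signs in front of it are reduced to minus signs. *)
Lemma foldr_cancel_flip (w : seq (bool * box)) ms b ps :
    uniq (map snd w) ->
    foldr (@cons_cancel i m) [::] w =
      [seq (false, b) | b <- ms] ++ [seq (true, b) | b <- b :: ps] ->
  foldr (@cons_cancel i m) [::] [seq ((y.2 != b) && y.1, y.2) | y <- w] =
    [seq (false, b) | b <- rcons ms b] ++ [seq (true, b) | b <- ps].
Proof.
elim: w ms => [|[sg b'] w IH] ms; first by case: ms.
rewrite [uniq _]/= => /andP[b'w uw].
have [ms1 [ps1 e1]] := foldr_cancel_shape w.
rewrite [foldr _ _ _]/= e1; case: sg; last first.
  case: ms => [|b2 ms] //= [-> e2].
  rewrite andbF (IH ms) //; first by rewrite e1 e2.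
case: ms1 e1 => [|b2 ms1] e1.
  have nob : [seq ((y.2 != b') && y.1, y.2) | y <- w] = w.
    rewrite -[RHS]map_id; apply/eq_in_map => -[sg2 b2] hin /=.
    case: eqP => //= eb; case/negP: b'w; rewrite -eb.
    by apply/mapP; exists (sg2, b2).
  have -> : cons_cancel (true, b') ([seq (false, b) | b <- [::]] ++ [seq (true, b) | b <- ps1])
     = [seq (true, b) | b <- b' :: ps1] by case: (ps1).
  case: ms => [|//] /= [<- e2]; rewrite eqxx /= nob e1 /= e2.
  by [].
rewrite /cons_cancel /= => e2.
have e3 : foldr (@cons_cancel i m) [::] w =
    [seq (false, b) | b <- b2 :: ms] ++ [seq (true, b) | b <- b :: ps].
  by rewrite e1 /= e2.
have bb' : b' != b.
  apply: contraNneq b'w => ->.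
  have : (true, b) \in foldr (@cons_cancel i m) [::] w.
    by rewrite e3 mem_cat; apply/orP; right; apply: mem_head.
  by move=> /foldr_cancel_sub h; apply/mapP; exists (true, b).
by rewrite /= bb' (IH (b2 :: ms)) // /cons_cancel.
Qed.

Lemma tableau_e_f l T T' : tableau_f l T = Some T' -> tableau_e l T' = Some T.
Proof.
rewrite /tableau_f /plus_boxes /tableau_e /minus_boxes /reduced.
have [ms [ps e]] := foldr_cancel_shape (signature l T).
rewrite e filter_cat map_cat.
have -> : [seq y.2 | y <- [seq (false, b) | b <- ms] & y.1] = [::].
  by elim: (ms).
have -> : [seq y.2 | y <- [seq (true, b) | b <- ps] & y.1] = ps.
  by elim: (ps) => //= b ps' ->.
case: ps e => [//|b ps] e /= [<-].
have ub : uniq (map snd (signature l T)).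
  by rewrite /signature -map_comp map_id_in //; apply: filter_uniq uniq_reading.
have Tb : T b.1 b.2 = l.
  have : (true, b) \in signature l T.
    by apply: foldr_cancel_sub; rewrite -/(reduced l T) in e *; rewrite e mem_cat; apply/orP; right; apply: mem_head.
  by case/mapP => b' _ [/esym/eqP h ->].
have sE : signature l (set_box b l.+1 T) =
    [seq ((y.2 != b) && y.1, y.2) | y <- signature l T].
  have TE b' : set_box b l.+1 T b'.1 b'.2 = if b' == b then l.+1 else T b'.1 b'.2.
    by rewrite mxE; case: (b').
  rewrite /signature -map_comp.
  rewrite (eq_filter (a2 := fun b' => (T b'.1 b'.2 == l) || (T b'.1 b'.2 == l.+1))).
    apply: eq_map => b' /=; rewrite TE; case: (b' =P b) => [->|//] /=.
    by rewrite (gtn_eqF (ltnSn l)).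
  move=> b' /=; rewrite TE; case: (b' =P b) => [->|//]; by rewrite Tb !eqxx orbT.
rewrite sE (foldr_cancel_flip ub e) filter_cat map_cat.
have -> : [seq y.2 | y <- [seq (false, b) | b <- rcons ms b] & ~~ y.1] = rcons ms b.
  by elim: (rcons ms b) => //= b' ps' ->.
have -> : [seq y.2 | y <- [seq (true, b) | b <- ps] & ~~ y.1] = [::].
  by elim: (ps).
rewrite cats0; case E : (rcons ms b) => [|b1 s1]; first by case: (ms) E.
have -> : last b1 s1 = b by rewrite -(last_rcons b1 ms b) E.
congr Some; apply/matrixP => r c; rewrite !mxE.
by case: eqP => // eb; rewrite -Tb -eb.
Qed.

(** The order in which the boxes are read. *)
Definition later : rel box :=
  fun b b' => (b'.2 < b.2)%N || ((b'.2 == b.2 :> nat) && (b.1 < b'.1)%N).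

Lemma pairwise_reading : pairwise later (reading i m).
Proof.
rewrite /reading.
have : pairwise (fun c c' : 'I_m => (c' < c)%N) (rev (enum 'I_m)).
  have tr : transitive (fun c c' : 'I_m => (c' < c)%N).
    by move=> c2 c1 c3 h1 h2; apply: ltn_trans h2 h1.
  rewrite -(sorted_pairwise tr) rev_sorted.
  have := iota_ltn_sorted 0 m; rewrite -val_enum_ord sorted_map.
  exact: sub_sorted.
elim: (rev _) => [//|c cs IH] /= /andP[hc hcs].
rewrite pairwise_cat IH // andbT; apply/andP; split.
  apply/allrelP => b b' /mapP[r _ ->] /allpairsP[[c' r'] /= [hc' _ ->]].
  by rewrite /later /= (allP hc).
rewrite pairwise_map.
have : pairwise ltn (map val (enum 'I_i)).
  by rewrite val_enum_ord -(sorted_pairwise ltn_trans) iota_ltn_sorted.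
rewrite pairwise_map; apply: sub_pairwise => r r' /= h.
by rewrite /later /= eqxx h orbT.
Qed.

Lemma mem_reading b : b \in reading i m.
Proof.
case: b => r c; apply/allpairsP; exists (c, r); split=> //=.
  by rewrite mem_rev mem_enum.
by rewrite mem_enum.
Qed.

Lemma reading_suffix s1 b s b' : reading i m = s1 ++ b :: s ->
  (b' \in s) = later b b'.
Proof.
move=> e; have := pairwise_reading; rewrite e pairwise_cat => /and3P[h1 _ /= /andP[h2 _]].
have asym b1 b2 : later b1 b2 -> ~~ later b2 b1 by rewrite /later; lia.
apply/idP/idP => [/(allP h2)//|h].
have := mem_reading b'; rewrite e mem_cat inE => /or3P[hb|/eqP eb|//].
  by have := asym _ _ h; rewrite (allrelP h1) // mem_head.
by have := asym _ _ h; move: h; rewrite eb => ->.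
Qed.

Section Lines.
Variables (T : tableau i m) (l : nat).
Hypothesis sT : is_ssyt n T.

Definition cntbox k s (r : nat) : int :=
  (count (fun b : box => (b.1 == r :> nat) && (T b.1 b.2 == k)) s)%:Z.

Local Notation P := (cntbox l).
Local Notation Mn := (cntbox l.+1).

Lemma cntbox0 k s r :
  (forall b, b \in s -> nat_of_ord b.1 = r -> T b.1 b.2 <> k) -> cntbox k s r = 0.
Proof.
move=> h; rewrite /cntbox; congr Posz; apply/eqP; rewrite -leqn0 leqNgt -has_count.
by apply/hasPn => b hb; apply/negP => /andP[/eqP e1 /eqP]; apply: h.
Qed.

Lemma cntbox_cons k b s r :
  cntbox k (b :: s) r = ((b.1 == r :> nat) && (T b.1 b.2 == k))%:R + cntbox k s r.
Proof. by rewrite /cntbox /=; lia. Qed.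

(** The reduced word of the boxes already read, from the last one on, is the
    block signature of their letters counted row by row.  Columns may thus be
    forgotten, although the word is read column by column. *)
Definition reduced_lines s := exists ms ps,
  [/\ reduced_of l T s = [seq (false, b) | b <- ms] ++ [seq (true, b) | b <- ps],
      (size ms)%:Z = minuses (Mn s) (P s) i,
      (size ps)%:Z = pluses (Mn s) (P s) i &
      forall b ps', ps = b :: ps' ->
        [/\ nat_of_ord b.1 = plus_pos (Mn s) (P s) i, T b.1 b.2 = l &
         forall b', b' \in s -> b'.1 = b.1 -> T b'.1 b'.2 = l -> (b'.2 <= b.2)%N]].

(** The boxes read after b in rows up to that of b contain no letter l+1, and no
    letter l in the rows above, because entries increase; so the new plus comes
    in front of its block ([pluses_add_plus]). *)
Lemma reduced_lines_plus s1 b s : reading i m = s1 ++ b :: s -> T b.1 b.2 = l ->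
  reduced_lines s -> reduced_lines (b :: s).
Proof.
move=> e Tb [ms [ps [e1 e2 e3 e4]]]; have [_ rowT colT] := sT.
have mem_s b' : (b' \in s) = later b b' by apply: reading_suffix e.
have P0 x : (x < b.1)%N -> P s x = 0.
  move=> hx; apply: cntbox0 => b'; rewrite mem_s => hb' ex.
  have h1 : (T b'.1 b'.2 < T b.1 b'.2)%N by apply: colT; rewrite ex.
  have h2 : (T b.1 b'.2 <= T b.1 b.2)%N by apply: rowT; move: hb'; rewrite /later; lia.
  by move=> h; move: h1 h2; rewrite h Tb; lia.
have M0 x : (x <= b.1)%N -> Mn s x = 0.
  rewrite leq_eqVlt => /orP[/eqP->|hx]; apply: cntbox0 => b'; rewrite mem_s => hb' ex.
    have eb : b'.1 = b.1 by apply: val_inj.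
    have h2 : (T b.1 b'.2 <= T b.1 b.2)%N by apply: rowT; move: hb'; rewrite /later; lia.
    by rewrite eb => h; move: h2; rewrite h Tb; lia.
  have h1 : (T b'.1 b'.2 < T b.1 b'.2)%N by apply: colT; rewrite ex.
  have h2 : (T b.1 b'.2 <= T b.1 b.2)%N by apply: rowT; move: hb'; rewrite /later; lia.
  by move=> h; move: h1 h2; rewrite h Tb; lia.
have hM x : (x < i)%N -> 0 <= Mn s x by [].
have eM : Mn (b :: s) = Mn s.
  apply: functional_extensionality => x; rewrite cntbox_cons Tb.
  by rewrite (ltn_eqF (ltnSn l)) andbF add0r.
have eP : P (b :: s) = incr (P s) b.1.
  apply: functional_extensionality => x; rewrite cntbox_cons Tb eqxx andbT /incr.
  by rewrite addrC eq_sym.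
have red : reduced_of l T (b :: s) = cons_cancel (true, b) (reduced_of l T s).
  by rewrite reduced_cons Tb eqxx.
have [[m0 [f1 f2 f3]]|[m0 [f1 f2 f3 f4]]] :=
  pluses_add_plus (ltn_ord b.1) hM P0 M0.
  have ms0 : ms = [::] by case: ms e1 e2 => //= b0 ms _; rewrite m0.
  exists [::], (b :: ps); rewrite eM eP f1 f2 f3; split=> //.
  - by rewrite red e1 ms0 /cons_cancel /=; case: (ps).
  - by rewrite -e3 /=; lia.
  move=> b2 ps2 [<- _]; split=> // b'; rewrite inE mem_s => /orP[/eqP->//|].
  by rewrite /later => /orP[/ltnW//|/andP[/eqP->]].
case: ms e1 e2 => [_ /= e2|b0 ms e1 e2]; first by rewrite -e2 in m0.
exists ms, ps; rewrite eM eP f1 f2 f3; split=> //.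
- by rewrite red e1.
- by rewrite -e2 /=; lia.
move=> b2 ps2 eps; have [g1 g2 g3] := e4 _ _ eps; split=> // b'.
rewrite inE => /orP[/eqP-> eb|hb']; last exact: g3.
by move: f4; rewrite -g1 eb ltnn.
Qed.

(** Each letter l read later in the row above b sits over a letter l+1 in the row
    of b, so it is matched already and the new minus survives
    ([pluses_add_minus]). *)
Lemma reduced_lines_minus s1 b s : reading i m = s1 ++ b :: s -> T b.1 b.2 = l.+1 ->
  reduced_lines s -> reduced_lines (b :: s).
Proof.
move=> e Tb [ms [ps [e1 e2 e3 e4]]]; have [_ rowT colT] := sT.
have mem_s b' : (b' \in s) = later b b' by apply: reading_suffix e.
have M0 x : (x < b.1)%N -> Mn s x = 0.
  move=> hx; apply: cntbox0 => b'; rewrite mem_s => hb' ex.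
  have h1 : (T b'.1 b'.2 < T b.1 b'.2)%N by apply: colT; rewrite ex.
  have h2 : (T b.1 b'.2 <= T b.1 b.2)%N by apply: rowT; move: hb'; rewrite /later; lia.
  by move=> h; move: h1 h2; rewrite h Tb; lia.
have P0 x : (x.+1 < b.1)%N -> P s x = 0.
  move=> hx; apply: cntbox0 => b'; rewrite mem_s => hb' ex.
  have hr : (x.+1 < i)%N by apply: ltn_trans hx _.
  have h1 : (T b'.1 b'.2 < T (Ordinal hr) b'.2)%N by apply: colT; rewrite ex /=.
  have h3 : (T (Ordinal hr) b'.2 < T b.1 b'.2)%N by apply: colT.
  have h2 : (T b.1 b'.2 <= T b.1 b.2)%N by apply: rowT; move: hb'; rewrite /later; lia.
  by move=> h; move: h1 h2 h3; rewrite h Tb; lia.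
have bal x : x.+1 = b.1 -> P s x <= Mn s b.1.
  move=> hx; rewrite /cntbox lez_nat -!size_filter.
  have us : uniq s.
    by have := uniq_reading; rewrite e cat_uniq => /and3P[_ _] /= /andP[].
  rewrite -(size_map (fun b' : box => (b.1, b'.2))).
  apply: uniq_leq_size.
    rewrite map_inj_in_uniq ?filter_uniq // => -[r c] [r' c'].
    rewrite !mem_filter /= => /andP[/andP[/eqP h1 _] _] /andP[/andP[/eqP h2 _] _] [->].
    by congr pair; apply: val_inj; rewrite /= h1 h2.
  move=> b'' /mapP[b']; rewrite mem_filter => /andP[/andP[/eqP h1 /eqP h2] hb'] ->.
  rewrite mem_filter eqxx mem_s /=; rewrite mem_s in hb'.
  have lt_c : (b'.2 < b.2)%N.
    by case/orP: hb' => [//|/andP[_]]; rewrite h1 -hx ltnNge leqnSn.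
  rewrite /later /= lt_c andbT eqn_leq; apply/andP; split.
    by rewrite -Tb; apply: rowT; apply: ltnW.
  by rewrite -h2; apply: colT; rewrite h1 hx.
have small : pluses (Mn s) (P s) b.1 <= Mn s b.1.
  case E : (nat_of_ord b.1) => [|x]; first by [].
  rewrite plusesS pluses_zero => [|y hy|y hy] //; last by apply: P0; rewrite E ltnS.
  have := bal x; rewrite E => /(_ erefl); have : 0 <= Mn s x by [].
  by lia.
have eP : P (b :: s) = P s.
  apply: functional_extensionality => x; rewrite cntbox_cons Tb.
  by rewrite (gtn_eqF (ltnSn l)) andbF add0r.
have eM : Mn (b :: s) = incr (Mn s) b.1.
  apply: functional_extensionality => x; rewrite cntbox_cons Tb eqxx andbT /incr.
  by rewrite addrC eq_sym.
have red : reduced_of l T (b :: s) = (false, b) :: reduced_of l T s.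
  by rewrite reduced_cons Tb eqxx orbT (gtn_eqF (ltnSn l)).
have [f1 f2 f3] := pluses_add_minus small (ltn_ord b.1).
exists (b :: ms), ps; rewrite eM eP f1 f2 f3; split=> //.
- by rewrite red e1.
- by rewrite -e2 /=; lia.
move=> b2 ps2 eps; have [g1 g2 g3] := e4 _ _ eps; split=> // b'.
rewrite inE => /orP[/eqP-> _|]; last exact: g3.
by rewrite Tb => /eqP; rewrite (gtn_eqF (ltnSn l)).
Qed.

Lemma reduced_lines_reading : reduced_lines (reading i m).
Proof.
suff H s s1 : reading i m = s1 ++ s -> reduced_lines s by apply: (H _ [::]).
elim: s s1 => [|b s IH] s1 e.
  have z k r : cntbox k [::] r = 0 by [].
  have p0 k : pluses (Mn [::]) (P [::]) k = 0 by apply: pluses_zero.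
  exists [::], [::]; split=> //.
  by have := pluses_minuses (Mn [::]) (P [::]) i; rewrite p0 big1 //=; lia.
have gs : reduced_lines s by apply: (IH (rcons s1 b)); rewrite e cat_rcons.
case: (T b.1 b.2 =P l) => [|n1]; first by move=> h; apply: reduced_lines_plus e h gs.
case: (T b.1 b.2 =P l.+1) => [|n2]; first by move=> h; apply: reduced_lines_minus e h gs.
have [ms [ps [e1 e2 e3 e4]]] := gs.
have eP : P (b :: s) = P s.
  by apply: functional_extensionality => x; rewrite cntbox_cons (introF eqP n1) andbF add0r.
have eM : Mn (b :: s) = Mn s.
  by apply: functional_extensionality => x; rewrite cntbox_cons (introF eqP n2) andbF add0r.
exists ms, ps; rewrite reduced_cons (introF eqP n1) (introF eqP n2) eP eM; split=> //.
move=> b2 ps2 eps; have [g1 g2 g3] := e4 _ _ eps; split=> // b'.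
by rewrite inE => /orP[/eqP->|]; [|exact: g3].
Qed.

Variable x : nat -> nat -> nat.
Hypotheses (px : pattern n i m x) (Tx : counts n T x).

Lemma card_letter (r : 'I_i) k : (0 < k <= n.+1)%N ->
  #|[set c | T r c == k]| = (x r k - x r k.-1)%N.
Proof.
move=> hk; have -> : [set c | T r c == k] =
    [set c : 'I_m | (c < x r k)%N] :\: [set c : 'I_m | (c < x r k.-1)%N].
  apply/setP => c; rewrite !inE -(Tx r c (_ : k <= n.+1)%N) -?(Tx r c (_ : k.-1 <= n.+1)%N).
  - by move: (T r c) => t; lia.
  - by lia.
  - by lia.
rewrite cardsD (_ : _ :&: _ = [set c : 'I_m | (c < x r k.-1)%N]).
  by rewrite !card_ord_lt //; apply: pattern_le px _ _ => //; lia.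
apply/setP => c; rewrite !inE andb_idl // => h; apply: leq_trans h _.
by apply: pattern_mono px _ _ => //; lia.
Qed.

Lemma cntbox_reading r k : (r < i)%N -> (0 < k <= n.+1)%N ->
  cntbox k (reading i m) r = (x r k)%:Z - (x r k.-1)%:Z.
Proof.
move=> hr hk; have le_x : (x r k.-1 <= x r k)%N by apply: pattern_mono px _ _ => //; lia.
rewrite subzn // -(card_letter (Ordinal hr) hk) /cntbox -size_filter; congr Posz.
rewrite -(card_uniqP (filter_uniq _ uniq_reading)).
rewrite -(card_imset _ (fun (c c' : 'I_m) (h : (Ordinal hr, c) = (Ordinal hr, c')) => congr1 snd h)).
apply: eq_card => -[r' c]; rewrite mem_filter mem_reading andbT /=.
apply/andP/imsetP => [[/eqP h1 /eqP h2]|[c' hc' [-> ->]]].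
  have er : r' = Ordinal hr by apply: val_inj.
  by exists c; rewrite ?inE -?er ?h2.
by move: hc'; rewrite inE eqxx.
Qed.

Let lp (r : nat) : int := (x r l)%:Z - (x r l.-1)%:Z.
Let lmn (r : nat) : int := (x r l.+1)%:Z - (x r l)%:Z.

(** Of the letters l in the row of the leftmost surviving plus, the one changed by
    the operator is the last, so that the row stays increasing and one count
    drops by 1. *)
Lemma tableau_lines : (0 < l <= n)%N ->
  [/\ tableau_phi l T = pluses lmn lp i, tableau_eps l T = minuses lmn lp i &
      0 < tableau_phi l T -> exists T', tableau_f l T = Some T' /\
        counts n T' (fun r v => (x r v - ((r == plus_pos lmn lp i) && (v == l)))%N)].
Proof.
move=> hl; have [ms [ps [e1 e2 e3 e4]]] := reduced_lines_reading.
have [r hr|r hr|f1 f2 f3 _] := @eq_pluses (Mn (reading i m)) (P (reading i m)) lmn lp i.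
- by rewrite cntbox_reading //; lia.
- by rewrite cntbox_reading //; lia.
rewrite f1 in e3; rewrite f2 in e2; rewrite f3 in e4.
have ep : plus_boxes l T = ps.
  rewrite /plus_boxes /reduced /signature -/(reduced_of l T _) e1 filter_cat map_cat.
  have -> : [seq y.2 | y <- [seq (false, b) | b <- ms] & y.1] = [::] by elim: (ms).
  by elim: (ps) => //= b ps' ->.
have em : minus_boxes l T = ms.
  rewrite /minus_boxes /reduced /signature -/(reduced_of l T _) e1 filter_cat map_cat.
  have -> : [seq y.2 | y <- [seq (true, b) | b <- ps] & ~~ y.1] = [::] by elim: (ps).
  by rewrite cats0; elim: (ms) => //= b ps' ->.
rewrite /tableau_phi /tableau_eps /tableau_f ep em; split=> // hphi.
case: ps e1 e3 e4 ep hphi => [//|b ps] e1 e3 e4 ep _.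
have [g1 g2 g3] := e4 b ps erefl.
exists (set_box b l.+1 T); split=> // r c v hv; rewrite mxE -g1.
have rowT : forall (r : 'I_i) (c c' : 'I_m), (c <= c')%N -> (T r c <= T r c')%N by case: sT.
have b_lt : (b.2 < x b.1 l)%N by rewrite -Tx ?g2 //; lia.
have b_last : (x b.1 l <= b.2.+1)%N.
  rewrite leqNgt; apply/negP => hlt.
  have hm : (b.2.+1 < m)%N.
    by apply: leq_trans hlt _; apply: pattern_le px _ _ => //; lia.
  have h1 : (T b.1 (Ordinal hm) <= l)%N by rewrite Tx //; lia.
  have h2 : (T b.1 b.2 <= T b.1 (Ordinal hm))%N by apply: rowT => /=.
  have h3 : T b.1 (Ordinal hm) = l by apply/eqP; rewrite eqn_leq h1 -{1}g2.
  by have := g3 (b.1, Ordinal hm) (mem_reading _) erefl h3; rewrite /= ltnn.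
case: eqP => [eb|nb].
  have er : r = b.1 by rewrite -eb. 
  have ec : c = b.2 by rewrite -eb.
  rewrite er ec eqxx /=; case: (ltngtP v l) => hvl.
  - rewrite subn0 -Tx // g2; lia.
  - rewrite subn0; apply/idP/idP => _; last by [].
    by rewrite -Tx // g2 ltnW.
  - by rewrite hvl; lia.
rewrite Tx //; case: (nat_of_ord r =P b.1) => [er|//] /=; last by rewrite subn0.
case: (v =P l) => [->|_] /=; last by rewrite subn0.
have er2 : r = b.1 by apply: val_inj.
have nc : nat_of_ord c <> b.2.
  by move=> ec; apply: nb; rewrite (surjective_pairing b) er2; congr pair; apply: val_inj.
by rewrite er2; lia.
Qed.
End Lines.
End Signature.

(** * Jeu de taquin on patterns *)

Lemma upd_upd t r c u v : upd (upd t r c u) r c v = upd t r c v.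
Proof.
apply: functional_extensionality => r'; apply: functional_extensionality => c'.
by rewrite /upd; case: (_ && _).
Qed.

Lemma upd_same t r c : upd t r c (t r c) = t.
Proof.
apply: functional_extensionality => r'; apply: functional_extensionality => c'.
by rewrite /upd; case: ifP => // /andP[/eqP-> /eqP->].
Qed.

Section Filling.
Variables n i : nat.
Implicit Type z : nat -> nat -> nat.

(** A partly emptied tableau: in row r the first z r 0 boxes are empty, those of
    index from z r (v-1) up to z r v - 1 contain v, and the boxes behind z r n are
    empty. *)
Definition fill z : filling := fun r c =>
  let v := val_at n z r c in if (r < i)%N && (0 < v <= n)%N then Some v else None.

Definition row_mono z := forall r v, (r < i)%N -> (v < n)%N -> (z r v <= z r v.+1)%N.

Lemma row_monoW z r : row_mono z -> (r < i)%N ->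
  forall v v', (v <= v' <= n)%N -> (z r v <= z r v')%N.
Proof.
move=> zm hr v; elim=> [|v' IH] hv; first by have -> : v = 0%N by lia.
case: (v =P v'.+1) => [-> //|ne].
by apply: leq_trans (IH _) (zm _ _ hr _); lia.
Qed.

Lemma fillE z r c v : row_mono z -> (r < i)%N -> (0 < v <= n)%N ->
  (z r v.-1 <= c < z r v)%N -> fill z r c = Some v.
Proof.
move=> zm hr hv hc; have mono := row_monoW zm hr.
have h1 := @val_at_le n z r c v mono; have h2 := @val_at_le n z r c v.-1 mono.
have e : val_at n z r c = v by lia.
by rewrite /fill e hr hv.
Qed.

Lemma fill_le z r c v a : row_mono z -> (v <= n)%N -> (c < z r v)%N ->
  fill z r c = Some a -> (a <= v)%N.
Proof.
move=> zm hv hc; rewrite /fill; case: ifP => // /andP[hr _] [<-].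
by rewrite (val_at_le _ (row_monoW zm hr)).
Qed.

Lemma fill_empty z r c : row_mono z -> (c < z r 0)%N -> fill z r c = None.
Proof.
move=> zm hc; rewrite /fill; case: ifP => // /andP[hr].
by have := @val_at_le n z r c 0 (row_monoW zm hr); lia.
Qed.

Lemma fill_outer z r c : row_mono z -> (z r n <= c)%N -> fill z r c = None.
Proof.
move=> zm hc; rewrite /fill; case: ifP => // /andP[hr].
by have := @val_at_le n z r c n (row_monoW zm hr); lia.
Qed.

(** Lengthening one stretch of equal letters by one box changes a single box. *)
Lemma fill_bump z z' r v : (forall r' v', (v' <= n)%N ->
    z' r' v' = (z r' v' + ((r' == r) && (v' == v)))%N) ->
  forall u, upd (fill z') r (z r v) u = upd (fill z) r (z r v) u.
Proof.
move=> ez u; apply: functional_extensionality => r'.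
apply: functional_extensionality => c'; rewrite /upd; case: ifP => // ne.
have e : val_at n z' r' c' = val_at n z r' c'.
  apply: eq_bigr => v' _; have hv' := ltn_ord v'; rewrite ez //.
  case: (r' =P r) ne => [->|_] /= ne; last by rewrite addn0.
  case: (nat_of_ord v' =P v) => [->|_]; last by rewrite addn0.
  by congr nat_of_bool; lia.
by rewrite /fill e.
Qed.

(** Within a run of equal letters the hole moves left, as long as the letters
    above it are smaller. *)
Lemma slide_left z r v e f c : row_mono z -> (r < i)%N -> (0 < v <= n)%N ->
    (e <= c)%N -> (z r v.-1 <= c - e)%N -> (c < z r v)%N ->
    ((0 < r)%N -> (c < z r.-1 v.-1)%N) ->
  slide (e + f) (upd (fill z) r c None) r c =
  slide f (upd (fill z) r (c - e) None) r (c - e).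
Proof.
move=> zm hr hv; elim: e c => [|e IH] c he hc1 hc2 hab; first by rewrite subn0.
case: c => [//|c] in he hc1 hc2 hab *.
have left : upd (fill z) r c.+1 None r c = Some v.
  rewrite /upd eqxx /= ifF; last by lia.
  by apply: fillE => //; lia.
rewrite addSn /= left.
have eU : upd (upd (upd (fill z) r c.+1 None) r c.+1 (Some v)) r c None =
    upd (fill z) r c None.
  by rewrite upd_upd -(@fillE z r c.+1 v) ?upd_same //; lia.
have IHc : slide (e + f) (upd (fill z) r c None) r c =
    slide f (upd (fill z) r (c.+1 - e.+1) None) r (c.+1 - e.+1).
  by rewrite IH ?subSS //; lia.
case E : (match r with 0%N => None | r'.+1 => upd (fill z) r c.+1 None r' c.+1 end) => [a|];
  last by rewrite eU.
suff -> : (v <= a)%N = false by rewrite eU.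
case: r {left eU IHc IH} E hab hr hc1 hc2 => [//|r] E hab hr _ _.
move: E; rewrite /upd ifF; last by lia.
by move/(fill_le (v := v.-1) zm) => h; have := hab isT; rewrite /= => h2; lia.
Qed.

(** When the entry above equals the entry to the left, the rule for ties sends the
    hole up. *)
Lemma slide_up z r v f c : row_mono z -> (r.+1 < i)%N -> (0 < v <= n)%N ->
    (z r.+1 v.-1 <= c < z r.+1 v)%N -> (z r v.-1 <= c < z r v)%N ->
  slide f.+1 (upd (fill z) r.+1 c None) r.+1 c = slide f (upd (fill z) r c None) r c.
Proof.
move=> zm hr hv hc1 hc2.
have above : upd (fill z) r.+1 c None r c = Some v.
  rewrite /upd ifF; last by lia.
  by apply: fillE => //; lia.
rewrite /= above.
have eU : upd (upd (upd (fill z) r.+1 c None) r.+1 c (Some v)) r c None =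
    upd (fill z) r c None.
  by rewrite upd_upd -(@fillE z r.+1 c v) ?upd_same //; lia.
rewrite eU; case E : (match c with 0%N => None | c'.+1 => upd (fill z) r.+1 c None r.+1 c' end)
  => [a|//].
suff -> : (a <= v)%N by [].
case: c {above eU} E hc1 hc2 => [//|c] E hc1 hc2.
move: E; rewrite /upd ifF; last by lia.
by move/(fill_le (v := v) zm); apply; lia.
Qed.

Lemma slide_stop z r c f : row_mono z -> (c <= z r 0)%N ->
    ((0 < r)%N -> (c < z r.-1 0)%N) ->
  slide f (fill z) r c = fill z.
Proof.
move=> zm hc hab; case: f => [//|f] /=.
have -> : (match r with 0%N => None | r'.+1 => fill z r' c end) = None.
  by case: r {hc} hab => [//|r] /(_ isT) h; apply: fill_empty.
have -> : (match c with 0%N => None | c'.+1 => fill z r c' end) = None.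
  by case: c hc {hab} => [//|c] h; apply: fill_empty.
by [].
Qed.

(** The row of the hole once it has passed all the letters above n-d.  On meeting
    the letter n-d+1 it goes up exactly when the box above it contains this
    letter as well. *)
Fixpoint hole_row z (d : nat) : nat :=
  if d is d'.+1 then
    let r := hole_row z d' in
    if (0 < r)%N && (z r.-1 (n - d) <= z r (n - d'))%N then r.-1 else r
  else i.-1.

(** The pattern when the hole has passed the letters above n-d; each of the
    letters passed occupies one more box. *)
Definition slid_levels z d (r v : nat) : nat :=
  (z r v + [&& n - d <= v, v <= n & r == hole_row z (n - v)])%N.

Definition addable z := (1 < i)%N -> (z i.-1 n < z i.-2 n)%N.

Definition col_strict z :=
  forall r v, (r.+1 < i)%N -> (v < n)%N -> (z r.+1 v.+1 <= z r v)%N.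

Section Slide.
Variable z : nat -> nat -> nat.
Hypotheses (i0 : (0 < i)%N) (zm : row_mono z) (zs : col_strict z) (za : addable z).

Lemma hole_row_lt d : (hole_row z d < i)%N.
Proof. by elim: d => [|d IH] /=; [lia|case: ifP; lia]. Qed.

Lemma hole_row_step d : (hole_row z d.+1 <= hole_row z d <= (hole_row z d.+1).+1)%N.
Proof. by rewrite /=; case: ifP; lia. Qed.

Lemma hole_row_addable d : (d <= n)%N -> (0 < hole_row z d)%N ->
  (z (hole_row z d) (n - d) < z (hole_row z d).-1 (n - d))%N.
Proof.
elim: d => [|d IH] hd; first by rewrite /= subn0 => h; apply: za; lia.
have hr := hole_row_lt d; rewrite /=; set r := hole_row z d in IH hr *.
have hv : (n - d = (n - d.+1).+1)%N by lia.
case: ifP => [/andP[r0 hup]|hstay] r1; last first.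
  have [r0 hlt] : (0 < r)%N /\ (z r (n - d) < z r.-1 (n - d.+1))%N by lia.
  by have := @zm r (n - d.+1)%N; rewrite -hv; lia.
have := IH (ltnW hd) r0; have := @zs r.-2 (n - d.+1)%N.
have -> : r.-2.+1 = r.-1 by lia.
by rewrite -hv; lia.
Qed.

Lemma slid_levels_row_mono d : (d <= n)%N -> row_mono (slid_levels z d).
Proof.
move=> hd r v hr hv; rewrite /slid_levels; have := zm hr hv.
have := hole_row_step (n - v.+1); have e : (n - v = (n - v.+1).+1)%N by lia.
rewrite e; set q := hole_row z (n - v.+1); set q' := hole_row z (n - v.+1).+1 => hq hz.
case: (r =P q') => [er|_]; last by lia.
case: (r =P q) => [eq|ne]; first by lia.
have hup : (z q' v <= z q v.+1)%N.
  have : q' = (if (0 < q)%N && (z q.-1 (n - (n - v.+1).+1) <= z q (n - (n - v.+1)))%N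
               then q.-1 else q) by [].
  have -> : (n - (n - v.+1).+1 = v)%N by lia.
  have -> : (n - (n - v.+1) = v.+1)%N by lia.
  by case: ifP => [/andP[_ h2] e2|_ e2]; [rewrite e2|]; lia.
have := @hole_row_addable (n - v.+1) (leq_subr _ _); rewrite subKn // -/q => hadd.
have eq : q.-1 = q' by lia.
by rewrite eq in hadd; rewrite er; lia.
Qed.

(** The hole stands just behind the letters up to n-d of its row; the letter n-d
    makes it go up at most once ([slide_up]) and then left along the whole run of
    this letter ([slide_left]). *)
Lemma slide_path d f : (d <= n)%N ->
    (hole_row z d + z (hole_row z d) (n - d) <= f)%N ->
  slide f (upd (fill (slid_levels z d)) (hole_row z d) (z (hole_row z d) (n - d)) None)
    (hole_row z d) (z (hole_row z d) (n - d)) = fill (slid_levels z n).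
Proof.
move=> hd; rewrite -(subKn hd); move: (n - d)%N (leq_subr d n) => v {d hd}.
elim: v f => [|v IH] f hv hf.
  rewrite subn0 in hf *; have hr := hole_row_lt n; set r := hole_row z n in hf hr *.
  have zr0 : slid_levels z n r 0 = (z r 0).+1.
    by rewrite /slid_levels subnn subn0 leqnn /= eqxx addn1.
  have e : fill (slid_levels z n) r (z r (n - n)) = None.
    by apply: fill_empty; [exact: slid_levels_row_mono|rewrite subnn zr0].
  rewrite -{1}e upd_same; apply: slide_stop; first exact: slid_levels_row_mono.
    by rewrite subnn zr0.
  move=> r0; rewrite subnn; apply: leq_trans (_ : z r.-1 0 <= _)%N; last exact: leq_addr.
  by have := hole_row_addable (leqnn n) r0; rewrite -/r subnn.
have hd : (n - v = (n - v.+1).+1)%N by lia.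
have hd' : (n - v.+1 <= n)%N by lia.
have Zm : row_mono (slid_levels z (n - v.+1)) by apply: slid_levels_row_mono.
have hadd := hole_row_addable hd'; have hlt := hole_row_lt (n - v.+1).
have rhoS : hole_row z (n - v) = (if (0 < hole_row z (n - v.+1))%N &&
    (z (hole_row z (n - v.+1)).-1 v <= z (hole_row z (n - v.+1)) v.+1)%N
    then (hole_row z (n - v.+1)).-1 else hole_row z (n - v.+1)).
  by rewrite hd /= -hd !subKn //; lia.
rewrite !subKn // in hf hadd *.
set r := hole_row z (n - v.+1) in hf hlt rhoS hadd *.
set Z := slid_levels z (n - v.+1) in Zm *.
have Zlow r' w : (w <= v)%N -> Z r' w = z r' w.
  by move=> hw; rewrite /Z /slid_levels subKn //; lia.
have Ztop r' : Z r' v.+1 = (z r' v.+1 + (r' == r))%N.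
  by rewrite /Z /slid_levels subKn // hv leqnn.
set c := z r v.+1 in hf rhoS hadd *.
have hvn : (v <= n)%N by lia.
have IHv f' : (hole_row z (n - v) + z (hole_row z (n - v)) v <= f')%N ->
    slide f' (upd (fill Z) (hole_row z (n - v)) (z (hole_row z (n - v)) v) None)
      (hole_row z (n - v)) (z (hole_row z (n - v)) v) = fill (slid_levels z n).
  move=> hf'; have := IH f' hvn; rewrite !subKn // => /(_ hf') <-.
  congr (slide _ _ _ _); have := @fill_bump Z (slid_levels z (n - v)) (hole_row z (n - v)) v.
  rewrite Zlow // => ->// r' v' hv'; rewrite /Z /slid_levels !subKn // -addnA; congr (_ + _)%N.
  by case: (ltngtP v v') => h; [|rewrite ?andbF|rewrite -h hvn]; lia.
have zmr : (z r v <= c)%N by apply: zm.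
move: rhoS; case: ifP => hup rhoE; rewrite rhoE in IHv.
  case E : r hup => [//|r2] /= hup; rewrite E /= in IHv.
  have hr2 : (r2.+1 < i)%N by rewrite -E.
  have c_lt : (c < z r2 v.+1)%N by move: hadd; rewrite E; apply.
  have f0 : f = f.-1.+1 by move: hf; rewrite E; lia.
  have A1 : (Z r2.+1 v.+1.-1 <= c < Z r2.+1 v.+1)%N.
    by rewrite -E /= Zlow // Ztop eqxx /c; lia.
  have A2 : (Z r2 v.+1.-1 <= c < Z r2 v.+1)%N.
    by rewrite /= Zlow // Ztop; lia.
  rewrite f0 (@slide_up Z r2 v.+1) //.
  have c2 : (c - (c - z r2 v) = z r2 v)%N by rewrite subKn.
  have f1 : (f.-1 = (c - z r2 v) + (f.-1 - (c - z r2 v)))%N by move: hf; rewrite E; lia.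
  rewrite f1 (@slide_left Z r2 v.+1) ?c2 //.
  - by apply: IHv; move: hf; rewrite E; lia.
  - by lia.
  - by lia.
  - by rewrite /= Zlow.
  - by rewrite Ztop E; lia.
  - move=> r20; rewrite /= Zlow //; apply: leq_trans c_lt _.
    by have := @zs r2.-1 v; rewrite prednK //; apply; lia.
have c2 : (c - (c - z r v) = z r v)%N by rewrite subKn.
have f1 : (f = (c - z r v) + (f - (c - z r v)))%N by lia.
rewrite f1 (@slide_left Z r v.+1) ?c2 //.
- by apply: IHv; lia.
- by lia.
- by rewrite /= Zlow.
- by rewrite Ztop eqxx /c; lia.
- by move=> r0; rewrite /= Zlow //; lia.
Qed.

(** A slide started at the right end of the last row adds 1 to the pattern along
    the path of the hole. *)
Lemma slide_fill c : c = z i.-1 n -> slide (i.-1 + c) (fill z) i.-1 c = fill (slid_levels z n).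
Proof.
move=> hc; have := @slide_path 0 (i.-1 + c) (leq0n n).
rewrite /= subn0 -hc => /(_ (leqnn _)) <-.
congr (slide _ _ _ _).
have e : fill z i.-1 c = None by apply: fill_outer; rewrite // hc.
rewrite -[LHS](upd_same _ i.-1 c) e hc; apply/esym/fill_bump => r v hv.
rewrite /slid_levels subn0; congr (_ + _)%N.
by case: (v =P n) => [->|ne]; [rewrite subnn leqnn /= andbT|]; lia.
Qed.
End Slide.
End Filling.

(** * Successive slides *)

Section Promotion.
Variables n i m : nat.
Hypotheses (i0 : (0 < i)%N) (n0 : (0 < n)%N).
Variable x : nat -> nat -> nat.
Hypothesis px : pattern n i m x.

(** The relation z r (v-1) + x r v = max + min in which x is the original pattern:
    the recursion of the toggles that make up rowmotion.  Adding x r v on the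
    left avoids truncated subtraction. *)
Definition toggled (z : nat -> nat -> nat) := forall r v, (r < i)%N -> (0 < v <= n)%N ->
  (z r v.-1 + x r v =
    maxn (if r.+1 < i then z r.+1 v else 0) (x r v.-1) +
    (if r is r'.+1 then minn (x r' v.-1) (z r v) else z r v))%N.

(** Above the path g of the last hole the pattern is still the original one.
    Later holes stay on or above this path; this fact is what makes the recursion
    survive a slide. *)
Definition frontier (z : nat -> nat -> nat) (g : nat -> nat) :=
  [/\ g n = i.-1,
      forall r v, (r < g v)%N -> (v <= n)%N -> z r v = x r v &
      forall v, (0 < v <= n)%N -> g v.-1 = g v \/
        (g v.-1).+1 = g v /\ (x (g v).-1 v.-1 <= z (g v) v)%N].

Definition slid (t : nat) (z : nat -> nat -> nat) :=
  [/\ row_mono n i z, col_strict n i z,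
      z i.-1 n = (x i.-1 n + t)%N, (forall r, (r < i.-1)%N -> z r n = m) &
      toggled z /\ exists g, frontier z g].

Lemma slid0 : slid 0 x.
Proof.
have [p1 p2 p3 p4] := px.
have pmn r : (r < i.-1)%N -> x r n = m.
  move=> hr; have h1 := p2 r n; have h2 := p4 r.+1.
  by have := @pattern_le n i m x r n px; lia.
split=> //.
- by move=> r v hr hv; apply: p1 => //; lia.
- by move=> r v hr hv; apply: p2 => //; lia.
- by rewrite addn0.
split=> [r v hr hv|].
  have -> : (maxn (if r.+1 < i then x r.+1 v else 0) (x r v.-1) = x r v.-1)%N.
    by case: ifP => h; [have := p2 r v.-1; rewrite prednK|]; lia.
  case: r hr => [//|r] hr; congr (_ + _)%N.
  by have := p2 r v.-1; rewrite prednK; lia.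
by exists (fun=> i.-1); split=> // v hv; left.
Qed.

(** Next to the path of the hole, values on both sides of the recursion grow by 1.
    Where the path turns, the balance depends on which argument of the maximum is
    the larger one; [key] relates this to the rule for the hole, because the row
    above the path is still that of x. *)
Lemma slid_step t z : slid t z -> (x i.-1 n + t < m)%N ->
  addable n i z /\ slid t.+1 (slid_levels n i z n).
Proof.
move=> [zm zs zt zn [zT [g [gn g1 g2]]]] tm; have [p1 p2 p3 p4] := px.
have za : addable n i z by move=> i1; rewrite zt zn; lia.
split=> //.
pose rh v := hole_row n i z (n - v).
have rh_lt v : (rh v < i)%N by apply: hole_row_lt.
have rhn : rh n = i.-1 by rewrite /rh subnn.
have zE r v : (v <= n)%N -> slid_levels n i z n r v = (z r v + (r == rh v))%N.
  by move=> hv; rewrite /slid_levels subnn hv.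
have rhS v : (v < n)%N -> rh v = if (0 < rh v.+1)%N && (z (rh v.+1).-1 v <= z (rh v.+1) v.+1)%N
    then (rh v.+1).-1 else rh v.+1.
  move=> hv; rewrite /rh (_ : (n - v)%N = (n - v.+1).+1) /=; last by lia.
  have -> : (n - (n - v.+1).+1 = v)%N by lia.
  by have -> : (n - (n - v.+1) = v.+1)%N by lia.
(* the new hole stays on or above the path of the preceding one *)
have rh_g v : (v <= n)%N -> (rh v <= g v)%N.
  move=> hv; rewrite -(subKn hv); move: (n - v)%N (leq_subr v n) => d {v hv}.
  elim: d => [|d IH] hd; first by rewrite subn0 rhn gn.
  have e : (n - d = (n - d.+1).+1)%N by lia.
  have {}IH := IH (ltnW hd); rewrite e in IH.
  have hv : (n - d.+1 < n)%N by lia.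
  move: (n - d.+1)%N hv IH {e} => v hv IH.
  have := g2 v.+1 (_ : (0 < v.+1 <= n)%N); rewrite /= => /(_ hv) [eg|[eg hx]].
    by rewrite eg rhS //; case: ifP; lia.
  rewrite rhS //; case: (ltngtP (rh v.+1) (g v.+1)) IH => // hlt _.
    by case: ifP; lia.
  rewrite hlt -eg /= ifT //.
  have hgi : ((g v).+1 < i)%N by rewrite eg -hlt.
  have := zT (g v) v.+1 (ltnW hgi); rewrite hgi /= => /(_ hv).
  have := g1 (g v) v.+1; rewrite -eg /= in hx *; move: hx.
  by case: (g v) => [|q]; lia.
have key r v : (r.+1 < i)%N -> (v < n)%N -> rh v.+1 = r.+1 ->
    z r v = maxn (z r.+1 v.+1) (x r v).
  move=> hr hv er; have := zT r v.+1 (ltnW hr); rewrite hr /= => /(_ hv).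
  have := rh_g v.+1 hv; rewrite er => hg.
  rewrite (g1 r v.+1) //; case: r hr er hg => [|r] hr er hg; first by lia.
  by have := p2 r v; lia.
have hole_row_v v (hv : (v <= n)%N) : (0 < rh v)%N -> (z (rh v) v < z (rh v).-1 v)%N.
  by have := @hole_row_addable n i z i0 zm zs za (n - v) (leq_subr _ _); rewrite subKn.
split.
- exact: slid_levels_row_mono.
- move=> r v hr hv; rewrite !zE //; last exact: ltnW.
  have := zs r v hr hv; case: (r.+1 =P rh v.+1) => [er|_]; last by lia.
  have := rhS v hv; rewrite -er /=; case: ifP => h ->; first by rewrite eqxx; lia.
  by lia.
- by rewrite zE // rhn eqxx zt; lia.
- by move=> r hr; rewrite zE // rhn zn //; lia.
split; last first.
  exists rh; split=> // [r v hr hv|v hv].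
    by rewrite zE // g1 //; [lia|apply: leq_trans hr (rh_g v hv)].
  have hv1 : (v.-1 < n)%N by lia.
  have := rhS v.-1 hv1; rewrite prednK; last by lia.
  case: ifP => [/andP[h1 h2] e|_ e]; [right|by left].
  split; first by lia.
  rewrite zE; last by lia.
  have hr : ((rh v).-1.+1 < i)%N by rewrite prednK.
  have ev : v.-1.+1 = v by lia.
  have er : (rh v).-1.+1 = rh v by lia.
  by have := key (rh v).-1 v.-1 hr hv1; rewrite ev er => /(_ erefl); lia.
move=> r v hr hv; rewrite !zE; try lia.
have hv1 : (v.-1 < n)%N by lia.
have := zT r v hr hv; have := rhS v.-1 hv1; rewrite prednK; last by lia.
have rl := rh_lt v; have kv q := key q v.-1.
have ev : v.-1.+1 = v by lia.
rewrite ev in kv.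
have e1 : (if r.+1 < i then z r.+1 v + (r.+1 == rh v) else 0)%N =
  ((if r.+1 < i then z r.+1 v else 0) + (r.+1 == rh v))%N.
  by case: ifP => h //; have := rl; lia.
rewrite e1.
case: (r =P rh v) => [er|nr].
  rewrite -er; case: r hr er {e1 hv1} => [|r] hr er /=; first by move=> ->; rewrite eqxx; lia.
  rewrite kv //; try lia.
  by move=> ->; rewrite geq_max leqnn /=; case: leqP => h2; case: ifP => h; lia.
case: (r.+1 =P rh v) => [er|nr1].
  rewrite -er /= (kv r) //; try lia.
  have -> : (r.+1 < i)%N by lia.
  by move=> ->; rewrite geq_max leqnn /=; case: leqP => h2; case: (r) er hr h2 => [|r'] er hr h2; lia.
move=> e; have -> : (r == rh v.-1) = false by move: e; case: ifP => _ ->; lia.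
by rewrite !addn0; case: (r) => [|r']; rewrite ?addn0.
Qed.
End Promotion.

(** * Promotion *)

Section PromotionCounts.
Variables n i m : nat.
Hypotheses (i0 : (0 < i)%N) (n0 : (0 < n)%N).
Variables (T : tableau i m) (x : nat -> nat -> nat).
Hypotheses (sT : is_ssyt n T) (px : pattern n i m x) (Tx : counts n T x).

Lemma remove_max_fill : remove_max n T = fill n i x.
Proof.
have eT : T = tab_of n i m x.
  by apply: (counts_eq px Tx (counts_tab_of px)).
have rx : row_mono n i x by move=> r v hr hv; have [p1 _ _ _] := px; apply: p1 => //; lia.
apply: functional_extensionality => r; apply: functional_extensionality => c.
rewrite /remove_max; case: insubP => [r' _ er|hr]; last by rewrite /fill (negbTE hr).
case: insubP => [c' _ ec|hc]; last first.
  rewrite fill_outer //; have hr : (r < i)%N by rewrite -er ltn_ord.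
  by apply: leq_trans (pattern_le px hr (leqnSn n)) _; rewrite leqNgt.
have [t1 _ _] := sT; have := t1 r' c'; rewrite eT mxE er ec /fill => /andP[h1 h2].
have -> : (r < i)%N by rewrite -er ltn_ord.
by rewrite h1 /=; case: eqP => [->|ne]; [rewrite ltnn|rewrite ifT //; lia].
Qed.

(** Entries n+1 occur only in the last row, since columns are strictly increasing
    and no letter exceeds n+1. *)
Lemma vacated_last_row (rl : 'I_i) : nat_of_ord rl = i.-1 ->
  vacated n T = [seq (rl, c) | c : 'I_m <- enum 'I_m & (x i.-1 n <= c)%N].
Proof.
move=> erl; rewrite /vacated filter_flatten -map_comp.
have key (c : 'I_m) : [seq b <- [seq (r, c) | r <- enum 'I_i] | T b.1 b.2 == n.+1] =
    if (x i.-1 n <= c)%N then [:: (rl, c)] else [::].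
  rewrite filter_map.
  have -> : [seq r <- enum 'I_i | preim (fun r => (r, c)) (fun b => T b.1 b.2 == n.+1) r] =
     [seq r <- enum 'I_i | pred1 rl r & (x i.-1 n <= c)%N].
    apply: eq_filter => r /=.
    have [t1 _ _] := sT; have := t1 r c; have := Tx r c (leqnSn n).
    have [p1 p2 p3 p4] := px.
    have e1 : (r == rl) = (nat_of_ord r == i.-1) by rewrite -erl.
    rewrite e1; case: (nat_of_ord r =P i.-1) => [->|ne] /=; first by lia.
    have hr : (r.+1 < i)%N by have := ltn_ord r; lia.
    have := p2 r n hr (leqnn n); rewrite p4 //; have := ltn_ord c; lia.
  case: ifP => h; last by rewrite (eq_filter (a2 := pred0)) ?filter_pred0 // => r /=; rewrite andbF.
  rewrite (eq_filter (a2 := pred1 rl)) => [|r /=]; last by rewrite andbT.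
  by rewrite filter_pred1_uniq ?enum_uniq ?mem_enum.
rewrite (eq_map (g := fun c : 'I_m => if (x i.-1 n <= c)%N then [:: (rl, c)] else [::])) //.
by elim: (enum 'I_m) => //= c s ->; case: ifP.
Qed.

Lemma slide_row k t z : slid n i m x t z -> (x i.-1 n + t + k = m)%N ->
  exists2 z', slid n i m x (t + k) z' &
    foldl (fun f c => slide (i.-1 + c) f i.-1 c) (fill n i z) (iota (x i.-1 n + t) k) =
    fill n i z'.
Proof.
elim: k t z => [|k IH] t z hz hk; first by exists z; rewrite ?addn0.
have ht : (x i.-1 n + t < m)%N by lia.
have [za hz'] := slid_step i0 n0 px hz ht.
have [zm zs zt _ _] := hz.
have [|z' h1 h2] := IH _ _ hz'; first by lia.
exists z'; first by rewrite addnS -addSn.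
by rewrite /= slide_fill // -addnS.
Qed.

Lemma jdt_fill : exists2 z, slid n i m x (m - x i.-1 n) z & jdt n T = fill n i z.
Proof.
have il : (i.-1 < i)%N by lia.
have c0m : (x i.-1 n <= m)%N by apply: pattern_le px _ _ => //.
have [|z h1 h2] := @slide_row (m - x i.-1 n) 0 x (slid0 i0 n0 px); first by lia.
exists z => //; rewrite -h2 /jdt remove_max_fill (@vacated_last_row (Ordinal il)) // addn0.
have -> : iota (x i.-1 n) (m - x i.-1 n) =
    [seq nat_of_ord c | c : 'I_m <- enum 'I_m & (x i.-1 n <= c)%N].
  rewrite -(filter_map val (fun c : nat => x i.-1 n <= c)%N) val_enum_ord.
  rewrite -{2}(subnKC c0m) iotaD filter_cat add0n.
  rewrite (eq_in_filter (a2 := pred0)) ?filter_pred0 => [|c]; last first.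
    by rewrite mem_iota /=; lia.
  rewrite (eq_in_filter (a2 := predT)) ?filter_predT // => c.
  by rewrite mem_iota /=; lia.
by elim: (filter _ _) (fill n i x) => //= c s IH f; rewrite -IH.
Qed.

(** Adding 1 to the remaining letters and filling up with 1 shifts the pattern by
    one letter. *)
Lemma promotion_counts : exists z,
  [/\ row_mono n i z, forall r, (r < i)%N -> z r n = m, toggled n i x z &
      counts n (promotion n T) (fun r v => if v is v'.+1 then z r v' else 0%N)].
Proof.
have c0m : (x i.-1 n <= m)%N by apply: pattern_le px _ _ => //; lia.
have [z [zm zs zt zn [zT _]] e] := jdt_fill.
have znm r : (r < i)%N -> z r n = m.
  move=> hr; case: (r =P i.-1) => [->|ne]; first by rewrite zt; lia.
  by apply: zn; lia.
exists z; split=> // r c v hv; rewrite mxE e /fill ltn_ord /=.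
have mono := row_monoW zm (ltn_ord r).
have vn : (val_at n z r c <= n)%N by rewrite val_at_le // znm // ltn_ord.
case: v hv => [|v] hv; first by case: ifP.
rewrite -(val_at_le c mono hv) vn andbT.
by case: (val_at n z r c).
Qed.
End PromotionCounts.

(** * Weights *)

Section Weight.
Variables n i m : nat.
Hypothesis hi : (1 <= i <= n)%N.
Local Notation N := n.+1.

Lemma omegaE l (j : 'I_n) : omega n l 0 j = (j.+1 == l)%:R.
Proof. by rewrite mxE. Qed.

(** A root is a difference of two differences of consecutive fundamental weights,
    and the sum telescopes. *)
Lemma alphapqE p q : (0 < p <= q)%N ->
  alphapq n p q = omega n p + omega n q - omega n p.-1 - omega n q.+1.
Proof.
case/andP=> p0; elim: q => [|q IH] hpq; first by lia.
rewrite /alphapq big_nat_recr //= -/(alphapq n p q).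
move: hpq; rewrite leq_eqVlt => /orP[/eqP->|hpq].
  by rewrite [alphapq _ _ _]big_geq // add0r /alpha mulr2n.
rewrite IH // /alpha mulr2n /= !addrA; apply/matrixP => x j; rewrite !mxE.
by move: (_%:R : int) (_%:R : int) (_%:R : int) (_%:R : int) (_%:R : int); lia.
Qed.

Lemma mulrz_entry (w : weight n) (z : int) (j : 'I_n) : (w *~ z) 0 j = w 0 j * z.
Proof.
case: z => k; first by rewrite -pmulrn mulmxnE -mulr_natr natz.
by rewrite NegzE mulrNz mxE -pmulrn mulmxnE -mulr_natr natz mulrN.
Qed.

Lemma sum_pick (F : nat -> int) a b l : (~~ (a <= l < b)%N -> F l = 0) ->
  \sum_(a <= p < b) (l == p)%:R * F p = F l.
Proof.
move=> F0; case h : (a <= l < b)%N; last first.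
  rewrite F0 ?h // big_nat big1 // => p hp; case: (l =P p) => [e|_]; last by rewrite mul0r.
  by rewrite e hp in h.
rewrite (@big_cat_nat _ _ _ l) /=; try lia.
rewrite [X in _ + X]big_ltn; last by lia.
rewrite eqxx mul1r big_nat big1 => [|p hp]; last by rewrite (_ : l == p = false) ?mul0r //; lia.
rewrite big_nat big1 => [|p hp]; last by rewrite (_ : l == p = false) ?mul0r //; lia.
by rewrite add0r addr0.
Qed.

(** With the telescoped roots, the coordinate at l only involves the row sums and
    column sums of the array that also make up phi - epsilon. *)
Lemma array_wt_coord (A : array n i) (j : 'I_n) : valid N m%:Z i (fa A) ->
  array_wt m A 0 j = array_phi m j.+1 A - array_eps j.+1 A.
Proof.
move=> vA; have hj := ltn_ord j.
set l := j.+1.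
pose R p : int := \sum_(i <= q < N) entry A p q.
pose C q : int := \sum_(1 <= p < i.+1) entry A p q.
have R0 p : ~~ (0 < p <= i)%N -> R p = 0.
  by move=> hp; rewrite /R big_nat big1 // => q hq; rewrite entry_out //; lia.
have C0 q : ~~ (i <= q <= n)%N -> C q = 0.
  by move=> hq; rewrite /C big_nat big1 // => p hp; rewrite entry_out //; lia.
have wE : array_wt m A 0 j = (l == i)%:R * m%:Z - R l - C l + R l.+1 + C l.-1.
  have e1 : (omega n i *+ m) 0 j = (l == i)%:R * m%:Z.
    by rewrite mulmxnE omegaE -[LHS]mulr_natr; congr (_ * _); apply: natz.
  rewrite /array_wt mxE e1 mxE summxE.
  have -> : \sum_(1 <= p < i.+1) (\sum_(i <= q < N) alphapq n p q *~ entry A p q) 0 j =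
    \sum_(1 <= p < i.+1) ((l == p)%:R * R p - (l.+1 == p)%:R * R p) +
    \sum_(1 <= p < i.+1) \sum_(i <= q < N)
      ((l == q)%:R * entry A p q - (l.-1 == q)%:R * entry A p q).
    rewrite -big_split /=; apply: eq_big_nat => p hp.
    rewrite summxE /R !big_distrr /= -sumrB -big_split /=; apply: eq_big_nat => q hq.
    rewrite mulrz_entry alphapqE; last by lia.
    rewrite !(mxE, omegaE) -/l !mulrDl !mulNr.
    have -> : (l == p.-1) = (l.+1 == p) by lia.
    have -> : (l == q.+1) = (l.-1 == q) by rewrite /l; lia.
    by rewrite -!addrA; congr (_ + _); rewrite addrCA.
  rewrite sumrB !sum_pick; [|by move=> h; apply: R0; lia..].
  rewrite exchange_big /=.
  have -> : \sum_(i <= q < N) \sum_(1 <= p < i.+1)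
      ((l == q)%:R * entry A p q - (l.-1 == q)%:R * entry A p q) =
    \sum_(i <= q < N) ((l == q)%:R * C q - (l.-1 == q)%:R * C q).
    by apply: eq_bigr => q _; rewrite /C sumrB !big_distrr.
  rewrite sumrB !sum_pick; [|by move=> h; apply: C0; lia..].
  by move: (C l) (C l.-1) (R l) (R l.+1) (_%:R * _) => c c' r r' w; lia.
rewrite wE; case: (ltngtP l i) => hli.
- have hl : (0 < l < i)%N by lia.
  have [-> -> _ _] := array_col hi vA hl.
  have := pluses_minuses (colb A l) (colc A l) N; rewrite sum_ordB.
  have -> : \sum_(x < N) colc A l x = R l.
    rewrite /R sum_colc //; try lia.
    have -> : ((n + i).+1 - N = i)%N by lia.
    have -> : ((n + i).+1 - i = N)%N by lia.
    by rewrite sum_low0 // => [y hy|]; [apply: colc0|lia].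
  have -> : \sum_(x < N) colb A l x = R l.+1.
    rewrite /R sum_colb //; try lia.
    have -> : ((n + i).+1 - N = i)%N by lia.
    have -> : ((n + i).+1 - i = N)%N by lia.
    by rewrite sum_low0 // => [y hy|]; [apply: colb0|lia].
  by rewrite (C0 l) ?(C0 l.-1) ?mul0r; lia.
- have hl : (i < l <= n)%N by rewrite /l in hli *; lia.
  have [-> -> _ _] := array_row hi vA hl.
  have := pluses_minuses (rowb A l) (rowc m A l) i; rewrite sum_ordB => ->.
  have -> : \sum_(x < i) rowc m A l x = C l.-1.
    by rewrite /C (sum_rowc m) // ?subSS ?subn0 ?subnn ?big_mkord //; lia.
  have -> : \sum_(x < i) rowb A l x = C l.
    by rewrite /C sum_rowb // ?subSS ?subn0 ?subnn ?big_mkord //; lia.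
  by rewrite (R0 l) ?(R0 l.+1) ?mul0r; lia.
rewrite /array_phi /array_eps hli eqxx mul1r (R0 i.+1) ?(C0 i.-1); try lia.
rewrite -/(R i) /C big_nat_recr /=; last by lia.
by move: (R i) (entry A i i) (\sum_(1 <= j0 < i) _) => a b c; lia.
Qed.

Lemma tableau_wt_coord (T : tableau i m) x (j : 'I_n) : is_ssyt n T ->
    pattern n i m x -> counts n T x ->
  tableau_wt n T 0 j = tableau_phi j.+1 T - tableau_eps j.+1 T.
Proof.
move=> sT px Tx; have hj := ltn_ord j.
have [|-> -> _] := @tableau_lines n i m T j.+1 sT x px Tx; first by lia.
rewrite pluses_minuses /tableau_wt summxE; apply: eq_bigr => r _.
rewrite summxE.
have -> : \sum_(c < m) (omega n (T r c) - omega n (T r c).-1) 0 j =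
   \sum_(c < m) ((T r c == j.+1)%:R - (T r c == j.+2)%:R).
  apply: eq_bigr => c _; rewrite mxE omegaE [X in _ + X]mxE omegaE.
  have [t1 _ _] := sT; have := t1 r c; move: (T r c) => t ht.
  by rewrite (_ : (j.+1 == t.-1) = (t == j.+2)) 1?eq_sym //; lia.
have cardE k : \sum_(c < m) (T r c == k)%:R = (#|[set c | T r c == k]|)%:Z.
  rewrite -natz -sum1_card natr_sum big_mkcond /=.
  by rewrite [RHS]big_mkcond /=; apply: eq_bigr => c _; rewrite inE; case: eqP.
rewrite sumrB !cardE !(card_letter px Tx) //=; [|lia..].
have [p1 p2 p3 p4] := px; have := ltn_ord r => hr.
have := p1 r j hr; have := p1 r j.+1 hr; lia.
Qed.
End Weight.

(** * The tableau of an array *)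

Section Bounds.
Variables (N : nat) (m : int).
Local Notation valid := (valid N m).
Local Notation nabove := (nabove N m).

Lemma valid_iter M a s : valid M a -> valid M (iter s (rowmotion N m M) a).
Proof. by move=> va; elim: s => //= s; apply: valid_rowmotion. Qed.

Lemma nabove_ge0 M a x j : valid M a -> (x < M)%N -> 0 <= nabove M a x j <= m.
Proof.
move=> va hx; rewrite /nabove /lppm; have vb := valid_iter (M.-1 - x) va.
case: ifP => h; first exact: (valid_lpp vb).
by have := valid_lpp va (leqnn M) (leqnn N); lia.
Qed.

Lemma nabove_leS M a x j : valid M a -> (x < M)%N -> nabove M a x j <= nabove M a x j.+1.
Proof.
move=> va hx; have /andP[_ hm] := nabove_ge0 j va hx.
rewrite /nabove /lppm; have [b0 bm] := valid_iter (M.-1 - x) va.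
move: hm; rewrite /nabove /lppm; case: (ltngtP j N) => hj hm; rewrite ?ifT ?ifF //; try lia.
by apply: (lpp_mono b0); lia.
Qed.

Lemma nabove_le_next M a x j : valid M a -> (x.+1 < M)%N -> nabove M a x j <= nabove M a x.+1 j.
Proof.
move=> va hx; rewrite /nabove /lppm (_ : M.-1 - x = (M.-1 - x.+1).+1)%N; last by lia.
rewrite iterS; have vb := valid_iter (M.-1 - x.+1) va.
case: ifP => // hj; have hx' : (x.+1 <= M)%N by lia.
by have [h _] := lpp_rowmotion vb hx' hj; apply: h.
Qed.

Lemma nabove_full M a x j : (N < j)%N -> nabove M a x j = m.
Proof. by move=> h; rewrite /nabove /lppm ifF //; lia. Qed.

Lemma nabove0 M a x : nabove M a x 0 = 0.
Proof. by rewrite /nabove /lppm /= lppx0. Qed.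
End Bounds.

Section ArrayPattern.
Variables n i m : nat.
Hypothesis hi : (1 <= i <= n)%N.
Local Notation N := n.+1.
Local Notation N0 := (n.+1 - i)%N.
Implicit Types A B : array n i.

Lemma fa_fo A x y : fa A x (y + i)%N = fo A x y.
Proof. by rewrite /fa /fo; congr entry; lia. Qed.

Lemma valid_fo A : valid N m%:Z i (fa A) <-> valid N0 m%:Z i (fo A).
Proof.
have a0 x y : (x < i)%N -> (y < i)%N -> fa A x y = 0.
  by move=> _ hy; rewrite fa0 // hy orbT.
have ab x y : (x < i)%N -> (y < N0)%N -> fa A x (y + i)%N = fo A x y.
  by move=> _ _; apply: fa_fo.
have e : lpp (fa A) i N = lpp (fo A) i N0.
  by rewrite (lpp_shift a0 ab) //; lia.
rewrite /valid e; split=> -[h1 h2]; split=> // x y hx hy.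
  by rewrite -fa_fo; apply: h1; lia.
case: (ltnP y i) => hyi; first by rewrite a0.
by rewrite -(subnK hyi) fa_fo; apply: h1; lia.
Qed.

Lemma nabove_fo A x j : valid N m%:Z i (fa A) -> (x < i)%N ->
  nabove N m%:Z i (fa A) x j = nabove N0 m%:Z i (fo A) x (j - i)%N.
Proof.
move=> /valid_fo va hx; have eN : N = (N0 + i)%N by lia.
rewrite [in LHS]eN; apply: nabove_shift => // x' y hx' hy; last exact: fa_fo.
by rewrite fa0 // hy orbT.
Qed.

(** The index j of [nabove] standing for the letter v in row r is n+2+r-v. *)
Definition gtpat A (r v : nat) : nat := `|m%:Z - nabove N m%:Z i (fa A) r (N.+1 + r - v)%N|%N.

Definition Phi A : tableau i m := tab_of n i m (gtpat A).

Lemma gtpatE A r v : valid N m%:Z i (fa A) -> (r < i)%N ->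
  (gtpat A r v)%:Z = m%:Z - nabove N m%:Z i (fa A) r (N.+1 + r - v)%N.
Proof. by move=> vA hr; have := nabove_ge0 (N.+1 + r - v) vA hr; rewrite /gtpat; lia. Qed.

Lemma gtpat_pattern A : valid N m%:Z i (fa A) -> pattern n i m (gtpat A).
Proof.
move=> vA; split=> [r v hr hv|r v hr hv|r hr|r hr].
- have := nabove_leS (N.+1 + r - v.+1) vA hr.
  rewrite (_ : (N.+1 + r - v.+1).+1 = N.+1 + r - v)%N; last by lia.
  by have := gtpatE v vA hr; have := gtpatE v.+1 vA hr; lia.
- have := nabove_le_next (N.+1 + r - v) vA hr.
  have := gtpatE v vA (ltnW hr); have := gtpatE v.+1 vA hr.
  by rewrite (_ : N.+1 + r.+1 - v.+1 = N.+1 + r - v)%N; lia.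
- by have := gtpatE 0 vA hr; rewrite nabove_full; lia.
- have := gtpatE N vA hr; rewrite nabove_fo // (_ : N.+1 + r - N - i = 0)%N; last by lia.
  by rewrite nabove0; lia.
Qed.

Section Valid.
Variable A : array n i.
Hypothesis vA : valid N m%:Z i (fa A).

Lemma Phi_counts : counts n (Phi A) (gtpat A).
Proof. exact: counts_tab_of (gtpat_pattern vA). Qed.

Lemma Phi_ssyt : is_ssyt n (Phi A).
Proof. exact: counts_ssyt (gtpat_pattern vA) Phi_counts. Qed.

Lemma gtpat_lines l r : (0 < l <= n)%N -> (r < i)%N ->
  tminus N m%:Z i (fa A) (N - l) r = (gtpat A r l.+1)%:Z - (gtpat A r l)%:Z /\
  tplus N m%:Z i (fa A) (N - l) r = (gtpat A r l)%:Z - (gtpat A r l.-1)%:Z.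
Proof.
move=> hl hr; rewrite !gtpatE // /tminus /tplus.
have -> : (N.+1 + r - l.+1 = N - l + r)%N by lia.
have -> : (N.+1 + r - l = (N - l + r).+1)%N by lia.
have -> : (N.+1 + r - l.-1 = (N - l + r).+2)%N by lia.
by split; lia.
Qed.

Lemma Phi_phi_eps l : (0 < l <= n)%N ->
  tableau_eps l (Phi A) = array_eps l A /\ tableau_phi l (Phi A) = array_phi m l A.
Proof.
move=> hl; have [-> ->] := array_lines hi vA hl.
have [-> -> _] := tableau_lines Phi_ssyt (gtpat_pattern vA) Phi_counts hl.
have [r hr|r hr|-> -> _ _] := @eq_pluses (tminus N m%:Z i (fa A) (N - l))
  (tplus N m%:Z i (fa A) (N - l)) (fun r => (gtpat A r l.+1)%:Z - (gtpat A r l)%:Z)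
  (fun r => (gtpat A r l)%:Z - (gtpat A r l.-1)%:Z) i => //; by have [] := gtpat_lines hl hr.
Qed.

Lemma Phi_wt : tableau_wt n (Phi A) = array_wt m A.
Proof.
apply/matrixP => z j; rewrite (ord1 z) (array_wt_coord hi j vA).
rewrite (tableau_wt_coord hi j Phi_ssyt (gtpat_pattern vA) Phi_counts).
by have [|-> ->] := @Phi_phi_eps j.+1; first exact: ltn_ord.
Qed.

Lemma Phi_f_pos l : (0 < l <= n)%N -> 0 < array_phi m l A ->
  exists A', [/\ array_f m l A = Some A', valid N m%:Z i (fa A') &
    tableau_f l (Phi A) = Some (Phi A')].
Proof.
move=> hl hphi; have [A' [fA vA' hX]] := array_f_crystal hi vA hl hphi.
exists A'; split=> //.
have [ephi _ hT] := tableau_lines Phi_ssyt (gtpat_pattern vA) Phi_counts hl.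
have [r hr|r hr|_ _ ep _] := @eq_pluses (tminus N m%:Z i (fa A) (N - l))
  (tplus N m%:Z i (fa A) (N - l)) (fun r => (gtpat A r l.+1)%:Z - (gtpat A r l)%:Z)
  (fun r => (gtpat A r l)%:Z - (gtpat A r l.-1)%:Z) i.
- by have [] := gtpat_lines hl hr.
- by have [] := gtpat_lines hl hr.
rewrite -ep in hT.
have [|T' [-> cT']] := hT; first by have [_ ->] := Phi_phi_eps hl.
set p := plus_pos _ _ _ in hX cT'.
have eg' r v : (r < i)%N -> (v <= n.+1)%N -> gtpat A' r v = (gtpat A r v - ((r == p) && (v == l)))%N.
  move=> hr hv; have := gtpatE v vA hr; have := gtpatE v vA' hr; rewrite hX //.
  have -> : (N.+1 + r - v == (N - l + r).+1)%N = (v == l) by lia.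
  by case: (_ && _); lia.
congr Some; apply: (@counts_eq n i m _ _ (gtpat A') (gtpat A')) => //.
- exact: gtpat_pattern.
- by move=> r c v hv; rewrite eg' // cT'.
- exact: counts_tab_of (gtpat_pattern vA').
Qed.
End Valid.
End ArrayPattern.

(** * The isomorphism and promotion *)

Section PatternCorners.
Variables (n i m : nat) (x : nat -> nat -> nat).
Hypothesis px : pattern n i m x.

Lemma pattern_zero r v : (r < i)%N -> (v <= r)%N -> (v <= n.+1)%N -> x r v = 0%N.
Proof.
have [p1 p2 p3 p4] := px; elim: r v => [|r IH] [|v] hr hv hvn; rewrite ?p3 //.
by have := p2 r v hr hvn; rewrite IH //; lia.
Qed.

(** Row r of a tableau has i-1-r boxes below each of its boxes, so its entries are
    at most n+2+r-i. *)
Lemma pattern_full r v : (r < i)%N -> (n.+2 + r - i <= v)%N -> (v <= n.+1)%N -> x r v = m.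
Proof.
have [p1 p2 p3 p4] := px; move=> hr; move: {2}(i - r)%N (leqnn (i - r)) => d.
elim: d r v hr => [|d IH] r v hr hd h1 h2; first by lia.
have le_m := pattern_le px hr h2.
case: (v =P n.+1) => [->|ne]; first exact: p4.
have hr1 : (r.+1 < i)%N by lia.
by have := p2 r v hr1; rewrite IH; lia.
Qed.
End PatternCorners.

(** The values at v determine those at v-1. *)
Lemma toggled_unique n i x z z' : toggled n i x z -> toggled n i x z' ->
    (forall r, (r < i)%N -> z r n = z' r n) ->
  forall r v, (r < i)%N -> (v <= n)%N -> z r v = z' r v.
Proof.
move=> zT zT' e r v hr hv; rewrite -(subKn hv).
move: (n - v)%N (leq_subr v n) r hr => d {v hv}.
elim: d => [|d IH] hd r hr; first by rewrite subn0 e.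
have hv : (0 < n - d <= n)%N by lia.
have := zT r _ hr hv; have := zT' r _ hr hv.
rewrite (_ : (n - d).-1 = n - d.+1)%N; last by lia.
have {}IH := IH (ltnW hd).
have -> : (if r.+1 < i then z r.+1 (n - d)%N else 0)%N =
          (if r.+1 < i then z' r.+1 (n - d)%N else 0)%N by case: ifP => // h; rewrite IH.
by rewrite IH //; lia.
Qed.

(** A letter l > r+1 in row r is a minus sign for the index l-1; the rows above
    contain, by induction, no letter l-1 to match it, so it would survive. *)
Lemma highest_counts n i m (T : tableau i m) : is_ssyt n T ->
    (forall l, (0 < l <= n)%N -> tableau_eps l T = 0) ->
  exists x, [/\ pattern n i m x, counts n T x &
    forall r v, (r < i)%N -> (v <= n.+1)%N -> x r v = if (v <= r)%N then 0%N else m].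
Proof.
move=> sT hE; have [x [px Tx]] := ssyt_counts sT; exists x; split=> // r v hr hv.
case: leqP => hvr; first exact: (pattern_zero px hr hvr hv).
have [p1 p2 p3 p4] := px.
have [d hd] := ubnP r; elim: d r hd v hr hv hvr => // d IH r hd v hr hv hvr.
have step l : (r < l <= n)%N -> x r l.+1 = x r l.
  move=> hl; have hl' : (0 < l <= n)%N by lia.
  have := hE l hl'; have [_ -> _] := tableau_lines sT px Tx hl'.
  pose b q : int := (x q l.+1)%:Z - (x q l)%:Z; pose a q : int := (x q l)%:Z - (x q l.-1)%:Z.
  rewrite -/b -/a => hm.
  have a0 q : (q < r)%N -> a q = 0.
    by move=> hq; rewrite /a !IH ?subrr //; lia.
  have b0 q : (q < r)%N -> 0 <= b q.
    by move=> hq; rewrite /b; have := p1 q l; lia.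
  have mono k : (r.+1 <= k)%N -> minuses b a r.+1 <= minuses b a k.
    elim: k => [//|k IHk]; rewrite leq_eqVlt => /orP[/eqP-> //|h].
    by apply: le_trans (IHk h) _ => /=; lia.
  have := mono i hr; rewrite hm /= (pluses_zero a0 b0).
  have hln : (l <= n)%N by lia.
  have := minuses_ge0 b a r; move: (minuses b a r) => M; rewrite /b.
  by have := p1 r l hr hln; lia.
rewrite -(p4 r hr); have -> : v = (n.+1 - (n.+1 - v))%N by lia.
have : (n.+1 - (n.+1 - v) > r)%N by lia.
move: (n.+1 - v)%N => e; elim: e => [|e IHe] he; first by rewrite subn0.
have <- : x r (n.+1 - e)%N = x r n.+1 by apply: IHe; lia.
have ee : (n.+1 - e = (n.+1 - e.+1).+1)%N by lia.
by rewrite ee step //; lia.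
Qed.

Section Main.
Variables n i m : nat.
Hypothesis hi : (1 <= i <= n)%N.
Local Notation N := n.+1.
Local Notation N0 := (n.+1 - i)%N.
Local Notation X A := (nabove N m%:Z i (fa A)).
Implicit Types A B : array n i.

Lemma Phi_f A l : valid N m%:Z i (fa A) -> (0 < l <= n)%N ->
  tableau_f l (Phi m A) = omap (@Phi n i m) (array_f m l A).
Proof.
move=> vA hl; have [_ ephi] := Phi_phi_eps hi vA hl.
case: (ltrP 0 (array_phi m l A)) => h.
  by have [A' [-> _ ->]] := Phi_f_pos hi vA hl h.
have e0 : array_phi m l A = 0 by move: h; rewrite -ephi /tableau_phi; lia.
rewrite /array_f e0 eqxx; move: ephi; rewrite e0 /tableau_phi /tableau_f.
by case: plus_boxes.
Qed.

Lemma Phi_e A l : valid N m%:Z i (fa A) -> (0 < l <= n)%N ->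
  tableau_e l (Phi m A) = omap (@Phi n i m) (array_e l A).
Proof.
move=> vA hl; have [eeps _] := Phi_phi_eps hi vA hl.
case: (ltrP 0 (array_eps l A)) => h.
  have [A' [-> vA' fA']] := array_e_crystal hi vA hl h.
  by have := Phi_f vA' hl; rewrite fA' /= => /tableau_e_f.
have e0 : array_eps l A = 0 by move: h; rewrite -eeps /tableau_eps; lia.
rewrite /array_e e0 eqxx; move: eeps; rewrite e0 /tableau_eps /tableau_e.
by case: minus_boxes.
Qed.

Lemma Phi_inj A B : valid N m%:Z i (fa A) -> valid N m%:Z i (fa B) ->
  Phi m A = Phi m B -> A = B.
Proof.
move=> vA vB eAB; apply: fa_inj => //.
have le_gt (C : array n i) : valid N m%:Z i (fa C) ->
    forall r v, (r < i)%N -> (v <= n.+1)%N -> (gtpat m C r v <= m)%N.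
  by move=> vC r v hr hv; apply: (pattern_le (gtpat_pattern hi vC) hr hv).
have cA := Phi_counts hi vA; rewrite eAB in cA.
have eg := counts_fun cA (Phi_counts hi vB) (le_gt A vA) (le_gt B vB).
apply: (@nabove_inj N m%:Z i) => r j hr.
case: (ltnP N j) => hj; first by rewrite !nabove_full.
case: (leqP j i) => hji; first by rewrite !nabove_fo // (_ : j - i = 0)%N ?nabove0 //; lia.
have hv : (N.+1 + r - j <= N)%N by lia.
have := eg r _ hr hv => e.
have := gtpatE hi (N.+1 + r - j)%N vA hr; have := gtpatE hi (N.+1 + r - j)%N vB hr.
by rewrite e subKn; [lia|lia].
Qed.

(** The pattern of the tableau prescribes the boundary values of the array without
    offset; the values for j <= i are forced by [pattern_full]. *)
Lemma Phi_onto (T : tableau i m) : is_ssyt n T ->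
  exists2 A : array n i, valid N m%:Z i (fa A) & Phi m A = T.
Proof.
move=> /ssyt_counts [x [px Tx]]; have [p1 p2 p3 p4] := px.
(* the first case avoids truncation: there the pattern has value m *)
pose Y r j : int := if j is 0%N then 0 else m%:Z - (x r (N.+1 + r - i - j)%N)%:Z.
have [||||//|a [va hY]] := @nabove_onto N0 m%:Z i Y.
- by [].
- move=> r [|j] hr hj //=; rewrite (pattern_zero px) //; lia.
- move=> r [|j] hr /=.
    have hv : (N.+1 + r - i - 1 <= N)%N by lia.
    by have := pattern_le px hr hv; lia.
  have hv : (N.+1 + r - i - j.+2 <= N.+1 + r - i - j.+1 <= N)%N by lia.
  by have := pattern_mono px hr hv; lia.
- move=> r [|j] hr //=; case: (leqP (N.+1 + r.+1) (i + j.+1)) => h.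
    rewrite (_ : N.+1 + r.+1 - i - j.+1 = 0)%N; last by lia.
    rewrite (_ : N.+1 + r - i - j.+1 = 0)%N; last by lia.
    by rewrite !p3 //; lia.
  rewrite (_ : N.+1 + r.+1 - i - j.+1 = (N.+1 + r - i - j.+1).+1)%N; last by lia.
  have hv : (N.+1 + r - i - j.+1 <= n)%N by lia.
  by have := p2 r _ hr hv; lia.
pose A := mk_array n i (fun p q => a (i - p) (n - q))%N.
have fA r j : (r < i)%N -> (j < N0)%N -> a r j = fo A r j.
  move=> hr hj; rewrite /fo entry_mk; [|lia..].
  by congr a; lia.
have vA : valid N m%:Z i (fa A) by apply/(valid_fo m hi); apply: eq_valid va.
exists A => //; have gA := gtpat_pattern hi vA.
apply: (counts_eq gA (Phi_counts hi vA) Tx) => r v hr hv.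
have := gtpatE hi v vA hr; rewrite nabove_fo // -(eq_nabove m%:Z fA) // hY // /Y.
case E : (N.+1 + r - v - i)%N => [|j] h.
  by rewrite (pattern_full px hr) //; lia.
case: (leqP v r) => hvr; first by move: h; rewrite !(pattern_zero px) //; lia.
by move: h; rewrite (_ : N.+1 + r - i - j.+1 = v)%N; lia.
Qed.

Lemma Phi_iso : crystal_iso (B := Bmi n i m) (C := SSYT n i m) (@Phi n i m).
Proof.
split=> [|A /(in_BmiP hi) vA|l A hl /(in_BmiP hi) vA|l A hl /(in_BmiP hi) vA] /=.
- split=> [A /(in_BmiP hi) vA|A B /(in_BmiP hi) vA /(in_BmiP hi) vB|T /Phi_onto [A vA <-]].
  + exact: Phi_ssyt.
  + exact: Phi_inj.
  + by exists A => //; apply/in_BmiP.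
- exact: Phi_wt.
- exact: Phi_phi_eps.
- by rewrite Phi_e // Phi_f.
Qed.

(** A potential that increases by 1 under lowering operators; the uniqueness proof
    is an induction on it. *)
Definition height A : nat := \sum_(r < i) \sum_(v < n.+2) `|X A r (N.+1 + r - v)%N|%N.

Lemma height_f A A' l : valid N m%:Z i (fa A) -> (0 < l <= n)%N ->
  0 < array_phi m l A -> array_f m l A = Some A' -> (height A < height A')%N.
Proof.
move=> vA hl hphi fA; have := array_f_crystal hi vA hl hphi; rewrite fA.
case=> _ [[<-] vA' hX]; set p := plus_pos _ _ _ in hX.
have i0 : (0 < i)%N by lia.
have hp : (p < i)%N by apply: plus_pos_lt.
have hl2 : (l < n.+2)%N by lia.
have e (r : 'I_i) (v : 'I_n.+2) : `|X A' r (N.+1 + r - v)%N|%N =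
    (`|X A r (N.+1 + r - v)| + ((r == Ordinal hp) && (v == Ordinal hl2)))%N.
  have hr := ltn_ord r; have hv := ltn_ord v.
  rewrite -!val_eqE /= hX // (_ : (N.+1 + r - v == (N - l + r).+1)%N = (v == l :> nat)).
    have /andP[X0 _] := nabove_ge0 (N.+1 + r - v)%N vA hr.
    by case: (_ && _); lia.
  by lia.
rewrite /height (bigD1 (Ordinal hp)) // [Z in (_ < Z)%N](bigD1 (Ordinal hp)) //.
rewrite (bigD1 (Ordinal hl2)) // [Z in (_ < Z + _)%N](bigD1 (Ordinal hl2)) //.
rewrite e !eqxx /= addn1 !addSn ltnS -!addnA leq_add2l.
have le_e r v := leq_trans (leq_addr _ _) (eq_leq (esym (e r v))).
apply: leq_add; first by apply: leq_sum => v _; apply: (le_e (Ordinal hp)).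
by apply: leq_sum => r _; apply: leq_sum => v _; apply: le_e.
Qed.

(** An array with some epsilon nonzero is a lowering of an array of smaller height,
    on which the two maps agree; otherwise both images are the highest weight
    tableau. *)
Lemma Phi_unique (Psi : array n i -> tableau i m) :
    crystal_iso (B := Bmi n i m) (C := SSYT n i m) Psi ->
  forall A, in_Bmi m A -> Psi A = Phi m A.
Proof.
move=> [[/= S1 _ _] _ S3 S4] A bA; have [s hs] := ubnP (height A).
elim: s A hs bA => // s IH A hs bA; have vA := (in_BmiP hi m A).1 bA.
case: (boolP [exists l : 'I_n, array_eps l.+1 A != 0]) => [/existsP[l hE]|hw].
  have hl : (0 < l.+1 <= n)%N by have := ltn_ord l.
  have eps_gt0 : 0 < array_eps l.+1 A.
    have [e _] := Phi_phi_eps hi vA hl.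
    by move: hE; rewrite -e /tableau_eps; lia.
  have [B [_ vB fB]] := array_e_crystal hi vA hl eps_gt0.
  have bB : in_Bmi m B by apply/in_BmiP.
  have hphi : 0 < array_phi m l.+1 B.
    have [_ e] := Phi_phi_eps hi vB hl.
    move: fB; rewrite /array_f; case: eqP => // ne _.
    by move: ne; rewrite -e /tableau_phi; lia.
  have hB := height_f vB hl hphi fB.
  have [_] := S4 _ _ hl bB; rewrite /= fB IH //; last by lia.
  by rewrite Phi_f // fB => -[].
have eps0 l : (0 < l <= n)%N -> array_eps l A = 0.
  case: l => // l hl; apply/eqP; move: hw; rewrite negb_exists => /forallP /(_ (Ordinal hl)).
  by rewrite negbK.
have [|x [px Tx ex]] := highest_counts (S1 A bA).
  by move=> l hl; have [/= -> _] := S3 l A hl bA; apply: eps0.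
have [|y [py Ty ey]] := highest_counts (Phi_ssyt hi vA).
  by move=> l hl; have [-> _] := Phi_phi_eps hi vA hl; apply: eps0.
by apply: (counts_eq px Tx Ty) => r v hr hv; rewrite ex ?ey.
Qed.

Lemma valid_pr A : valid N m%:Z i (fa A) -> valid N m%:Z i (fa (pr m A)).
Proof.
move=> /(valid_fo m hi) vA; apply/(valid_fo m hi).
apply: eq_valid (valid_rowmotion vA) => x y hx hy.
by rewrite fo_pr.
Qed.

(** The formula of [nabove_rowmotion], complemented to m.  Outside of the range of
    that formula the patterns are constant, equal to m or 0, and the relation is
    trivial. *)
Lemma gtpat_toggled A : valid N m%:Z i (fa A) ->
  toggled n i (gtpat m A) (fun r v => gtpat m (pr m A) r v.+1).
Proof.
move=> vA r v hr hv; have vP := valid_pr vA.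
have gA := gtpat_pattern hi vA; have gP := gtpat_pattern hi vP.
have v0 : v.-1.+1 = v by lia.
rewrite v0.
case: (leqP (n.+2 + r - i) v) => hlo.
  have hr1 : (r.+1 < i)%N by lia.
  have hvn : (v <= n.+1)%N by lia.
  have f1 := pattern_full gA hr hlo hvn.
  have f2 := pattern_full gP hr hlo hvn.
  have f3 : gtpat m (pr m A) r.+1 v.+1 = m by apply: (pattern_full gP hr1); lia.
  have f4 : gtpat m (pr m A) r v.+1 = m by apply: (pattern_full gP hr); lia.
  rewrite hr1 f1 f2 f3 f4.
  have e : (maxn m (gtpat m A r v.-1) = m)%N.
    have hv1 : (v.-1 <= n.+1)%N by lia.
    by have := pattern_le gA hr hv1; lia.
  rewrite e; case: r hr hr1 hlo {e f1 f2 f3 f4} => [//|r] hr hr1 hlo.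
  by rewrite (pattern_full gA) ?minnn //; lia.
case: (leqP v r) => hhi.
  have f1 : gtpat m A r v = 0%N by apply: (pattern_zero gA hr); lia.
  have f2 : gtpat m (pr m A) r v = 0%N by apply: (pattern_zero gP hr); lia.
  have f3 : gtpat m A r v.-1 = 0%N by apply: (pattern_zero gA hr); lia.
  have f4 : (if r.+1 < i then gtpat m (pr m A) r.+1 v.+1 else 0)%N = 0%N.
    by case: ifP => h //; apply: (pattern_zero gP h); lia.
  rewrite f1 f2 f3 f4 {f1 f2 f3 f4}.
  case: r hr hlo hhi => [|r] hr hlo hhi; first by lia.
  by rewrite (pattern_zero gA) ?min0n //; lia.
have [j ej] : exists j, (N.+1 + r - v - i = j.+1)%N by exists (N.+1 + r - v - i).-1; lia.
have hj : (j < N0)%N by lia.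
have vfo := (valid_fo m hi A).1 vA.
have eA q w k : (q < i)%N -> (N.+1 + q - w - i)%N = k ->
    (gtpat m A q w)%:Z = m%:Z - nabove N0 m%:Z i (fo A) q k.
  by move=> hq <-; rewrite gtpatE // nabove_fo.
have eP q w k : (q < i)%N -> (N.+1 + q - w - i)%N = k ->
    (gtpat m (pr m A) q w)%:Z = m%:Z - nabove N0 m%:Z i (rowmotion N0 m%:Z i (fo A)) q k.
  move=> hq <-; rewrite gtpatE // nabove_fo //; congr (_ - _); apply: eq_nabove => // x y hx hy.
  by rewrite fo_pr.
have := nabove_rowmotion m%:Z (fo A) hr hj; cbv zeta.
have a1 := eA r v j.+1 hr ej.
have a2 : (gtpat m A r v.-1)%:Z = m%:Z - nabove N0 m%:Z i (fo A) r j.+2 by apply: eA => //; lia.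
have b1 := eP r v j.+1 hr ej.
have b0 : (gtpat m (pr m A) r v.+1)%:Z = m%:Z - nabove N0 m%:Z i (rowmotion N0 m%:Z i (fo A)) r j.
  by apply: eP => //; lia.
have Y0 : 0 <= nabove N0 m%:Z i (rowmotion N0 m%:Z i (fo A)) r j.
  by have /andP[] := nabove_ge0 j (valid_rowmotion vfo) hr.
have e1 : (r.+1 < i)%N -> (gtpat m (pr m A) r.+1 v.+1)%:Z =
    m%:Z - nabove N0 m%:Z i (rowmotion N0 m%:Z i (fo A)) r.+1 j.+1.
  by move=> h; apply: eP => //; lia.
have e2 q : r = q.+1 -> (gtpat m A q v.-1)%:Z = m%:Z - nabove N0 m%:Z i (fo A) q j.+1.
  by move=> eq; apply: eA; lia.
case: (ltnP r.+1 i) e1 => h e1.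
  have {}e1 := e1 isT.
  by case: r e2 {hr hlo hhi ej h} Y0 a1 a2 b1 b0 e1 => [|q] e2 Y0 a1 a2 b1 b0 e1;
    [|have := e2 q erefl]; lia.
by case: r e2 {hr hlo hhi ej h e1} Y0 a1 a2 b1 b0 => [|q] e2 Y0 a1 a2 b1 b0;
  [|have := e2 q erefl]; lia.
Qed.

Lemma Phi_pr A : valid N m%:Z i (fa A) -> Phi m (pr m A) = promotion n (Phi m A).
Proof.
move=> vA; have vP := valid_pr vA.
have i0 : (0 < i)%N by lia.
have n0 : (0 < n)%N by lia.
have gA := gtpat_pattern hi vA; have gP := gtpat_pattern hi vP.
have [z [zm zn zT zc]] := promotion_counts i0 n0 (Phi_ssyt hi vA) gA (Phi_counts hi vA).
have ez := toggled_unique (gtpat_toggled vA) zT.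
have {}ez r v : (r < i)%N -> (v <= n)%N -> gtpat m (pr m A) r v.+1 = z r v.
  by apply: ez => q hq; rewrite zn //; have [_ _ _ p4] := gP; apply: p4.
apply: (counts_eq gP (Phi_counts hi vP)) => // r c [|v] hv.
  by rewrite zc //; have [_ _ p3 _] := gP; rewrite p3.
by rewrite zc // ez.
Qed.
End Main.

Theorem theorem6p2p1 (n i m : nat) (hn : (1 <= n)%N) (hi : (1 <= i <= n)%N) :
  (forall A : array n i, in_Bmi m A -> in_Bmi m (pr m A)) /\
  exists Phi : array n i -> tableau i m,
    [/\ crystal_iso (B := Bmi n i m) (C := SSYT n i m) Phi,
        forall Psi : array n i -> tableau i m,
          crystal_iso (B := Bmi n i m) (C := SSYT n i m) Psi ->
          forall A : array n i, in_Bmi m A -> Psi A = Phi A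
      & forall A : array n i, in_Bmi m A -> Phi (pr m A) = promotion n (Phi A)].
Proof.
split=> [A /(in_BmiP hi) vA|]; first by apply/(in_BmiP hi); apply: valid_pr.
exists (@Phi n i m); split.
- exact: Phi_iso.
- by move=> Psi /(Phi_unique hi).
- by move=> A /(in_BmiP hi) vA; apply: Phi_pr.
Qed.
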